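(* Let $K$ be a commutative artinian ring, let $A$ and $B$ be basic Artin $K$-algebras and let $M$ and $N$ be a finitely generated $A$-$B$-bimodule and $B$-$A$-bimodule, respectively. Suppose that $B$ has finite global dimension and $\mathcal{P}^{<\infty}(A\text{-mod})$ is contravariantly finite in $A\text{-mod}$. The following assertions hold: (1) If $\Lambda=\begin{pmatrix}A&0\\N&B\end{pmatrix}$, then $\mathcal{P}^{<\infty}(\Lambda\text{-mod})$ is contravariantly finite in $\Lambda\text{-mod}$. Moreover, if $A\text{-mod}$ allows for unlimited iteration of strong tilting, so does $\Lambda\text{-mod}$. (2) If $\operatorname{pdim}({}_AM)<\infty$ and $\Gamma=\begin{pmatrix}A&M\\0&B\end{pmatrix}$, then $\mathcal{P}^{<\infty}(\Gamma\text{-mod})$ is contravariantly finite in $\Gamma\text{-mod}$. Moreover, if $A\text{-mod}$ allows for unlimited iteration of strong tilting, so does $\Gamma\text{-mod}$.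
   Context: Bimodules are assumed to have the same action of $K$ on the left and on the right. For an Artin algebra $A$, $A\text{-mod}$ (resp. $\text{mod-}A$) is the category of finitely generated left (resp. right) $A$-modules, and $\mathcal{P}^{<\infty}(A\text{-mod})$ (resp. $\mathcal{P}^{<\infty}(\text{mod-}A)$) its full subcategory of modules of finite projective dimension. $A$ is basic if $A/J(A)$ is a product of division rings; a module is basic if it has no indecomposable direct summand of multiplicity $>1$. $\mathcal{P}^{<\infty}(A\text{-mod})$ is contravariantly finite in $A\text{-mod}$ if for each $X\in A\text{-mod}$ there is a map $\phi:Y\to X$ with $Y\in\mathcal{P}^{<\infty}(A\text{-mod})$ through which every homomorphism from an object of $\mathcal{P}^{<\infty}(A\text{-mod})$ to $X$ factors. A module $T\in A\text{-mod}$ is a tilting module if (1) $T\in\mathcal{P}^{<\infty}(A\text{-mod})$, (2) $\operatorname{Ext}^i_A(T,T)=0$ for $i\ge1$, (3) there is an exact sequence $0\to A\to T_0\to\cdots\to T_s\to0$ with all $T_j\in\operatorname{add}(T)$. It is strong if, in addition, $\operatorname{Ext}^i_A(X,T)=0$ for all $X\in\mathcal{P}^{<\infty}(A\text{-mod})$ and $i\ge1$. Similarly for right modules. If $A\text{-mod}$ has a strong tilting module, the basic one is unique up to isomorphism. For basic Artin algebras $C,D$: $\text{mod-}D$ results from $C\text{-mod}$ via strong tilting if $C\text{-mod}$ has a basic strong tilting module $T$ and $D\cong\operatorname{End}_C(T)^{\mathrm{op}}$; $D\text{-mod}$ results from $\text{mod-}C$ via strong tilting if $\text{mod-}C$ has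 a basic strong tilting module $T$ and $D\cong\operatorname{End}_C(T)$. The category $C\text{-mod}$ allows for unlimited iteration of strong tilting if there is an infinite sequence of basic algebras $(C_i)_{i\ge0}$ with $C_0=C$ such that $\text{mod-}C_{i+1}$ results from $C_i\text{-mod}$ via strong tilting for $i$ even, and $C_{i+1}\text{-mod}$ results from $\text{mod-}C_i$ via strong tilting for $i$ odd. *)

(* Defs.v *)
From HB Require Import structures.
From mathcomp Require Import all_boot all_algebra.

Set Implicit Arguments.
Unset Strict Implicit.
Unset Printing Implicit Defensive.

Import GRing.Theory.
Local Open Scope ring_scope.

(* Left modules over R are [lmodType R]; right modules over R are left modules
   over the converse ring, [lmodType R^c].  Every module-theoretic notion below
   is stated for left modules over a ring and is used at R and at R^c. *)

Section Modules.
Variable R : nzRingType.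
Implicit Types X Y T : lmodType R.

Definition fin_gen X : Prop :=
  exists (n : nat) (g : 'I_n -> X),
    forall x : X, exists c : 'I_n -> R, x = \sum_(i < n) c i *: g i.

Definition zero_mod X : Prop := forall x : X, x = 0.

Definition lmod_iso X Y : Prop :=
  exists (f : {linear X -> Y}) (g : {linear Y -> X}), cancel f g /\ cancel g f.

Definition direct_summand X Y : Prop :=
  exists (i : {linear X -> Y}) (p : {linear Y -> X}), cancel i p.

Definition add_closure T X : Prop :=
  exists n : nat, direct_summand X {ffun 'I_n -> T}.

Definition indecomposable X : Prop :=
  ~ zero_mod X /\
  forall U V : lmodType R, lmod_iso X (U * V)%type -> zero_mod U \/ zero_mod V.

Definition basic_mod X : Prop :=
  forall Y, indecomposable Y -> ~ direct_summand (Y * Y)%type X.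

Definition exact_at X Y T (f : {linear X -> Y}) (g : {linear Y -> T}) : Prop :=
  forall y : Y, g y = 0 <-> exists x : X, f x = y.

Definition projective P : Prop :=
  forall (X Y : lmodType R) (g : {linear X -> Y}) (f : {linear P -> Y}),
    (forall y, exists x, g x = y) ->
    exists h : {linear P -> X}, forall p, g (h p) = f p.

Record proj_resolution X := ProjResolution {
  res_obj : nat -> lmodType R;
  res_diff : forall i, {linear res_obj i.+1 -> res_obj i};
  res_aug : {linear res_obj 0%N -> X};
  res_projective : forall i, projective (res_obj i);
  res_aug_surj : forall x : X, exists p, res_aug p = x;
  res_exact0 : exact_at (res_diff 0%N) res_aug;
  res_exactS : forall i, exact_at (res_diff i.+1) (res_diff i)
}.

Definition pdim_le (n : nat) X : Prop :=
  exists P : proj_resolution X, forall i, (n < i)%N -> zero_mod (res_obj P i).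

Definition fin_pdim X : Prop := exists n : nat, pdim_le n X.

(* Ext^{i+1}(X, Y) = 0: the cohomology of Hom(P, Y) vanishes in degree i+1, for
   P a projective resolution of X. *)
Definition ExtS_vanishes (i : nat) X Y : Prop :=
  forall (P : proj_resolution X) (f : {linear res_obj P i.+1 -> Y}),
    (forall p, f (res_diff P i.+1 p) = 0) ->
    exists g : {linear res_obj P i -> Y}, forall p, f p = g (res_diff P i p).

(* X is an object of P^{<oo}(R-mod). *)
Definition Pfin X : Prop := fin_gen X /\ fin_pdim X.

Definition fin_gldim : Prop :=
  exists n : nat, forall X, pdim_le n X.

Definition Pfin_contravariantly_finite : Prop :=
  forall X, fin_gen X ->
    exists (Y : lmodType R) (phi : {linear Y -> X}), Pfin Y /\
      forall (Z : lmodType R) (f : {linear Z -> X}), Pfin Z ->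
        exists g : {linear Z -> Y}, forall z, f z = phi (g z).

(* 0 -> R -> T_0 -> ... -> T_s -> 0 is encoded by a sequence of modules indexed
   by nat which vanish beyond s, so that exactness at T_s is surjectivity onto
   T_s of the previous map. *)
Definition has_add_coresolution T : Prop :=
  exists (s : nat) (C : nat -> lmodType R) (iota : {linear R^o -> C 0%N})
         (d : forall j, {linear C j -> C j.+1}),
    [/\ forall j, (j <= s)%N -> add_closure T (C j),
        forall j, (s < j)%N -> zero_mod (C j),
        injective iota,
        exact_at iota (d 0%N)
      & forall j, exact_at (d j) (d j.+1)].

Definition tilting T : Prop :=
  [/\ Pfin T, forall i, ExtS_vanishes i T T & has_add_coresolution T].

Definition strong_tilting T : Prop :=
  tilting T /\ forall X, Pfin X -> forall i, ExtS_vanishes i X T.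

End Modules.

Section Rings.
Variable R : nzRingType.

Definition left_ideal (I : R -> Prop) : Prop :=
  [/\ I 0, forall x y, I x -> I y -> I (x + y) & forall a x, I x -> I (a * x)].

Definition maximal_left_ideal (I : R -> Prop) : Prop :=
  [/\ left_ideal I, ~ I 1
    & forall J : R -> Prop, left_ideal J -> ~ J 1 ->
        (forall x, I x -> J x) -> forall x, J x -> I x].

Definition jacobson_radical (x : R) : Prop :=
  forall I, maximal_left_ideal I -> I x.

Definition division_ring (D : nzRingType) : Prop :=
  forall x : D, x <> 0 -> exists y : D, x * y = 1 /\ y * x = 1.

(* The map a |-> (pi_i a)_i to the product of the D_i is onto, with kernel
   J(R); that is, it induces an isomorphism from R/J(R) to the product. *)
Definition basic_ring : Prop :=
  exists (n : nat) (D : 'I_n -> nzRingType) (pi : forall i, {rmorphism R -> D i}),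
    [/\ forall i, division_ring (D i),
        forall d : (forall i, D i), exists a : R, forall i, pi i a = d i
      & forall a : R, (forall i, pi i a = 0) <-> jacobson_radical a].

End Rings.

Definition artinian (K : comNzRingType) : Prop :=
  forall I : nat -> K -> Prop,
    (forall n, left_ideal (I n)) -> (forall n x, I n.+1 x -> I n x) ->
    exists n, forall m, (n <= m)%N -> forall x, I n x -> I m x.

Definition artin_algebra (K : comNzRingType) (A : algType K) : Prop :=
  artinian K /\ fin_gen A.

(* E and R are K-algebras through eta and theta; E is isomorphic, as a
   K-algebra, to End_R(T) with composition of maps as product. *)
Definition iso_to_End (K E R : nzRingType) (eta : K -> E) (theta : K -> R)
    (T : lmodType R) : Prop :=
  exists phi : E -> {linear T -> T},
    [/\ forall x y t, phi (x + y) t = phi x t + phi y t,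
        forall x y t, phi (x * y) t = phi x (phi y t),
        forall k t, phi (eta k) t = theta k *: t,
        forall x y, phi x =1 phi y -> x = y
      & forall f : {linear T -> T}, exists x, phi x =1 f].

Section Iteration.
Variable K : comNzRingType.
Implicit Types C D : algType K.

(* mod-D results from C-mod: D^op is isomorphic to End_C(T). *)
Definition strong_tilts_left_to_right C D : Prop :=
  exists T : lmodType C,
    [/\ basic_mod T, strong_tilting T
      & @iso_to_End K D^c C (in_alg D) (in_alg C) T].

(* D-mod results from mod-C: D is isomorphic to End_C(T). *)
Definition strong_tilts_right_to_left C D : Prop :=
  exists T : lmodType C^c,
    [/\ basic_mod T, strong_tilting T
      & @iso_to_End K D C^c (in_alg D) (in_alg C) T].

Definition unlimited_strong_tilting C : Prop :=
  exists S : nat -> algType K,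
    [/\ S 0%N = C,
        forall i, artin_algebra (S i) /\ basic_ring (S i),
        forall i, ~~ odd i -> strong_tilts_left_to_right (S i) (S i.+1)
      & forall i, odd i -> strong_tilts_right_to_left (S i) (S i.+1)].

End Iteration.

HB.mixin Record Lmodule_isBimodule (K : comNzRingType) (A B : algType K) M
    of GRing.Lmodule A M := {
  ract : M -> B -> M;
  ractDl : forall m m' b, ract (m + m') b = ract m b + ract m' b;
  ractDr : forall m b b', ract m (b + b') = ract m b + ract m b';
  ractA : forall m b b', ract (ract m b) b' = ract m (b * b');
  ract1 : forall m, ract m 1 = m;
  ract_scale : forall (a : A) m b, ract (a *: m) b = a *: ract m b;
  (* K acts in the same way on the left and on the right. *)
  ract_alg : forall (k : K) m, ract m k%:A = (k%:A : A) *: m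
}.

#[short(type="bimodType")]
HB.structure Definition Bimodule (K : comNzRingType) (A B : algType K) :=
  {M of GRing.Lmodule A M & Lmodule_isBimodule K A B M}.

Definition fin_gen_bimod (K : comNzRingType) (A B : algType K)
    (M : bimodType A B) : Prop :=
  exists (n : nat) (g : 'I_n -> M), forall m : M, exists t : seq (A * 'I_n * B),
    m = \sum_(x <- t) ract (x.1.1 *: g x.1.2) x.2.

(* (a, m, b) stands for the matrix with rows (a, m) and (0, b). *)
Definition upper_tri (K : comNzRingType) (A B : algType K) (M : bimodType A B)
  : Type := (A * M * B)%type.

(* (a, n, b) stands for the matrix with rows (a, 0) and (n, b). *)
Definition lower_tri (K : comNzRingType) (A B : algType K) (N : bimodType B A)
  : Type := (A * N * B)%type.

Section BimoduleTheory.
Variables (K : comNzRingType) (A B : algType K) (M : bimodType A B).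

Lemma ract0 (b : B) : ract (0 : M) b = 0.
Proof. by apply: (addrI (ract (0 : M) b)); rewrite -ractDl !addr0. Qed.

Lemma ract_alg_scale (k : K) (m : M) (b : B) :
  ract m (k *: b) = (k%:A : A) *: ract m b.
Proof. by rewrite -[b in LHS]mul1r scalerAl -ractA ract_alg ract_scale. Qed.

End BimoduleTheory.

Section UpperTriangular.
Variables (K : comNzRingType) (A B : algType K) (M : bimodType A B).
Local Notation U := (upper_tri M).

HB.instance Definition _ := GRing.Zmodule.copy U (A * M * B)%type.

Definition ut_one : U := (1, 0, 1).

Definition ut_mul (x y : U) : U :=
  (x.1.1 * y.1.1, x.1.1 *: y.1.2 + ract x.1.2 y.2, x.2 * y.2).

Definition ut_scale (k : K) (x : U) : U := (k *: x.1.1, k%:A *: x.1.2, k *: x.2).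

Lemma ut_eq (x y : U) : x.1.1 = y.1.1 -> x.1.2 = y.1.2 -> x.2 = y.2 -> x = y.
Proof. by case: x y => [[? ?] ?] [[? ?] ?] /= -> -> ->. Qed.

Fact ut_mulA : associative ut_mul.
Proof.
move=> x y z; apply: ut_eq => /=; rewrite ?mulrA //.
by rewrite scalerDr scalerA ractDl ract_scale ractA addrA.
Qed.

Fact ut_mul1 : left_id ut_one ut_mul.
Proof. by move=> x; apply: ut_eq; rewrite /= ?mul1r // ract0 scale1r addr0. Qed.

Fact ut_mulr1 : right_id ut_one ut_mul.
Proof. by move=> x; apply: ut_eq; rewrite /= ?mulr1 // scaler0 ract1 add0r. Qed.

Fact ut_mulDl : left_distributive ut_mul +%R.
Proof.
move=> x y z; apply: ut_eq; rewrite /= ?mulrDl //.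
by rewrite scalerDl ractDl addrACA.
Qed.

Fact ut_mulDr : right_distributive ut_mul +%R.
Proof.
move=> x y z; apply: ut_eq; rewrite /= ?mulrDr //.
by rewrite scalerDr ractDr addrACA.
Qed.

Fact ut_one_neq0 : ut_one != 0.
Proof. by apply/eqP => -[/eqP]; rewrite oner_eq0. Qed.

HB.instance Definition _ := GRing.Zmodule_isNzRing.Build U
  ut_mulA ut_mul1 ut_mulr1 ut_mulDl ut_mulDr ut_one_neq0.

Fact ut_scaleA k l x : ut_scale k (ut_scale l x) = ut_scale (k * l) x.
Proof. by apply: ut_eq; rewrite /= ?scalerA // mulr_algl scalerA. Qed.

Fact ut_scale1 : left_id 1 ut_scale.
Proof. by move=> x; apply: ut_eq; rewrite /= !scale1r. Qed.

Fact ut_scaleDr : right_distributive ut_scale +%R.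
Proof. by move=> k x y; apply: ut_eq; rewrite /= scalerDr. Qed.

Fact ut_scaleDl x : {morph ut_scale^~ x : k l / k + l}.
Proof. by move=> k l; apply: ut_eq; rewrite /= !scalerDl. Qed.

HB.instance Definition _ := GRing.Zmodule_isLmodule.Build K U
  ut_scaleA ut_scale1 ut_scaleDr ut_scaleDl.

Fact ut_scaleAl (k : K) (x y : U) : k *: (x * y) = (k *: x) * y.
Proof.
apply: ut_eq; rewrite /= ?scalerAl //.
by rewrite scalerDr scalerA mulr_algl ract_scale.
Qed.

HB.instance Definition _ := GRing.Lmodule_isLalgebra.Build K U ut_scaleAl.

Fact ut_scaleAr (k : K) (x y : U) : k *: (x * y) = x * (k *: y).
Proof.
apply: ut_eq; rewrite /= ?scalerAr //.
by rewrite scalerDr !scalerA mulr_algl mulr_algr ract_alg_scale.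
Qed.

HB.instance Definition _ := GRing.Lalgebra_isAlgebra.Build K U ut_scaleAr.

End UpperTriangular.

Section LowerTriangular.
Variables (K : comNzRingType) (A B : algType K) (N : bimodType B A).
Local Notation L := (lower_tri N).

HB.instance Definition _ := GRing.Zmodule.copy L (A * N * B)%type.

Definition lt_one : L := (1, 0, 1).

Definition lt_mul (x y : L) : L :=
  (x.1.1 * y.1.1, ract x.1.2 y.1.1 + x.2 *: y.1.2, x.2 * y.2).

Definition lt_scale (k : K) (x : L) : L := (k *: x.1.1, k%:A *: x.1.2, k *: x.2).

Lemma lt_eq (x y : L) : x.1.1 = y.1.1 -> x.1.2 = y.1.2 -> x.2 = y.2 -> x = y.
Proof. by case: x y => [[? ?] ?] [[? ?] ?] /= -> -> ->. Qed.

Fact lt_mulA : associative lt_mul.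
Proof.
move=> x y z; apply: lt_eq => /=; rewrite ?mulrA //.
by rewrite scalerDr scalerA ractDl ract_scale ractA addrA.
Qed.

Fact lt_mul1 : left_id lt_one lt_mul.
Proof. by move=> x; apply: lt_eq; rewrite /= ?mul1r // ract0 scale1r add0r. Qed.

Fact lt_mulr1 : right_id lt_one lt_mul.
Proof. by move=> x; apply: lt_eq; rewrite /= ?mulr1 // scaler0 ract1 addr0. Qed.

Fact lt_mulDl : left_distributive lt_mul +%R.
Proof.
move=> x y z; apply: lt_eq; rewrite /= ?mulrDl //.
by rewrite scalerDl ractDl addrACA.
Qed.

Fact lt_mulDr : right_distributive lt_mul +%R.
Proof.
move=> x y z; apply: lt_eq; rewrite /= ?mulrDr //.
by rewrite scalerDr ractDr addrACA.
Qed.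

Fact lt_one_neq0 : lt_one != 0.
Proof. by apply/eqP => -[/eqP]; rewrite oner_eq0. Qed.

HB.instance Definition _ := GRing.Zmodule_isNzRing.Build L
  lt_mulA lt_mul1 lt_mulr1 lt_mulDl lt_mulDr lt_one_neq0.

Fact lt_scaleA k l x : lt_scale k (lt_scale l x) = lt_scale (k * l) x.
Proof. by apply: lt_eq; rewrite /= ?scalerA // mulr_algl scalerA. Qed.

Fact lt_scale1 : left_id 1 lt_scale.
Proof. by move=> x; apply: lt_eq; rewrite /= !scale1r. Qed.

Fact lt_scaleDr : right_distributive lt_scale +%R.
Proof. by move=> k x y; apply: lt_eq; rewrite /= scalerDr. Qed.

Fact lt_scaleDl x : {morph lt_scale^~ x : k l / k + l}.
Proof. by move=> k l; apply: lt_eq; rewrite /= !scalerDl. Qed.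

HB.instance Definition _ := GRing.Zmodule_isLmodule.Build K L
  lt_scaleA lt_scale1 lt_scaleDr lt_scaleDl.

Fact lt_scaleAl (k : K) (x y : L) : k *: (x * y) = (k *: x) * y.
Proof.
apply: lt_eq; rewrite /= ?scalerAl //.
by rewrite scalerDr scalerA mulr_algl ract_scale.
Qed.

HB.instance Definition _ := GRing.Lmodule_isLalgebra.Build K L lt_scaleAl.

Fact lt_scaleAr (k : K) (x y : L) : k *: (x * y) = x * (k *: y).
Proof.
apply: lt_eq; rewrite /= ?scalerAr //.
by rewrite scalerDr !scalerA mulr_algl mulr_algr ract_alg_scale.
Qed.

HB.instance Definition _ := GRing.Lalgebra_isAlgebra.Build K L lt_scaleAr.

End LowerTriangular.

(* Main.v *)
Require Import Defs.
From HB Require Import structures.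
From mathcomp Require Import all_boot all_algebra.
From mathcomp Require Import boolp.
From Stdlib Require List.

Set Implicit Arguments.
Unset Strict Implicit.
Unset Printing Implicit Defensive.

Import GRing.Theory.
Local Open Scope ring_scope.

(* For an idempotent e of R with eRe = A, assume that eR has finite projective dimension over A
   and that the R-modules X with eX = 0 have bounded projective dimension.  Then X is in
   P^{<oo}(R) if and only if eX is in P^{<oo}(A): the unit X -> Hom_A(eR, eX) has kernel and
   cokernel killed by e.  Hence right approximations, and Auslander-Buchweitz special
   approximations, are pulled back from A along this unit, and R inherits contravariant finiteness
   and a strong tilting module from A.  That module U contains GT := Hom_A(eR, T), where T is the
   strong tilting A-module, and GT has the same endomorphisms as T.

   The situation is preserved by strong tilting.  If D = End(U), the projection of U onto GT is
   an idempotent e' of D with e'De' = End(T), and e'D = Hom_R(U, GT) = Hom_A(eU, T) has finite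
   projective dimension over End(T).  A D-module killed by e' is Hom_R(X, U) for some X with
   eX = 0; since X then embeds in a power of U, with cokernels again in P^{<oo}(R), the projective
   dimension of Hom_R(X, U) is bounded.  Iterating from both corners proves the statement on
   unlimited iteration.

   Finally, A is such a corner of both triangular algebras.  The modules killed by e are
   B-modules; B has finite global dimension, and projective B-modules are projective over the
   lower triangular algebra, while over the upper one B is resolved by A + M. *)

(** * Modules and short exact sequences *)

(** To be pulled back along the unit, strong tilting has to be recognised without its coresolution
    of the ring. This is [STilt]: a module of P^{<oo} that is Ext-injective and cogenerating there,
    with a common bound on projective dimensions. Dimension shifting rebuilds the coresolution from
    it, and the bound makes it stop; this is why modules killed by [e] must have bounded, not merely
    finite, projective dimension. The harder direction is that a strong tilting module cogenerates
    P^{<oo}.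

    Two constraints shape the iteration. The modules must be basic, yet [GT] has to survive as a
    whole summand of [U], or the corner End(T) of End(U) is lost. Hence a Krull-Schmidt exchange
    that removes repeated summands from the complement of [GT] only, and a proof that [GT] is basic.
    Moreover each tilt passes from left to right modules or back, so corners are taken on
    alternating sides. Finiteness is therefore measured by length over [K], which does not depend on
    the side and survives corners, coinduction and endomorphism rings. *)

Section LinearMaps.
Variable R : nzRingType.

Definition lin_of (X Y : lmodType R) (f : X -> Y) (lin_f : linear f) : {linear X -> Y} :=
  HB.pack f (GRing.isLinear.Build R X Y *:%R f lin_f).
(** By linearity, a relation need only be single-valued at 0 to be a map. Inverses, liftings through
    injections and descents through surjections all come from this. *)
Lemma lin_rel (X Y : lmodType R) (r : X -> Y -> Prop) :
  (forall x, exists y, r x y) ->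
  (forall a x y x' y', r x y -> r x' y' -> r (a *: x + x') (a *: y + y')) ->
  (forall y, r 0 y -> y = 0) ->
  exists f : {linear X -> Y}, forall x y, r x y <-> f x = y.
Proof.
move=> tot lin fun0.
have rN x y : r x y -> r (- x) (- y).
  move=> rxy; have := lin (-1 - 1) _ _ _ _ rxy rxy.
  by rewrite !scalerBl !scaleN1r !scale1r !addrNK.
have uniq x y y' : r x y -> r x y' -> y = y'.
  move=> rxy /rN rxy'; apply/subr0_eq/fun0.
  by have := lin 1 _ _ _ _ rxy rxy'; rewrite !scale1r subrr.
have [f rf] := choice tot.
have lin_f : linear f by move=> a x x'; apply: uniq (rf _) _; apply: lin.
exists (lin_of lin_f) => x y; split=> [rxy|<-]; last exact: rf.
exact: uniq (rf x) rxy.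
Qed.

Lemma bij_inv (X Y : lmodType R) (f : {linear X -> Y}) :
  injective f -> (forall y, exists x, f x = y) ->
  exists g : {linear Y -> X}, cancel f g /\ cancel g f.
Proof.
move=> inj_f surj_f.
have [|a y x y' x' <- <-|x|g Hg] := @lin_rel Y X (fun y x => f x = y) => //.
- by rewrite linearP.
- by rewrite -(linear0 f) => /inj_f.
by exists g; split=> x; apply/Hg.
Qed.

Lemma iso_of_bij (X Y : lmodType R) (f : {linear X -> Y}) :
  injective f -> (forall y, exists x, f x = y) -> lmod_iso X Y.
Proof. by move=> inj_f /(bij_inv inj_f)[g fgK]; exists f, g. Qed.

Definition surj (X Y : Type) (f : X -> Y) := forall y, exists x, f x = y.

Lemma inj0 (X Y : lmodType R) (f : {linear X -> Y}) :
  (forall x, f x = 0 -> x = 0) -> injective f.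
Proof.
by move=> f0 x y fxy; apply/subr0_eq/f0; rewrite linearB fxy subrr.
Qed.

Definition submod (X : lmodType R) (S : X -> Prop) :=
  S 0 /\ forall a x y, S x -> S y -> S (a *: x + y).

Record submodT (X : lmodType R) := SubmodT {
  submod_pred :> X -> Prop;
  submodP : submod submod_pred }.

End LinearMaps.

Section Submodule.
Variables (R : nzRingType) (X : lmodType R) (S : submodT X).

Lemma submodD x y : S x -> S y -> S (x + y).
Proof. by case: (submodP S) => _ H Sx Sy; rewrite -[x]scale1r; apply: H. Qed.
Lemma submodZ a x : S x -> S (a *: x).
Proof. by case: (submodP S) => S0 H Sx; rewrite -[_ *: _]addr0; apply: H. Qed.
Lemma submod0 : S 0. Proof. by case: (submodP S). Qed.
Lemma submodN x : S x -> S (- x).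
Proof. by move=> Sx; rewrite -scaleN1r; apply: submodZ. Qed.

Definition sub_mod : Type := {x : X | `[< S x >]}.
HB.instance Definition _ := SubChoice.on sub_mod.

Lemma sub_modP (x : sub_mod) : S (val x). Proof. exact/asboolP/(valP x). Qed.
Definition to_sub x (Sx : S x) : sub_mod := exist _ x (asboolT Sx).

Definition sub_add (x y : sub_mod) := to_sub (submodD (sub_modP x) (sub_modP y)).
Definition sub_opp (x : sub_mod) := to_sub (submodN (sub_modP x)).
Definition sub_scale a (x : sub_mod) := to_sub (submodZ a (sub_modP x)).
Fact sub_addA : associative sub_add.
Proof. by move=> x y z; apply/val_inj/addrA. Qed.
Fact sub_addC : commutative sub_add.
Proof. by move=> x y; apply/val_inj/addrC. Qed.
Fact sub_add0 : left_id (to_sub submod0) sub_add.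
Proof. by move=> x; apply/val_inj/add0r. Qed.
Fact sub_addN : left_inverse (to_sub submod0) sub_opp sub_add.
Proof. by move=> x; apply/val_inj/addNr. Qed.
HB.instance Definition _ :=
  GRing.isZmodule.Build sub_mod sub_addA sub_addC sub_add0 sub_addN.
Fact sub_scaleA a b (x : sub_mod) : sub_scale a (sub_scale b x) = sub_scale (a * b) x.
Proof. exact/val_inj/scalerA. Qed.
Fact sub_scale1 : left_id 1 sub_scale.
Proof. by move=> x; apply/val_inj/scale1r. Qed.
Fact sub_scaleDr : right_distributive sub_scale +%R.
Proof. by move=> a x y; apply/val_inj/scalerDr. Qed.
Fact sub_scaleDl x : {morph sub_scale^~ x : a b / a + b}.
Proof. by move=> a b; apply/val_inj/scalerDl. Qed.
HB.instance Definition _ := GRing.Zmodule_isLmodule.Build R sub_mod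
  sub_scaleA sub_scale1 sub_scaleDr sub_scaleDl.

Fact sub_val_linear : linear (val : sub_mod -> X). Proof. by []. Qed.
Definition sub_incl : {linear sub_mod -> X} := lin_of sub_val_linear.

End Submodule.

Section Quotient.
Variables (R : nzRingType) (X : lmodType R) (S : submodT X).

(** [choose] returns the same element for extensionally equal predicates and any admissible default,
    so congruent elements share their representative. The quotient is then the set of fixed points
    of [crep]. *)
Definition crep (x : X) : X := choose (fun y => `[< S (x - y) >]) x.

Lemma crepP x : S (x - crep x).
Proof.
apply/asboolP/(@chooseP _ (fun y => `[< S (x - y) >])).
by apply/asboolP; rewrite subrr; apply: submod0.
Qed.

Lemma crep_eq x y : S (x - y) -> crep x = crep y.
Proof.
move=> Sxy; have E : (fun z => `[< S (x - z) >]) =1 (fun z => `[< S (y - z) >]).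
  move=> z; apply/asbool_equiv_eq; split=> H.
    have -> : y - z = - (x - y) + (x - z) by rewrite opprB subrKA.
    by apply: submodD H; apply: submodN.
  by rewrite -(subrKA y); apply: submodD.
rewrite /crep (eq_choose E); apply: choose_id; apply/asboolP.
  by rewrite -opprB; apply: submodN.
by rewrite subrr; apply: submod0.
Qed.

Lemma crepK x : crep (crep x) = crep x.
Proof. by apply: crep_eq; rewrite -opprB; apply/submodN/crepP. Qed.

Definition quot_mod : Type := {x : X | crep x == x}.
HB.instance Definition _ := SubChoice.on quot_mod.
Definition qcl (x : X) : quot_mod := exist _ (crep x) (introT eqP (crepK x)).

Lemma qcl_eq x y : S (x - y) -> qcl x = qcl y.
Proof. by move=> Sxy; apply/val_inj/crep_eq. Qed.
Lemma qclK (x : quot_mod) : qcl (val x) = x.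
Proof. by apply/val_inj/eqP/(valP x). Qed.
Lemma qcl_inj x y : qcl x = qcl y -> S (x - y).
Proof.
move=> /(congr1 val) /= E; rewrite -(subrKA (crep x)); apply: submodD.
  exact: crepP.
by rewrite E -opprB; apply/submodN/crepP.
Qed.

Definition q_add (x y : quot_mod) := qcl (val x + val y).
Definition q_opp (x : quot_mod) := qcl (- val x).
Definition q_scale a (x : quot_mod) := qcl (a *: val x).

Lemma q_addE x y : q_add (qcl x) (qcl y) = qcl (x + y).
Proof.
apply/esym/qcl_eq; rewrite /= opprD addrACA.
by apply: submodD; apply: crepP.
Qed.

Lemma q_oppE x : q_opp (qcl x) = qcl (- x).
Proof. by apply: qcl_eq; rewrite /= opprK addrC; apply: crepP. Qed.
Lemma q_scaleE a x : q_scale a (qcl x) = qcl (a *: x).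
Proof.
by apply/esym/qcl_eq; rewrite /= -scalerBr; apply/submodZ/crepP.
Qed.
Fact q_addA : associative q_add.
Proof. by move=> x y z; rewrite -[x]qclK -[y]qclK -[z]qclK !q_addE addrA. Qed.
Fact q_addC : commutative q_add.
Proof. by move=> x y; rewrite -[x]qclK -[y]qclK !q_addE addrC. Qed.
Fact q_add0 : left_id (qcl 0) q_add.
Proof. by move=> x; rewrite -[x]qclK q_addE add0r. Qed.
Fact q_addN : left_inverse (qcl 0) q_opp q_add.
Proof. by move=> x; rewrite -[x]qclK q_oppE q_addE addNr. Qed.
HB.instance Definition _ :=
  GRing.isZmodule.Build quot_mod q_addA q_addC q_add0 q_addN.
Fact q_scaleA a b (x : quot_mod) : q_scale a (q_scale b x) = q_scale (a * b) x.
Proof. by rewrite -[x]qclK !q_scaleE scalerA. Qed.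
Fact q_scale1 : left_id 1 q_scale.
Proof. by move=> x; rewrite -[x]qclK q_scaleE scale1r. Qed.
Fact q_scaleDr : right_distributive q_scale +%R.
Proof.
move=> a x y; rewrite -[x]qclK -[y]qclK [qcl _ + qcl _]q_addE !q_scaleE.
by rewrite [_ + _ in RHS]q_addE scalerDr.
Qed.
Fact q_scaleDl x : {morph q_scale^~ x : a b / a + b}.
Proof.
by move=> a b; rewrite -[x]qclK !q_scaleE [_ + _ in RHS]q_addE scalerDl.
Qed.
HB.instance Definition _ := GRing.Zmodule_isLmodule.Build R quot_mod
  q_scaleA q_scale1 q_scaleDr q_scaleDl.

Fact qcl_linear : linear qcl.
Proof.
by move=> a x y; rewrite [_ + _ in RHS]/(_ + _) /= [_ *: _ in RHS]q_scaleE q_addE.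
Qed.

Definition qproj : {linear X -> quot_mod} := lin_of qcl_linear.

End Quotient.

Section Ses.
Variable R : nzRingType.
Implicit Types X Y Z W K L P Q : lmodType R.

Definition ses X Y Z (f : {linear X -> Y}) (g : {linear Y -> Z}) :=
  [/\ injective f, exact_at f g & surj g].

Lemma ses_comp X Y Z (f : {linear X -> Y}) (g : {linear Y -> Z}) :
  ses f g -> forall x, g (f x) = 0.
Proof. by move=> [_ ex _] x; apply/ex; exists x. Qed.

(** Hides the two constructions: later arguments see a submodule and its quotient as the ends of a
    short exact sequence. *)
Lemma sub_quot X (S : X -> Prop) : submod S ->
  exists (K Q : lmodType R) (f : {linear K -> X}) (g : {linear X -> Q}),
    ses f g /\ forall x, S x <-> exists k, f k = x.
Proof.
move=> SP; pose T := SubmodT SP.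
have valP' x : S x <-> exists k, sub_incl T k = x.
  by split=> [Sx|[k <-]]; [exists (to_sub (S := T) Sx) | apply: (@sub_modP _ _ T)].
exists (sub_mod T), (quot_mod T), (sub_incl T), (qproj T); split=> //; split.
- exact: val_inj.
- move=> x; split=> [|/valP' Sx].
    move=> qx; apply/valP'; rewrite -[x]subr0; apply: (@qcl_inj _ _ T).
    exact: etrans qx (esym (linear0 (qproj T))).
  by apply: etrans (linear0 (qproj T)); apply: qcl_eq; rewrite subr0.
by move=> q; exists (val q); apply: qclK.
Qed.

Lemma ker_submod X Y (f : {linear X -> Y}) : submod (fun x => f x = 0).
Proof.
by split=> [|a x y fx fy]; rewrite ?linear0 // linearP fx fy scaler0 addr0.
Qed.

Lemma im_submod X Y (f : {linear X -> Y}) : submod (fun y => exists x, f x = y).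
Proof.
split=> [|a _ _ [x <-] [x' <-]]; first by exists 0; rewrite linear0.
by exists (a *: x + x'); rewrite linearP.
Qed.

Lemma ker_ses X Y (g : {linear X -> Y}) : surj g ->
  exists (K : lmodType R) (f : {linear K -> X}), ses f g.
Proof.
move=> sg; have [K [Q [f [q [[inj_f _ _] HS]]]]] := sub_quot (ker_submod g).
by exists K, f; split.
Qed.

Lemma coker_ses X Y (f : {linear X -> Y}) : injective f ->
  exists (Q : lmodType R) (g : {linear Y -> Q}), ses f g.
Proof.
move=> inj_f; have [K [Q [f' [g [[_ ex sg] HS]]]]] := sub_quot (im_submod f).
by exists Q, g; split=> // y; apply: iff_trans (ex y) _; apply: iff_sym.
Qed.

Lemma im_factor X Y (h : {linear X -> Y}) :
  exists (K I Q : lmodType R) (k : {linear K -> X}) (p : {linear X -> I})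
    (i : {linear I -> Y}) (q : {linear Y -> Q}),
    [/\ ses k p, ses i q & forall x, i (p x) = h x].
Proof.
have [I [Q [i [q [iq HS]]]]] := sub_quot (im_submod h).
have [|a x y x' y' E E'|y|p Hp] := @lin_rel R X I (fun x y => i y = h x).
- by move=> x; apply/HS; exists x.
- by rewrite !linearP E E'.
- by case: iq => inj_i _ _; rewrite linear0 -(linear0 i) => /inj_i.
have hp x : i (p x) = h x by apply/Hp.
have [|K [k kp]] := @ker_ses _ _ p.
  move=> y; have /HS [x hx] : exists k, i k = i y by exists y.
  by exists x; apply/Hp.
by exists K, I, Q, k, p, i, q; split.
Qed.

Lemma inj_lift W X Y (f : {linear X -> Y}) (h : {linear W -> Y}) :
  injective f -> (forall w, exists x, f x = h w) ->
  exists h' : {linear W -> X}, forall w, f (h' w) = h w.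
Proof.
move=> inj_f Hh.
have [|a x y x' y' E E'|y|p Hp] := @lin_rel R W X (fun w x => f x = h w) => //.
- by rewrite !linearP E E'.
- by rewrite linear0 -(linear0 f) => /inj_f.
by exists p => w; apply/Hp.
Qed.

Lemma ses_lift W X Y Z (f : {linear X -> Y}) (g : {linear Y -> Z})
    (h : {linear W -> Y}) : ses f g -> (forall w, g (h w) = 0) ->
  exists h' : {linear W -> X}, forall w, f (h' w) = h w.
Proof. by move=> [inj_f ex _] gh; apply: inj_lift => // w; apply/ex. Qed.

Lemma surj_desc W Y Z (g : {linear Y -> Z}) (h : {linear Y -> W}) :
  surj g -> (forall y, g y = 0 -> h y = 0) ->
  exists h' : {linear Z -> W}, forall y, h' (g y) = h y.
Proof.
move=> sg gh.
have [|a x y x' y' [u [<- <-]] [v [<- <-]]|y [u [/gh -> <-]]|p Hp] //:=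
  @lin_rel R Z W (fun z w => exists y, g y = z /\ h y = w).
- by move=> z; have [y <-] := sg z; exists (h y), y.
- by exists (a *: u + v); rewrite !linearP.
by exists p => y; apply/Hp; exists y.
Qed.

Lemma ses_desc W X Y Z (f : {linear X -> Y}) (g : {linear Y -> Z})
    (h : {linear Y -> W}) : ses f g -> (forall x, h (f x) = 0) ->
  exists h' : {linear Z -> W}, forall y, h' (g y) = h y.
Proof. by move=> [_ ex sg] hf; apply: surj_desc => // y /ex[x <-]. Qed.

Lemma add_linear X Y (f g : {linear X -> Y}) : linear (fun x => f x + g x).
Proof. by move=> a x y; rewrite !linearP scalerDr addrACA. Qed.
Lemma opp_linear X Y (f : {linear X -> Y}) : linear (fun x => - f x).
Proof. by move=> a x y; rewrite (linearP f) opprD scalerN. Qed.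
Lemma comp_linear X Y Z (g : {linear Y -> Z}) (f : {linear X -> Y}) :
  linear (fun x => g (f x)).
Proof. by move=> a x y; rewrite !linearP. Qed.
Lemma id_linear X : linear (fun x : X => x). Proof. by []. Qed.
Lemma zero_linear X Y : linear (fun _ : X => 0 : Y).
Proof. by move=> a x y; rewrite scaler0 addr0. Qed.
Lemma pair_linear X Y Z (f : {linear X -> Y}) (g : {linear X -> Z}) :
  linear (fun x => (f x, g x)).
Proof. by move=> a x y; rewrite !linearP. Qed.
Lemma fst_linear X Y : linear (fun x : X * Y => x.1). Proof. by []. Qed.
Lemma snd_linear X Y : linear (fun x : X * Y => x.2). Proof. by []. Qed.

Definition addl X Y f g : {linear X -> Y} := lin_of (@add_linear X Y f g).
Definition oppl X Y f : {linear X -> Y} := lin_of (@opp_linear X Y f).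
Definition compl X Y Z g f : {linear X -> Z} := lin_of (@comp_linear X Y Z g f).
Definition idl X : {linear X -> X} := lin_of (@id_linear X).
Definition zerol X Y : {linear X -> Y} := lin_of (@zero_linear X Y).
Definition pairl X Y Z f g : {linear X -> (Y * Z)%type} := lin_of (@pair_linear X Y Z f g).
Definition fstl X Y : {linear (X * Y)%type -> X} := lin_of (@fst_linear X Y).
Definition sndl X Y : {linear (X * Y)%type -> Y} := lin_of (@snd_linear X Y).
Definition inll X Y : {linear X -> (X * Y)%type} := pairl (idl X) (zerol X Y).
Definition inrl X Y : {linear Y -> (X * Y)%type} := pairl (zerol Y X) (idl Y).
Definition copairl X Y Z (f : {linear X -> Z}) (g : {linear Y -> Z}) :
  {linear (X * Y)%type -> Z} := addl (compl f (fstl X Y)) (compl g (sndl X Y)).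
Definition prodl X Y X' Y' (f : {linear X -> X'}) (g : {linear Y -> Y'}) :
  {linear (X * Y)%type -> (X' * Y')%type} :=
  pairl (compl f (fstl X Y)) (compl g (sndl X Y)).

Lemma ses_inl_snd X Y : ses (inll X Y) (sndl X Y).
Proof.
split=> [x x' []|[x y]|y] //=; last by exists (0, y).
by split=> [->|[x' [_ <-]]] //; exists x.
Qed.

Lemma pullback X Y Z (f : {linear X -> Z}) (g : {linear Y -> Z}) :
  exists (Q : lmodType R) (p : {linear Q -> X}) (q : {linear Q -> Y}),
    [/\ forall x, f (p x) = g (q x),
        forall x y, f x = g y -> exists z, p z = x /\ q z = y
      & forall z, p z = 0 -> q z = 0 -> z = 0].
Proof.
have [Q [Q' [i [q [[inj_i _ _] HS]]]]] :=
  sub_quot (ker_submod (addl (compl f (fstl X Y)) (oppl (compl g (sndl X Y))))).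
exists Q, (compl (fstl X Y) i), (compl (sndl X Y) i); split.
- move=> x /=; apply/subr0_eq; have := HS (i x) => /= ->; by exists x.
- move=> x y fxy; have /HS [z iz] /= : addl (compl f (fstl X Y)) (oppl (compl g (sndl X Y))) (x, y) = 0.
    by rewrite /= fxy subrr.
  by exists z; rewrite iz.
move=> z /= H1 H2; apply: inj_i; rewrite linear0.
by rewrite [LHS]surjective_pairing H1 H2.
Qed.

Lemma pullback_ses X Y Z K (f : {linear X -> Z}) (g : {linear Y -> Z})
    (k : {linear K -> Y}) Q (p : {linear Q -> X}) (q : {linear Q -> Y}) :
  [/\ forall x, f (p x) = g (q x),
      forall x y, f x = g y -> exists z, p z = x /\ q z = y
    & forall z, p z = 0 -> q z = 0 -> z = 0] ->
  ses k g -> exists j : {linear K -> Q}, ses j p /\ forall x, q (j x) = k x.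
Proof.
move=> [E ex inj] [inj_k exk sg].
have [|a x y x' y' [E1 E2] [E3 E4]|z [E1 E2]|j Hj] :=
  @lin_rel R K Q (fun x z => p z = 0 /\ q z = k x).
- move=> x; apply: ex; rewrite linear0; apply/esym/exk; by exists x.
- by rewrite !linearP E1 E2 E3 E4 scaler0 addr0.
- by apply: inj; rewrite ?E2 ?linear0.
have jP x : p (j x) = 0 /\ q (j x) = k x by apply/Hj.
exists j; split=> [|x]; last by case: (jP x).
split.
- apply: inj0 => x jx; apply: inj_k; case: (jP x) => _ <-.
  by rewrite jx !linear0.
- move=> z; split=> [pz|[x <-]]; last by case: (jP x).
  have /exk [x kx] : g (q z) = 0 by rewrite -E pz linear0.
  by exists x; apply/Hj.
by move=> x; have [y gy] := sg (f x); have [z [<- _]] := ex x y (esym gy); exists z.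
Qed.

Lemma pullback_sym X Y Z (f : {linear X -> Z}) (g : {linear Y -> Z})
    Q (p : {linear Q -> X}) (q : {linear Q -> Y}) :
  [/\ forall x, f (p x) = g (q x),
      forall x y, f x = g y -> exists z, p z = x /\ q z = y
    & forall z, p z = 0 -> q z = 0 -> z = 0] ->
  [/\ forall x, g (q x) = f (p x),
      forall x y, g x = f y -> exists z, q z = x /\ p z = y
    & forall z, q z = 0 -> p z = 0 -> z = 0].
Proof.
move=> [E ex inj]; split=> // [x y gx|z H1 H2]; last exact: inj.
by have [z [? ?]] := ex _ _ (esym gx); exists z.
Qed.

End Ses.

(** * Projective dimension *)

Section ProjectiveDimension.
Variable R : nzRingType.
Implicit Types X Y Z W K L P Q : lmodType R.

Lemma iso_refl X : lmod_iso X X.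
Proof. by exists (idl X), (idl X). Qed.
Lemma iso_sym X Y : lmod_iso X Y -> lmod_iso Y X.
Proof. by move=> [f [g [fK gK]]]; exists g, f. Qed.
Lemma iso_trans X Y Z : lmod_iso X Y -> lmod_iso Y Z -> lmod_iso X Z.
Proof.
move=> [f [g [fK gK]]] [f' [g' [fK' gK']]]; exists (compl f' f), (compl g g').
by split=> x /=; rewrite ?fK' ?fK ?gK ?gK'.
Qed.

Lemma iso_summand X Y : lmod_iso X Y -> direct_summand X Y.
Proof. by move=> [f [g [fK _]]]; exists f, g. Qed.
Lemma iso_bij X Y : lmod_iso X Y ->
  exists f : {linear X -> Y}, injective f /\ surj f.
Proof.
by move=> [f [g [fK gK]]]; exists f; split=> [|y]; [apply: can_inj fK | exists (g y)].
Qed.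

Lemma summand_trans X Y Z : direct_summand X Y -> direct_summand Y Z -> direct_summand X Z.
Proof.
move=> [f [g fK]] [f' [g' fK']]; exists (compl f' f), (compl g g').
by move=> x /=; rewrite fK' fK.
Qed.

Lemma summand_prodl X Y : direct_summand X (X * Y)%type.
Proof. by exists (inll X Y), (fstl X Y). Qed.
Lemma summand_prodr X Y : direct_summand Y (X * Y)%type.
Proof. by exists (inrl X Y), (sndl X Y). Qed.

Definition powi n X (i : 'I_n) (x : X) : {ffun 'I_n -> X} :=
  [ffun j => if j == i then x else 0].
Lemma powi_linear n X i : linear (@powi n X i).
Proof.
by move=> a x y; apply/ffunP => j; rewrite !ffunE; case: eqP => //; rewrite scaler0 addr0.
Qed.

Definition powil n X i : {linear X -> {ffun 'I_n -> X}} := lin_of (@powi_linear n X i).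
Lemma powp_linear n X i : linear (fun x : {ffun 'I_n -> X} => x i).
Proof. by move=> a x y; rewrite !ffunE. Qed.
Definition powpl n X i : {linear {ffun 'I_n -> X} -> X} := lin_of (@powp_linear n X i).
Lemma powtup_linear n X Y (f : 'I_n -> {linear X -> Y}) :
  linear (fun x => [ffun i => f i x] : {ffun 'I_n -> Y}).
Proof. by move=> a x y; apply/ffunP => i; rewrite !ffunE linearP. Qed.
Definition powtupl n X Y f : {linear X -> {ffun 'I_n -> Y}} := lin_of (@powtup_linear n X Y f).
Definition powmapl n X Y (f : {linear X -> Y}) : {linear {ffun 'I_n -> X} -> {ffun 'I_n -> Y}} :=
  powtupl (fun i => compl f (powpl X i)).
Lemma powsum_linear n X Y (f : 'I_n -> {linear X -> Y}) :
  linear (fun x : {ffun 'I_n -> X} => \sum_i f i (x i)).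
Proof.
move=> a x y; rewrite scaler_sumr -big_split /=; apply: eq_bigr => i _.
by rewrite !ffunE linearP.
Qed.

Definition powsuml n X Y f : {linear {ffun 'I_n -> X} -> Y} := lin_of (@powsum_linear n X Y f).

Lemma pow_sum n X (x : {ffun 'I_n -> X}) : x = \sum_i powi i (x i).
Proof.
apply/ffunP => j; rewrite sum_ffunE (bigD1 j) //= big1 ?addr0 ?ffunE ?eqxx //.
by move=> i ij; rewrite ffunE eq_sym (negbTE ij).
Qed.

Lemma powsumE n X Y (h : {linear {ffun 'I_n -> X} -> Y}) x :
  h x = \sum_i h (powi i (x i)).
Proof. by rewrite {1}[x]pow_sum linear_sum. Qed.

Lemma pow1_iso X : lmod_iso X {ffun 'I_1 -> X}.
Proof.
exists (powil X ord0), (powpl X ord0); split=> [x|x] /=; first by rewrite ffunE.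
by apply/ffunP => i; rewrite ffunE (ord1 i).
Qed.

Lemma pow_add_iso n m X : lmod_iso ({ffun 'I_n -> X} * {ffun 'I_m -> X})%type {ffun 'I_(n + m) -> X}.
Proof.
pose f (x : {ffun 'I_n -> X} * {ffun 'I_m -> X}) : {ffun 'I_(n + m) -> X} :=
  [ffun i => match split i with inl j => x.1 j | inr j => x.2 j end].
have lf : linear f.
  by move=> a x y; apply/ffunP => i; rewrite !ffunE; case: split => j; rewrite !ffunE.
pose g (x : {ffun 'I_(n + m) -> X}) : {ffun 'I_n -> X} * {ffun 'I_m -> X} :=
  ([ffun i => x (lshift m i)], [ffun i => x (rshift n i)]).
have lg : linear g by move=> a x y; congr (_, _); apply/ffunP => i; rewrite !ffunE.
exists (lin_of lf), (lin_of lg); split=> [[x y]|x] /=.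
  by congr (_, _); apply/ffunP => i; rewrite !ffunE (unsplitK (inl i), unsplitK (inr i)).
apply/ffunP => i; rewrite ffunE; case: splitP => j ij; rewrite ffunE; congr (x _); exact: val_inj.
Qed.

Lemma proj_summand X P : direct_summand X P -> projective P -> projective X.
Proof.
move=> [i [p ip]] pP Y Z g f sg; have [h Hh] := pP Y Z g (compl f p) sg.
by exists (compl h i) => x /=; rewrite Hh /= ip.
Qed.

Lemma proj_iso X P : lmod_iso X P -> projective P -> projective X.
Proof. by move/iso_summand; apply: proj_summand. Qed.
Lemma proj_prod P Q : projective P -> projective Q -> projective (P * Q)%type.
Proof.
move=> pP pQ Y Z g f sg.
have [h Hh] := pP Y Z g (compl f (inll P Q)) sg.
have [k Hk] := pQ Y Z g (compl f (inrl P Q)) sg.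
exists (copairl h k) => -[x y] /=; rewrite linearD Hh Hk /= -linearD.
by congr (f (_, _)); rewrite ?addr0 ?add0r.
Qed.

Lemma proj_pow n P : projective P -> projective {ffun 'I_n -> P}.
Proof.
move=> pP Y Z g f sg.
have /choice [h Hh] i : exists h : {linear P -> Y}, forall p, g (h p) = compl f (powil P i) p.
  exact: pP.
exists (powsuml h) => p /=; rewrite linear_sum [in RHS]powsumE.
by apply: eq_bigr => i _; rewrite Hh.
Qed.

Lemma proj_free1 : projective R^o.
Proof.
move=> Y Z g f sg; have [y gy] := sg (f 1).
have lh : linear (fun a : R^o => a *: y) by move=> a b c; rewrite scalerDl scalerA.
exists (lin_of lh) => a /=; rewrite linearZ gy -linearZ /=.
by congr (f _); apply: mulr1.
Qed.

Definition free_mod n : lmodType R := {ffun 'I_n -> R^o}.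
Lemma proj_free n : projective (free_mod n).
Proof. exact/proj_pow/proj_free1. Qed.

Lemma proj_split K L P (f : {linear K -> L}) (g : {linear L -> P}) :
  ses f g -> projective P -> exists s : {linear P -> L}, cancel s g.
Proof. by move=> [_ _ sg] pP; have [s Hs] := pP _ _ g (idl P) sg; exists s. Qed.

Lemma split_iso K L P (f : {linear K -> L}) (g : {linear L -> P}) (s : {linear P -> L}) :
  ses f g -> cancel s g -> lmod_iso (K * P)%type L.
Proof.
move=> fg gs; have gf := ses_comp fg; case: fg => inj_f ex _.
apply: (@iso_of_bij _ _ _ (copairl f s)).
  apply: inj0 => -[k p] /= E; have /= := congr1 g E.
  rewrite linearD linear0 gf add0r gs => p0; move: E; rewrite p0 linear0 addr0.
  by rewrite -(linear0 f) => /inj_f ->.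
move=> l; have /ex [k Hk] : g (l - s (g l)) = 0 by rewrite linearB gs subrr.
by exists (k, g l); rewrite /= Hk subrK.
Qed.

Lemma retr_section K L P (f : {linear K -> L}) (g : {linear L -> P}) (r : {linear L -> K}) :
  ses f g -> cancel f r -> exists s : {linear P -> L}, cancel s g /\ forall p, r (s p) = 0.
Proof.
move=> fg rf; have gf := ses_comp fg.
have [|s Hs] := @ses_desc R L _ _ _ f g (addl (idl L) (oppl (compl f r))) fg.
  by move=> x /=; rewrite rf subrr.
case: fg => _ _ sg; exists s; split=> p; have [l <-] := sg p; rewrite Hs /= linearB.
  by rewrite gf subr0.
by rewrite rf subrr.
Qed.

(** Each syzygy comes with its own presentation, so that inductions carry no resolution along;
    [fin_pdimE] compares with resolutions. *)
Fixpoint pd n X : Prop :=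
  match n with
  | 0 => projective X
  | n'.+1 => exists K P (f : {linear K -> P}) (g : {linear P -> X}),
      [/\ ses f g, projective P & pd n' K]
  end.

Lemma ses_iso K L X Y (f : {linear K -> L}) (g : {linear L -> X})
   (h : {linear X -> Y}) : injective h -> surj h -> ses f g -> ses f (compl h g).
Proof.
move=> ih sh [inj_f ex sg]; split=> // [x|y].
  by rewrite -ex /=; split=> [|->]; rewrite -(linear0 h) // => /ih.
by have [x <-] := sh y; have [l <-] := sg x; exists l.
Qed.

Lemma pd_iso n X Y : lmod_iso X Y -> pd n X -> pd n Y.
Proof.
case: n => [/iso_sym/proj_iso //|n] /iso_bij[h [ih sh]].
move=> [K [P [f [g [fg pP pK]]]]]; exists K, P, f, (compl h g); split=> //.
exact: ses_iso.
Qed.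

Lemma ses_prod K L X K' L' X' (f : {linear K -> L}) (g : {linear L -> X})
   (f' : {linear K' -> L'}) (g' : {linear L' -> X'}) :
   ses f g -> ses f' g' -> ses (prodl f f') (prodl g g').
Proof.
move=> [i e s] [i' e' s']; split=> [[k k'] [m m'] [/i -> /i' -> //]|[x x']|[x x']] /=.
  split=> [[/e[k <-] /e'[k' <-]]|[[k k'] [<- <-]]]; first by exists (k, k').
  by congr (_, _); [apply/e; exists k | apply/e'; exists k'].
by have [l <-] := s x; have [l' <-] := s' x'; exists (l, l').
Qed.

Lemma ses_id0 X Z (f : {linear Z -> X}) : zero_mod Z -> ses f (idl X).
Proof.
move=> Z0; split=> [z z' _|x|x]; first by rewrite (Z0 z) (Z0 z').
  by split=> [/= ->|[z <-]]; [exists 0; rewrite linear0 | rewrite (Z0 z) linear0].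
by exists x.
Qed.

Lemma zero_pow0 X : zero_mod {ffun 'I_0 -> X}.
Proof. by move=> x; apply/ffunP => -[]. Qed.

Lemma pd_prod n X Y : pd n X -> pd n Y -> pd n (X * Y)%type.
Proof.
elim: n X Y => [|n IH] X Y; first exact: proj_prod.
move=> [K [P [f [g [fg pP pK]]]]] [K' [P' [f' [g' [fg' pP' pK']]]]].
exists (K * K')%type, (P * P')%type, (prodl f f'), (prodl g g').
by split; [apply: ses_prod | apply: proj_prod | apply: IH].
Qed.

Lemma pdS n X : pd n X -> pd n.+1 X.
Proof.
elim: n X => [|n IH] X.
  move=> pX; exists {ffun 'I_0 -> R^o}, X, (zerol _ _), (idl X).
  split=> //; last exact: proj_free.
  by apply/ses_id0/zero_pow0.
move=> [K [P [f [g [fg pP pK]]]]]; exists K, P, f, g; split=> //; exact: IH.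
Qed.

Lemma pd_le m n X : (m <= n)%N -> pd m X -> pd n X.
Proof.
move=> /subnK <-; elim: (n - m)%N => [|k IH] //.
by move/IH; rewrite addSn; apply: pdS.
Qed.

(** The pullback [Z] of [P] along [X -> X * Q] maps onto [X] with the same kernel, and [P] splits as
    [Z * Q]; so [Z] is projective. *)
Lemma pd_prod_proj n X Q : projective Q -> pd n (X * Q)%type -> pd n X.
Proof.
case: n => [|n] pQ; first exact/proj_summand/summand_prodl.
move=> [K [P [f [g [fg pP pK]]]]].
have [Z [p [q PB]]] := pullback (inll X Q) g.
have [j [jp qj]] := pullback_ses PB fg.
exists K, Z, j, p; split=> //.
have qQ : ses q (compl (sndl X Q) g).
  case: PB => E ex inj; split.
  - apply: inj0 => z qz; apply: inj => //.
    by have /(congr1 fst) := E z; rewrite qz linear0.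
  - move=> y; split=> [/= gy|[z <-]]; last by rewrite /= -E.
    have [|z [_ <-]] := ex (g y).1 y; last by exists z.
    by rewrite [g y]surjective_pairing gy.
  by case: fg => _ _ sg y; have [x gx] := sg (0, y); exists x; rewrite /= gx.
have [s qs] := proj_split qQ pQ.
have /iso_summand ZP := split_iso qQ qs.
exact: proj_summand (summand_trans (summand_prodl _ _) ZP) pP.
Qed.

Lemma schanuel K P X K' P' (f : {linear K -> P}) (g : {linear P -> X})
    (f' : {linear K' -> P'}) (g' : {linear P' -> X}) :
  ses f g -> ses f' g' -> projective P -> projective P' ->
  lmod_iso (K * P')%type (K' * P)%type.
Proof.
move=> fg fg' pP pP'; have [Z [p [q PB]]] := pullback g g'.
have [j [jp _]] := pullback_ses PB fg'.
have [j' [jq _]] := pullback_ses (pullback_sym PB) fg.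
have [s ps] := proj_split jp pP; have [s' qs] := proj_split jq pP'.
exact: iso_trans (split_iso jq qs) (iso_sym (split_iso jp ps)).
Qed.

Lemma pd_syz n K P X (f : {linear K -> P}) (g : {linear P -> X}) :
  ses f g -> projective P -> pd n.+1 X -> pd n K.
Proof.
move=> fg pP [K' [P' [f' [g' [fg' pP' pK']]]]].
apply: (pd_prod_proj pP'); apply: pd_iso (iso_sym (schanuel fg fg' pP pP')) _.
by apply: pd_prod pK' _; apply: (@pd_le 0).
Qed.

Lemma pd_presented n X : pd n X ->
  exists K P (f : {linear K -> P}) (g : {linear P -> X}), ses f g /\ projective P.
Proof. by move/pdS => [K [P [f [g [fg pP _]]]]]; exists K, P, f, g. Qed.

(** If [P] maps onto [U * V], then [P * P] maps onto it componentwise. The syzygy of this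
    presentation is itself a product, and the induction applies to it. *)
Lemma pd_summand n X Y : direct_summand X Y -> pd n Y -> pd n X.
Proof.
move=> [i [p ip]].
suff H : forall (m : nat) (U V : lmodType R), pd m (U * V)%type -> pd m U.
  have [K [j jp]] : exists K (j : {linear K -> Y}), ses j p.
    by apply: ker_ses => x; exists (i x).
  move=> pY; apply: (H n X K); apply: pd_iso pY.
  apply: iso_sym; apply: iso_trans (split_iso jp ip).
  exists (pairl (sndl X K) (fstl X K)), (pairl (sndl K X) (fstl K X)).
  by split=> -[].
move=> {i p ip X Y n}; elim=> [|n IH] U V; first exact/proj_summand/summand_prodl.
move=> pUV; have [K [P [f [g [fg pP]]]]] := pd_presented pUV.
pose gU := compl (fstl U V) g; pose gV := compl (sndl U V) g.
have sU : surj gU by case: fg => _ _ sg u; have [x gx] := sg (u, 0); exists x; rewrite /gU /= gx.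
have sV : surj gV by case: fg => _ _ sg v; have [x gx] := sg (0, v); exists x; rewrite /gV /= gx.
have [KU [fU fgU]] := ker_ses sU; have [KV [fV fgV]] := ker_ses sV.
have /(pd_syz (ses_prod fgU fgV) (proj_prod pP pP)) /IH pKU := pUV.
by exists KU, P, fU, gU.
Qed.

Lemma horseshoe X' X X'' P' P'' K' K'' (f : {linear X' -> X}) (g : {linear X -> X''})
    (i' : {linear K' -> P'}) (p' : {linear P' -> X'})
    (i'' : {linear K'' -> P''}) (p'' : {linear P'' -> X''}) :
  ses f g -> ses i' p' -> ses i'' p'' -> projective P'' ->
  exists K (i : {linear K -> (P' * P'')%type}) (p : {linear (P' * P'')%type -> X})
    (a : {linear K' -> K}) (b : {linear K -> K''}), ses i p /\ ses a b.
Proof.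
move=> fg ip' ip'' pP; have gf := ses_comp fg; case: fg => injf exf sg.
case: (ip') => inji' ex' s'; case: (ip'') => inji'' ex'' s''.
have [u Hu] := pP _ _ g p'' sg.
pose p := copairl (compl f p') u.
have sp : surj p.
  move=> x; have [y Hy] := s'' (g x).
  have /exf [x' Hx'] : g (x - u y) = 0 by rewrite linearB Hu Hy subrr.
  by have [y' Hy'] := s' x'; exists (y', y); rewrite /p /= Hy' Hx' subrK.
have [K [i ip]] := ker_ses sp; have pi := ses_comp ip; case: (ip) => inji ex _.
have [|a Ha] := ses_lift (h := compl (inll P' P'') i') ip.
  by move=> k; rewrite /p /= (ses_comp ip') !linear0 addr0.
have [|b Hb] := ses_lift (h := compl (sndl P' P'') i) ip''.
  move=> k; rewrite /= -Hu; have := congr1 g (pi k).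
  by rewrite /p /= linearD gf add0r linear0.
exists K, i, p, a, b; split=> //; split.
- by apply: inj0 => k ak; apply: inji'; have := Ha k; rewrite ak !linear0 => -[<-].
- move=> k; split=> [bk|[k' <-]]; last first.
    by apply: inji''; rewrite Hb /= Ha linear0.
  have i2 : (i k).2 = 0 by have := Hb k; rewrite bk linear0.
  have /ex' [k' Hk'] : p' (i k).1 = 0.
    apply: injf; have := pi k; rewrite /p /= i2 linear0 addr0 => ->.
    by rewrite linear0.
  exists k'; apply: inji; rewrite Ha /= Hk' -[0]i2.
  by rewrite -surjective_pairing.
move=> k''.
have /exf [x' Hx'] : g (u (i'' k'')) = 0 by rewrite Hu (ses_comp ip'').
have [y' Hy'] := s' x'.
have /ex [k Hk] : p (- y', i'' k'') = 0.
  by rewrite /p /= linearN Hy' linearN Hx' addNr.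
by exists k; apply: inji''; rewrite Hb /= Hk.
Qed.

Lemma pd_mid n (X' X X'' : lmodType R) (f : {linear X' -> X}) (g : {linear X -> X''}) :
  ses f g -> pd n X' -> pd n X'' -> pd n X.
Proof.
elim: n X' X X'' f g => [|n IH] Y' Y Y'' f' g' fg' H' H''.
  have [s gs] := proj_split fg' H''.
  exact: proj_iso (iso_sym (split_iso fg' gs)) (proj_prod H' H'').
case: H' => [K' [P' [i' [p' [ip' pP' pK']]]]].
case: H'' => [K'' [P'' [i'' [p'' [ip'' pP'' pK'']]]]].
have [K [i [p [a [b [ip ab]]]]]] := horseshoe fg' ip' ip'' pP''.
exists K, (P' * P'')%type, i, p; split=> //; first exact: proj_prod.
exact: IH ab pK' pK''.
Qed.

Lemma pd_left n (X' X X'' : lmodType R) (f : {linear X' -> X}) (g : {linear X -> X''}) :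
  ses f g -> pd n X -> pd n X'' -> pd n X'.
Proof.
elim: n X' X X'' f g => [|n IH] Y' Y Y'' f' g' fg' H H''.
  have [s gs] := proj_split fg' H''.
  exact: proj_summand (summand_trans (summand_prodl _ _) (iso_summand (split_iso fg' gs))) H.
have [K [P [i [p [ip pP pK]]]]] := H.
case: (fg') => injf exf sg.
(* [Z] is the kernel of [P -> Y'']; it is an extension of [Y'] by [K] *)
have sgp : surj (compl g' p).
  by case: ip => _ _ sp y; have [x <-] := sg y; have [z <-] := sp x; exists z.
have [Z [j jp]] := ker_ses sgp.
have pZ : pd n Z := pd_syz jp pP H''.
have [|q Hq] := ses_lift (h := compl p j) fg'.
  by move=> z; have /= := ses_comp jp z.
have sq : surj q.
  case: (ip) => _ _ sp; case: (jp) => _ exj _ y; have [x px] := sp (f' y).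
  have /exj [z jz] : g' (p x) = 0 by rewrite px (ses_comp fg').
  by exists z; apply: injf; rewrite Hq /= jz.
(* A projective mapping onto [Y'] is not given; it is obtained from a presentation of [Z], whose
   projective dimension is finite. *)
have [K2 [P2 [i2 [p2 [[_ _ sp2] pP2]]]]] := pd_presented pZ.
have sq2 : surj (compl q p2).
  by move=> y; have [z <-] := sq y; have [w <-] := sp2 z; exists w.
have [L [l lq]] := ker_ses sq2; exists L, P2, l, (compl q p2); split=> //.
(* The horseshoe places a syzygy of [Y] between the syzygies [L] of [Y'] and [K''] of [Y''], one
   dimension lower. *)
have [K'' [P'' [i'' [p'' [ip'' pP'' pK'']]]]] := H''.
have [K3 [i3 [p3 [a [b [ip3 ab]]]]]] := horseshoe fg' lq ip'' pP''.
exact: IH ab (pd_syz ip3 (proj_prod pP2 pP'') H) pK''.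
Qed.

(** The kernel [Z] of [P -> X''] is an extension of [X'] by the syzygy [K] of [X]; passing from [Z]
    to [X''] costs the extra 1. *)
Lemma pd_right n (X' X X'' : lmodType R) (f : {linear X' -> X}) (g : {linear X -> X''}) :
  ses f g -> pd n X' -> pd n X -> pd n.+1 X''.
Proof.
move=> fg H' H; have [K [P [i [p [ip pP]]]]] := pd_presented H.
have [_ _ sg] := fg.
have sgp : surj (compl g p).
  by case: ip => _ _ sp y; have [x <-] := sg y; have [z <-] := sp x; exists z.
have [Z [j jp]] := ker_ses sgp; exists Z, P, j, (compl g p); split=> //.
have [|q Hq] := ses_lift (h := compl p j) fg.
  by move=> z; have /= := ses_comp jp z.
have [|k Hk] := ses_lift (h := i) jp.
  by move=> z /=; rewrite (ses_comp ip) linear0.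
have kq : exists k : {linear K -> Z}, ses k q.
  exists k; case: (fg) => injf exf _.
  case: (ip) => inji exi sp; case: (jp) => injj exj _; split.
  - by apply: inj0 => x kx; apply: inji; rewrite -Hk kx !linear0.
  - move=> z; split=> [qz|[x <-]].
      have /exi [x ix] : p (j z) = 0 by have /= <- := Hq z; rewrite qz linear0.
      by exists x; apply: injj; rewrite Hk.
    by apply: injf; rewrite Hq /= Hk (ses_comp ip) linear0.
  move=> y; have [x px] := sp (f y).
  have /exj [z jz] : g (p x) = 0 by rewrite px (ses_comp fg).
  by exists z; apply: injf; rewrite Hq /= jz.
case: kq => {Hk}k kq; case: n H' H => [|n] H' H.
  have [s qs] := proj_split kq H'.
  apply: proj_iso (iso_sym (split_iso kq qs)) (proj_prod _ H').
  have [t pt] := proj_split ip H.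
  exact: proj_summand (summand_trans (summand_prodl _ _) (iso_summand (split_iso ip pt))) pP.
by apply: pd_mid kq _ H'; apply: pdS; apply: pd_syz ip pP H.
Qed.

Lemma pd_pow n m X : pd n X -> pd n {ffun 'I_m -> X}.
Proof.
elim: n X => [|n IH] X; first exact: proj_pow.
move=> [K [P [f [g [fg pP pK]]]]].
exists {ffun 'I_m -> K}, {ffun 'I_m -> P}, (powmapl m f), (powmapl m g).
split; [|exact: proj_pow|exact: IH].
case: fg => injf ex sg; split.
- by apply: inj0 => x /ffunP fx; apply/ffunP => i; apply: injf; have := fx i; rewrite !ffunE linear0.
- move=> y; split=> [/ffunP gy|[x <-]].
    have /choice [x Hx] i : exists x, f x = y i by apply/ex; have := gy i; rewrite !ffunE.
    by exists [ffun i => x i]; apply/ffunP => i; rewrite ffunE /= ffunE Hx.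
  by apply/ffunP => i; rewrite ffunE /= ffunE /= [RHS]ffunE; apply/ex; exists (x i).
move=> y; have /choice [x Hx] i : exists x, g x = y i by apply: sg.
by exists [ffun i => x i]; apply/ffunP => i; rewrite ffunE /= ffunE Hx.
Qed.

Lemma pd_of_res n X : pdim_le n X -> pd n X.
Proof.
elim: n X => [|n IH] X [[O d a Oproj sa ex0 exS] /= H].
  have inj_a : injective a.
    by apply: inj0 => x /ex0 [y <-]; rewrite (H 1%N _ y) ?linear0.
  exact: (@pd_iso 0 _ _ (iso_of_bij inj_a sa) (Oproj 0%N)).
have [K [k ka]] := ker_ses sa; have [injk exk _] := ka.
have [|a' Ha'] := ses_lift (h := d 0%N) ka.
  by move=> x; apply/ex0; exists x.
exists K, (O 0%N), k, a; split=> //; apply: IH.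
unshelve eexists (@ProjResolution R K (fun i => O i.+1) (fun i => d i.+1) a' _ _ _ _).
- by move=> i; apply: Oproj.
- move=> y; have /ex0 [x Hx] : a (k y) = 0 by apply/exk; exists y.
  by exists x; apply: injk; rewrite Ha'.
- move=> y; apply: iff_trans (exS 0%N y).
  by split=> [E|E]; [rewrite -Ha' E linear0 | apply: injk; rewrite Ha' E linear0].
- by move=> i; apply: exS.
by move=> i ni; apply: H.
Qed.

Lemma res_of_pd n X : pd n X -> pdim_le n X.
Proof.
elim: n X => [|n IH] X.
  pose O i : lmodType R := if i is 0 then X else {ffun 'I_0 -> R^o}.
  move=> pX.
  unshelve eexists (@ProjResolution R X O (fun i => zerol (O i.+1) (O i)) (idl X) _ _ _ _).
  - by case=> [|i] //; apply: proj_free.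
  - by move=> x; exists x.
  - by move=> y; split=> [/= ->|[x <-]] //; exists 0.
  - by move=> i y; split=> // _; exists 0; apply/esym/zero_pow0.
  by case=> //= i _; apply: zero_pow0.
move=> [K [P [f [g [fg pP /IH [[O d a Oproj sa ex0 exS] /= H]]]]]].
pose O' i : lmodType R := if i is i'.+1 then O i' else P.
pose d' i : {linear O' i.+1 -> O' i} :=
  match i return {linear O' i.+1 -> O' i} with
  | 0 => compl f a
  | i'.+1 => d i'
  end.
have [injf exf sg] := fg.
unshelve eexists (@ProjResolution R X O' d' g _ _ _ _).
- by case.
- exact: sg.
- move=> y; apply: iff_trans (exf y) _; split=> [[x <-]|[x <-]]; last by exists (a x).
  by have [z <-] := sa x; exists z.
- case=> [|i] y; last exact: exS.
  apply: iff_trans (ex0 y) => /=; split=> [|->]; last by rewrite linear0.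
  by rewrite -(linear0 f) => /injf.
by case=> // i ni; apply: H.
Qed.

Lemma fin_pdimE X : fin_pdim X <-> exists n, pd n X.
Proof. by split=> -[n] H; exists n; [apply: pd_of_res | apply: res_of_pd]. Qed.

End ProjectiveDimension.

(** * Vanishing of extensions *)

Section Ext.
Variable R : nzRingType.
Implicit Types X Y Z W K L P Q T C U V I : lmodType R.

(* Ext^1(X, Y) = 0, as a lifting property, so that no resolution has to be chosen. *)
Definition E1 X Y := forall K L (f : {linear K -> L}) (g : {linear L -> X}),
  ses f g -> forall h : {linear K -> Y}, exists h' : {linear L -> Y}, forall k, h' (f k) = h k.

Definition presented X := exists K P (f : {linear K -> P}) (g : {linear P -> X}),
  ses f g /\ projective P.

(** Every extension of [X] is a pushout of one presentation by a projective, so vanishing may be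
    tested there. *)
Lemma E1_one X Y K P (i : {linear K -> P}) (p : {linear P -> X}) :
  ses i p -> projective P ->
  (forall h : {linear K -> Y}, exists h' : {linear P -> Y}, forall k, h' (i k) = h k) ->
  E1 X Y.
Proof.
move=> ip pP ext K' L f g fg h; have [injf exf sg] := fg; have [inji exi sp] := ip.
have [u gu] := pP _ _ g p sg.
have [|v fv] := ses_lift (h := compl u i) fg.
  by move=> k /=; rewrite gu (ses_comp ip).
have [w wi] := ext (compl h v).
(* [L] is spanned by the images of [P] under [u] and of [K'] under [f], and the extension is
   prescribed on both. They overlap in [K], on which [w] was chosen to agree with [h]. *)
have [|a l y l' y' [q [k [-> ->]]] [q' [k' [-> ->]]]|y [q [k [E ->]]]|H HP] :=
  @lin_rel R L Y (fun l y => exists q k, l = u q + f k /\ y = w q + h k).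
- move=> l; have [q pq] := sp (g l).
  have /exf [k fk] : g (l - u q) = 0 by rewrite linearB gu pq subrr.
  by exists (w q + h k), q, k; rewrite fk addrC subrK.
- exists (a *: q + q'), (a *: k + k'); rewrite !linearP.
  by split; rewrite scalerDr addrACA.
- have /exi [z iz] : p q = 0.
    by have := congr1 g E; rewrite linearD (ses_comp fg) gu addr0 linear0.
  have /= -> : k = - v z.
    by apply: injf; rewrite linearN fv /= iz; apply/eqP; rewrite -addr_eq0 addrC -E.
  by rewrite -iz wi linearN subrr.
by exists H => k; apply/HP; exists 0, k; rewrite !linear0 !add0r.
Qed.

Lemma E1_proj P Y : projective P -> E1 P Y.
Proof.
move=> pP K L f g fg h; have [s gs] := proj_split fg pP.
have [|r Hr] := ses_lift (h := addl (idl L) (oppl (compl s g))) fg.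
  by move=> l /=; rewrite linearB gs subrr.
exists (compl h r) => k /=; congr (h _); have [injf _ _] := fg; apply: injf.
by rewrite Hr /= (ses_comp fg) linear0 subr0.
Qed.

Lemma E1_retr X Y Z (f : {linear Y -> Z}) (g : {linear Z -> X}) :
  ses f g -> E1 X Y -> exists r : {linear Z -> Y}, cancel f r.
Proof. by move=> fg /(_ _ _ _ _ fg (idl Y)). Qed.

Lemma E1_section X Y Z (f : {linear Y -> Z}) (g : {linear Z -> X}) :
  ses f g -> E1 X Y -> exists s : {linear X -> Z}, cancel s g.
Proof.
by move=> fg /(E1_retr fg)[r fr]; have [s [gs _]] := retr_section fg fr; exists s.
Qed.

Lemma E1_lift X Y Z Q (f : {linear Y -> Z}) (g : {linear Z -> Q}) (h : {linear X -> Q}) :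
  ses f g -> E1 X Y -> exists h' : {linear X -> Z}, forall x, g (h' x) = h x.
Proof.
move=> fg XY; have [U [p [q PB]]] := pullback h g.
have [j [jp _]] := pullback_ses PB fg; have [s ps] := E1_section jp XY.
by exists (compl q s) => x /=; case: PB => <- _ _; rewrite ps.
Qed.

(** An extension of [X] is pulled back along [p] to one of [X']; the map is extended there and
    restricted to [L] along [l |-> (i (g l), l)]. *)
Lemma E1_summandl X X' Y : direct_summand X X' -> E1 X' Y -> E1 X Y.
Proof.
move=> [i [p ip]] E K L f g fg h.
have [U [u [v PB]]] := pullback p g.
have [j [ju vj]] := pullback_ses PB fg.
have [h' Hh] := E _ _ _ _ ju h.
have [Epb ex inj] := PB.
have [||w Hw] := @inj_lift R L _ _ (pairl u v) (pairl (compl i g) (idl L)).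
- by apply: inj0 => z /= [uz vz]; apply: inj.
- move=> l; have [|z [uz vz]] := ex (i (g l)) l; first by rewrite ip.
  by exists z; rewrite /= uz vz.
exists (compl h' w) => k /=; rewrite -Hh; congr (h' _).
have /= [w1 w2] := Hw (f k); apply/subr0_eq/inj.
  by rewrite linearB w1 (ses_comp fg) (ses_comp ju) linear0 subrr.
by rewrite linearB w2 vj subrr.
Qed.

Lemma E1_summandr X Y Y' : direct_summand Y Y' -> E1 X Y' -> E1 X Y.
Proof.
move=> [i [p ip]] E K L f g fg h; have [h' Hh] := E _ _ _ _ fg (compl i h).
by exists (compl p h') => k /=; rewrite Hh /= ip.
Qed.

Lemma E1_pow n X Y : E1 X Y -> E1 X {ffun 'I_n -> Y}.
Proof.
move=> E K L f g fg h.
have /choice [h' Hh] i : exists h' : {linear L -> Y}, forall k, h' (f k) = h k i.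
  exact: (E _ _ _ _ fg (compl (powpl Y i) h)).
by exists (powtupl h') => k; apply/ffunP => i; rewrite ffunE Hh.
Qed.

(** The preimage [U] of [X'] in [L] is an extension of [X'], and [L] is an extension of [X''] by
    [U]: the map is extended in two stages. *)
Lemma E1_extl X' X X'' Y (f : {linear X' -> X}) (g : {linear X -> X''}) :
  ses f g -> E1 X' Y -> E1 X'' Y -> E1 X Y.
Proof.
move=> fg E' E'' K L u v uv h.
have [U [p [q PB]]] := pullback f v.
have [j [jp qj]] := pullback_ses PB uv.
have [w Hw] := E' _ _ _ _ jp h.
have qg : ses q (compl g v).
  have [Epb ex inj] := PB; have [injf exf sg] := fg; have [_ exv sv] := uv; split.
  - apply: inj0 => z qz; apply: inj => //.
    by apply: injf; rewrite Epb qz !linear0.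
  - move=> l; split=> [/exf [x fx]|[z <-]]; last by rewrite /= -Epb (ses_comp fg).
    by have [z [_ <-]] := ex _ _ fx; exists z.
  by move=> y; have [x <-] := sg y; have [l <-] := sv x; exists l.
have [h' Hh] := E'' _ _ _ _ qg w.
by exists h' => k; rewrite -qj Hh Hw.
Qed.

Lemma E1_prodl X X' Y : E1 X Y -> E1 X' Y -> E1 (X * X')%type Y.
Proof. exact/E1_extl/ses_inl_snd. Qed.
(** The composite into [Y''] extends to [P] and lifts to [Y] by projectivity; the discrepancy on [K]
    takes values in [Y']. *)
Lemma E1_extr X Y' Y Y'' (f : {linear Y' -> Y}) (g : {linear Y -> Y''}) :
  ses f g -> presented X -> E1 X Y' -> E1 X Y'' -> E1 X Y.
Proof.
move=> fg [K [P [i [p [ip pP]]]]] E' E''; apply: (E1_one ip pP) => h.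
have [u Hu] := E'' _ _ _ _ ip (compl g h); have [_ _ sg] := fg.
have [v gv] := pP _ _ g u sg.
have [|w Hw] := ses_lift (h := addl h (oppl (compl v i))) fg.
  by move=> k /=; rewrite linearB gv Hu subrr.
have [w' Hw'] := E' _ _ _ _ ip w.
exists (addl v (compl f w')) => k /=.
by rewrite Hw' Hw /= addrC subrK.
Qed.

(* Ext^1(X, Y'') embeds in Ext^2(X, Y) = Ext^1(K, Y) when Ext^1(X, C) = 0. *)
Lemma E1_shift X Y C Y'' K P (f : {linear Y -> C}) (g : {linear C -> Y''})
    (i : {linear K -> P}) (p : {linear P -> X}) :
  ses f g -> ses i p -> projective P -> E1 K Y -> E1 X C -> E1 X Y''.
Proof.
move=> fg ip pP EK EX; apply: (E1_one ip pP) => h.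
have [u gu] := E1_lift h fg EK; have [v Hv] := EX _ _ _ _ ip u.
by exists (compl g v) => k /=; rewrite Hv gu.
Qed.

(** A converse of [E1_shift]: maps [K -> Y''] extend to [P], hence lift to [C], so Ext^1(K, Y)
    embeds in Ext^1(K, C). *)
Lemma E1_unshift X Y C Y'' K P (f : {linear Y -> C}) (g : {linear C -> Y''})
    (i : {linear K -> P}) (p : {linear P -> X}) :
  ses f g -> ses i p -> projective P -> presented K -> E1 X Y'' -> E1 K C -> E1 K Y.
Proof.
move=> fg ip pP [K2 [P2 [i2 [p2 [ip2 pP2]]]]] EX EK; apply: (E1_one ip2 pP2) => h.
have [u Hu] := EK _ _ _ _ ip2 (compl f h); have [_ _ sg] := fg.
have [|v Hv] := ses_desc (h := compl g u) ip2.
  by move=> k /=; rewrite Hu /= (ses_comp fg).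
have [w Hw] := EX _ _ _ _ ip v; have [w' Hw'] := pP _ _ g w sg.
have [|t Ht] := ses_lift (h := addl u (oppl (compl w' (compl i p2)))) fg.
  by move=> x /=; rewrite linearB Hw' Hw Hv subrr.
exists t => k; have [injf _ _] := fg; apply: injf.
by rewrite Ht /= Hu /= (ses_comp ip2) !linear0 ?subr0 ?addr0.
Qed.

Fixpoint syz n X K : Prop :=
  match n with
  | 0 => lmod_iso X K
  | n'.+1 => exists L P (f : {linear L -> P}) (g : {linear P -> X}),
      [/\ ses f g, projective P & syz n' L K]
  end.

(** Schanuel's lemma iterated. It is stated for stably isomorphic [X] and [X'] because syzygies of
    isomorphic modules are only stably isomorphic. *)
Lemma syz_stable n X X' Q Q' K K' :
  lmod_iso (X * Q)%type (X' * Q')%type -> projective Q -> projective Q' ->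
  syz n X K -> syz n X' K' -> exists U U', [/\ projective U, projective U' &
    lmod_iso (K * U)%type (K' * U')%type].
Proof.
have prods (A A' B B' : lmodType R) : lmod_iso A A' -> lmod_iso B B' -> lmod_iso (A * B)%type (A' * B')%type.
  move=> [f [g [fK gK]]] [f' [g' [fK' gK']]]; exists (prodl f f'), (prodl g g').
  by split=> -[x y] /=; rewrite ?fK ?fK' ?gK ?gK'.
elim: n X X' Q Q' => [|n IH] X X' Q Q' XX pQ pQ'.
  move=> /= XK XK'; exists Q, Q'; split=> //.
  apply: iso_trans (prods _ _ _ _ (iso_sym XK) (iso_refl Q)) _.
  exact: iso_trans XX (prods _ _ _ _ XK' (iso_refl Q')).
move=> [L [P [f [g [fg pP LK]]]]] [L' [P' [f' [g' [fg' pP' LK']]]]].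
(* The summand [Q] is presented by itself with kernel 0, which gives presentations of the isomorphic
   modules [X * Q] and [X' * Q']. *)
have zQ (A : lmodType R) : ses (zerol (free_mod R 0) A) (idl A) by apply/ses_id0/zero_pow0.
have s1 := ses_prod fg (zQ Q); have s2 := ses_prod fg' (zQ Q').
have [h [ih sh]] := iso_bij XX.
have {}s1 := ses_iso ih sh s1.
have iL := schanuel s1 s2 (proj_prod pP pQ) (proj_prod pP' pQ').
have assoc (A B C : lmodType R) : lmod_iso (A * (B * C))%type ((A * B) * C)%type.
  exists (pairl (pairl (fstl A (B*C)%type) (compl (fstl B C) (sndl A (B*C)%type))) (compl (sndl B C) (sndl A (B*C)%type))).
  exists (pairl (compl (fstl A B) (fstl (A*B)%type C)) (pairl (compl (sndl A B) (fstl (A*B)%type C)) (sndl (A*B)%type C))).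
  by split=> [[a [b c]]|[[a b] c]].
apply: IH LK LK'.
- apply: iso_trans (assoc _ _ _) _; apply: iso_trans iL _.
  exact: iso_sym (assoc _ _ _).
- by apply: proj_prod; [apply: (@proj_free R) | apply: proj_prod].
by apply: proj_prod; [apply: (@proj_free R) | apply: proj_prod].
Qed.

Lemma E1_syz n X K K' Y : syz n X K -> syz n X K' -> E1 K Y -> E1 K' Y.
Proof.
move=> XK XK' E.
have [U [U' [pU pU' KU]]] := syz_stable (iso_refl (X * free_mod R 0)%type) (@proj_free R 0) (@proj_free R 0) XK XK'.
apply: E1_summandl (summand_prodl K' U') _; apply: E1_summandl (iso_summand (iso_sym KU)) _.
exact: E1_prodl E (E1_proj pU).
Qed.

Lemma syzSr n X K L P (f : {linear L -> P}) (g : {linear P -> K}) :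
  syz n X K -> ses f g -> projective P -> syz n.+1 X L.
Proof.
move=> + fg pP; elim: n X => [|n IH] X.
  move=> /iso_sym /iso_bij [h [ih sh]]; exists L, P, f, (compl h g); split=> //=.
    exact: ses_iso.
  exact: iso_refl.
move=> [L' [P' [f' [g' [fg' pP' LK]]]]]; exists L', P', f', g'; split=> //.
exact: IH.
Qed.

Lemma syz_pd n m X K : syz n X K -> pd (n + m) X -> pd m K.
Proof.
elim: n X => [|n IH] X; first exact: pd_iso.
by move=> [L [P [f [g [fg pP LK]]]]] /(pd_syz fg pP); apply: IH.
Qed.

(** A cocycle in degree i+1 factors through the kernel of [res_obj P i -> K], where [K] is the i-th
    syzygy cut out by the resolution. Extending it to [res_obj P i] is what [E1 K Y] provides. *)
Lemma ExtSE i X Y : (forall K, syz i X K -> E1 K Y) -> ExtS_vanishes i X Y.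
Proof.
move=> HE [O d a Oproj sa ex0 exS] /= f fd.
have [K0 [k0 ka]] := ker_ses sa.
have [|d0 Hd0] := ses_lift (h := d 0%N) ka; first by move=> x; apply/ex0; exists x.
have H j : exists (K : lmodType R) (c : {linear O j -> K}), surj c /\
     (syz j X K /\ exists (L : lmodType R) (k : {linear L -> O j}) (c' : {linear O j.+1 -> L}),
      [/\ ses k c, surj c', forall x, k (c' x) = d j x
        & forall x, c' x = 0 <-> d j x = 0]).
  elim: j => [|j [K [c [sc [XK [L [k [c' [kc sc' kc'E c'0]]]]]]]]].
    exists X, a; split=> //; split; first exact: iso_refl.
    exists K0, k0, d0; have [injk exk _] := ka; split=> //.
      move=> y; have /ex0 [x Hx] : a (k0 y) = 0 by apply/exk; exists y.
      by exists x; apply: injk; rewrite Hd0.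
    by move=> x; rewrite -Hd0; split=> [->|]; [rewrite linear0 | rewrite -(linear0 k0) => /injk].
  exists L, c'; split=> //; split; first exact: syzSr XK kc (Oproj j).
  have [M [m mc]] := ker_ses sc'; have [injm exm _] := mc.
  have [|e He] := ses_lift (h := d j.+1) mc.
    by move=> x; apply/c'0; apply/exS; exists x.
  exists M, m, e; split=> //.
    move=> y; have /c'0 /exS [x Hx] : c' (m y) = 0 by apply/exm; exists y.
    by exists x; apply: injm; rewrite He.
  by move=> x; rewrite -He; split=> [->|]; [rewrite linear0 | rewrite -(linear0 m) => /injm].
have [K [c [sc [XK [L [k [c' [kc sc' kc'E c'0]]]]]]]] := H i.
have [|h Hh] := surj_desc (h := f) sc'.
  by move=> x /c'0 /exS [y <-]; apply: fd.
have [h' Hh'] := HE K XK _ _ _ _ kc h.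
by exists h' => p; rewrite -kc'E Hh' Hh.
Qed.

(** Finite projective dimension supplies a resolution, to which the hypothesis on all resolutions is
    applied. *)
Lemma ExtS_E1 i X Y : ExtS_vanishes i X Y -> fin_pdim X ->
  exists K, syz i X K /\ E1 K Y.
Proof.
move=> HE [n [P _]]; move: HE => /(_ P).
elim: i X P => [|i IH] X [O d a Oproj sa ex0 exS] /= HE.
  have [K0 [k0 ka]] := ker_ses sa; have [injk exk _] := ka.
  have [|d0 Hd0] := ses_lift (h := d 0%N) ka; first by move=> x; apply/ex0; exists x.
  exists X; split; first exact: iso_refl.
  apply: (E1_one ka (Oproj 0%N)) => h.
  have [p|g Hg] := HE (compl h d0).
    rewrite -(linear0 h) /=; congr (h _); apply: injk; rewrite Hd0 linear0.
    by apply/exS; exists p.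
  exists g => k; have /ex0 [x Hx] : a (k0 k) = 0 by apply/exk; exists k.
  have -> : k = d0 x by apply: injk; rewrite Hd0.
  by rewrite Hd0 -Hg.
have [K [k ka]] := ker_ses sa; have [injk exk _] := ka.
have [|a' Ha'] := ses_lift (h := d 0%N) ka.
  by move=> x; apply/ex0; exists x.
unshelve epose proof (IH K (@ProjResolution R K (fun i => O i.+1) (fun i => d i.+1) a' _ _ _ _) _) as H.
- by move=> j; apply: Oproj.
- move=> y; have /ex0 [x Hx] : a (k y) = 0 by apply/exk; exists y.
  by exists x; apply: injk; rewrite Ha'.
- move=> y; apply: iff_trans (exS 0%N y).
  by split=> [E|E]; [rewrite -Ha' E linear0 | apply: injk; rewrite Ha' E linear0].
- by move=> j; apply: exS.
- exact: HE.
by have [L [KL EL]] := H; exists L; split=> //; exists K, (O 0%N), k, a.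
Qed.

End Ext.

(** * Modules of finite length *)

Section Length.
Variable R : nzRingType.
Implicit Types X Y Z : lmodType R.

(* Every chain of submodules below S has at most n strict inclusions. *)
Fixpoint lenle n X (S : X -> Prop) : Prop :=
  match n with
  | 0 => forall x, S x -> x = 0
  | n'.+1 => forall S' : X -> Prop, submod S' -> (forall x, S' x -> S x) ->
      (exists x, S x /\ ~ S' x) -> lenle n' S'
  end.

Definition len n X := lenle n (fun _ : X => True).
Definition fin_len X := exists n, len n X.

Lemma submodI X (S S' : X -> Prop) : submod S -> submod S' -> submod (fun x => S x /\ S' x).
Proof.
move=> [S0 SD] [S'0 S'D]; split=> // a x y [? ?] [? ?].
by split; [apply: SD | apply: S'D].
Qed.

Lemma submod_im X Y (f : {linear X -> Y}) (S : X -> Prop) :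
  submod S -> submod (fun y => exists x, S x /\ f x = y).
Proof.
move=> [S0 SD]; split=> [|a _ _ [x [Sx <-]] [y [Sy <-]]]; first by exists 0; rewrite linear0.
by exists (a *: x + y); rewrite linearP; split=> //; apply: SD.
Qed.

Lemma submod_pre X Y (f : {linear X -> Y}) (S : Y -> Prop) :
  submod S -> submod (fun x => S (f x)).
Proof. by move=> [S0 SD]; split=> [|a x y ? ?]; rewrite ?linear0 ?linearP //; apply: SD. Qed.
Lemma submod_full X : submod (fun _ : X => True). Proof. by []. Qed.

Lemma lenle_sub n X (S S' : X -> Prop) :
  (forall x, S' x -> S x) -> lenle n S -> lenle n S'.
Proof.
case: n => [|n] SS' H; first by move=> x /SS'; apply: H.
move=> S'' sm S''S' [x [S'x nS'']]; apply: H => //; first by move=> y /S''S' /SS'.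
by exists x; split=> //; apply: SS'.
Qed.

Lemma lenleS n X (S : X -> Prop) : lenle n S -> lenle n.+1 S.
Proof.
elim: n S => [|n IH] S H S' sm S'S [x [Sx nS']]; first by move=> y /S'S; apply: H.
by apply: IH; apply: H => //; exists x.
Qed.

Lemma lenle_le m n X (S : X -> Prop) : (m <= n)%N -> lenle m S -> lenle n S.
Proof.
move=> /subnK <-; elim: (n - m)%N => [|k IH] //.
by move/IH; rewrite addSn; apply: lenleS.
Qed.

(** A strict inclusion of [S'] in [S] is strict on kernels or on images, so one of the two bounds
    drops; the induction is on their sum. *)
Lemma lenle_add X Y (f : {linear X -> Y}) a b (S : X -> Prop) : submod S ->
  lenle a (fun x => S x /\ f x = 0) -> lenle b (fun y => exists x, S x /\ f x = y) ->
  lenle (a + b) S.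
Proof.
have [m] := ubnP (a + b); elim: m a b S => // m IH a b S ab smS Ha Hb.
have S0 : S 0 by case: smS.
have pos : (exists x, S x /\ x <> 0) -> (0 < a + b)%N.
  move=> [x [Sx nx]]; rewrite lt0n addn_eq0; apply/negP => /andP[/eqP a0 /eqP b0].
  rewrite a0 b0 in Ha Hb; apply/nx/Ha; split=> //; apply: Hb; by exists x.
case E : (a + b)%N => [|k].
  move=> x Sx; apply: contrapT => nx; suff : (0 < a + b)%N by rewrite E.
  by apply: pos; exists x.
move=> S' smS' S'S [x [Sx nS'x]].
have [[y [Sy [fy nS'y]]]|ker] := pselect (exists y, S y /\ (f y = 0 /\ ~ S' y)).
  case: a ab Ha E {pos} => [|a] ab Ha E.
    by case: nS'y; rewrite (Ha y) //; case: smS'.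
  have [<-] : (a + b).+1 = k.+1 by rewrite -E addSn.
  apply: IH => //.
  - apply: Ha.
    + exact/submodI/ker_submod.
    + by move=> z [/S'S ? ?].
    + by exists y; split=> // -[].
  - by apply: lenle_sub Hb => z [u [/S'S Su <-]]; exists u.
have nim : ~ exists u, S' u /\ f u = f x.
  move=> [u [S'u fu]]; apply: nS'x.
  have [y Ey] : exists y, y = x - u by exists (x - u).
  have S'y : S' y.
    apply: contrapT => nS'y; apply: ker; exists y; split; last first.
      by split=> //; rewrite Ey linearB fu subrr.
    by case: smS => _ SD; rewrite Ey addrC -scaleN1r; apply: SD => //; apply: S'S.
  case: smS' => _ SD; have := SD 1 _ _ S'u S'y.
  by rewrite Ey scale1r addrC subrK.
case: b ab Hb E {pos} => [|b] ab Hb E.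
  case: nim; exists 0; split; first by case: smS'.
  by rewrite linear0; apply/esym/Hb; exists x.
have [<-] : (a + b).+1 = k.+1 by rewrite -E addnS.
apply: IH => //.
- by move: ab; rewrite addnS.
- by apply: lenle_sub Ha => z [/S'S].
apply: Hb.
- exact: submod_im.
- by move=> z [u [/S'S Su <-]]; exists u.
by exists (f x); split=> //; exists x.
Qed.

Lemma lenle_im X Y (f : {linear X -> Y}) n (S : X -> Prop) : submod S ->
  lenle n S -> lenle n (fun y => exists x, S x /\ f x = y).
Proof.
elim: n S => [|n IH] S smS H; first by move=> y [x [/H -> <-]]; rewrite linear0.
move=> S' smS' S'S [y [[x [Sx fx]] nS'y]].
have : lenle n (fun x => S x /\ S' (f x)).
  apply: H => [||]; first exact/submodI/submod_pre.
    by move=> z [].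
  by exists x; split=> // -[_]; rewrite fx.
move=> /(IH _ (submodI smS (submod_pre f smS'))); apply: lenle_sub => z S'z.
by have [u [Su fu]] := S'S z S'z; exists u; rewrite fu.
Qed.

Lemma len_inj X Y (f : {linear X -> Y}) n : injective f -> len n Y -> len n X.
Proof.
move=> inj_f H; apply: (@lenle_add X Y f 0 n) => //.
  by move=> x [_]; rewrite -(linear0 f) => /inj_f.
by apply: lenle_sub H.
Qed.

Lemma len_surj X Y (f : {linear X -> Y}) n : surj f -> len n X -> len n Y.
Proof.
move=> sf /(@lenle_im _ _ f n _ (submod_full X)); apply: lenle_sub => y _.
by have [x <-] := sf y; exists x.
Qed.

Lemma len_ses X Y Z (f : {linear X -> Y}) (g : {linear Y -> Z}) a b :
  ses f g -> len a X -> len b Z -> len (a + b) Y.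
Proof.
move=> [inj_f ex sg] Ha Hb; apply: (@lenle_add _ _ g) => //.
  apply: lenle_sub (@lenle_im _ _ f a _ (submod_full X) Ha) => y [_ /ex[x <-]].
  by exists x.
exact: lenle_sub Hb.
Qed.

Lemma fin_len_inj X Y (f : {linear X -> Y}) : injective f -> fin_len Y -> fin_len X.
Proof. by move=> fi [n H]; exists n; apply: len_inj fi H. Qed.
Lemma fin_len_surj X Y (f : {linear X -> Y}) : surj f -> fin_len X -> fin_len Y.
Proof. by move=> fi [n H]; exists n; apply: len_surj fi H. Qed.
Lemma fin_len_ses X Y Z (f : {linear X -> Y}) (g : {linear Y -> Z}) :
  ses f g -> fin_len X -> fin_len Z -> fin_len Y.
Proof. by move=> fg [a Ha] [b Hb]; exists (a + b)%N; apply: len_ses fg Ha Hb. Qed.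
Lemma fin_len_prod X Y : fin_len X -> fin_len Y -> fin_len (X * Y)%type.
Proof. exact/fin_len_ses/ses_inl_snd. Qed.
Lemma fin_len_zero X : zero_mod X -> fin_len X.
Proof. by move=> X0; exists 0%N => x _. Qed.
Lemma fin_len_iso X Y : lmod_iso X Y -> fin_len Y -> fin_len X.
Proof. by move/iso_bij => [f [fi _]]; apply: fin_len_inj fi. Qed.
Lemma fin_len_pow n X : fin_len X -> fin_len {ffun 'I_n -> X}.
Proof.
move=> H; elim: n => [|n IH]; first exact/fin_len_zero/zero_pow0.
apply: fin_len_iso (iso_sym (pow_add_iso 1 n X)) _; apply: fin_len_prod IH.
exact: fin_len_iso (iso_sym (pow1_iso X)) H.
Qed.

Lemma fin_len_max X (Q : (X -> Prop) -> Prop) S0 : fin_len X -> Q S0 ->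
  (forall S, Q S -> submod S) ->
  exists S, Q S /\ forall S', Q S' -> (forall x, S x -> S' x) -> forall x, S' x -> S x.
Proof.
move=> [n Hn] Q0 Qsm.
(* [P m] says that some member has length at least [m]. A member realising the largest such [m] is
   maximal, since a strictly larger one would be longer. *)
pose P m := `[< exists S, Q S /\ forall j, (j < m)%N -> ~ lenle j S >].
have P0 : exists m, P m by exists 0%N; apply/asboolP; exists S0; split.
have Pn m : P m -> (m <= n)%N.
  move=> /asboolP [S [QS HS]]; rewrite leqNgt; apply/negP => nm.
  by apply: (HS n nm); apply: lenle_sub Hn.
have /asboolP [S [QS HS]] : P (ex_maxn P0 Pn) by case: ex_maxnP.
exists S; split=> // S' QS' SS' x S'x; apply: contrapT => nSx.
suff : P (ex_maxn P0 Pn).+1 by case: ex_maxnP => m _ Hm /Hm; rewrite ltnn.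
apply/asboolP; exists S'; split=> // -[|j] jm Hj.
  by apply: nSx; rewrite (Hj _ S'x); case: (Qsm _ QS).
apply: (HS j jm); apply: Hj => //; first exact: Qsm.
by exists x.
Qed.

Lemma fin_len_min X (Q : (X -> Prop) -> Prop) S0 : fin_len X -> Q S0 ->
  (forall S, Q S -> submod S) ->
  exists S, Q S /\ forall S', Q S' -> (forall x, S' x -> S x) -> forall x, S x -> S' x.
Proof.
move=> [n Hn] + Qsm; have : lenle n S0 by apply: lenle_sub Hn.
elim: n {Hn} S0 => [|n IH] S H QS.
  exists S; split=> // S' QS' SS' x /H ->; by case: (Qsm _ QS').
have [[S' [QS' [S'S [x [Sx nS']]]]]|H'] := pselect (exists S', Q S' /\ ((forall x, S' x -> S x) /\
    exists x, S x /\ ~ S' x)).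
  by apply: (IH S') => //; apply: H => //; [apply: Qsm | exists x].
exists S; split=> // S' QS' S'S x Sx; apply: contrapT => nS'; apply: H'.
by exists S'; split=> //; split=> //; exists x.
Qed.

Definition span n X (g : 'I_n -> X) (x : X) := exists c : 'I_n -> R, x = \sum_i c i *: g i.

Lemma span_submod n X (g : 'I_n -> X) : submod (span g).
Proof.
split=> [|a _ _ [c ->] [d ->]]; first by exists (fun=> 0); rewrite big1 // => i _; rewrite scale0r.
exists (fun i => a * c i + d i); rewrite scaler_sumr -big_split /=.
by apply: eq_bigr => i _; rewrite scalerDl scalerA.
Qed.

Lemma span_gen n X (g : 'I_n -> X) i : span g (g i).
Proof.
exists (fun j => (j == i)%:R); rewrite (bigD1 i) //= eqxx scale1r big1 ?addr0 //.
by move=> j /negbTE ->; rewrite scale0r.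
Qed.

(** A maximal finitely generated submodule is everything, since any further element could be added
    to its generators. *)
Lemma fin_gen_of_len X : fin_len X -> fin_gen X.
Proof.
move=> flX; pose Q S := exists n (g : 'I_n -> X), forall x, S x <-> span g x.
have Q0 : Q (fun x => x = 0).
  exists 0%N, (fun=> 0) => x; split=> [->|[c ->]]; last by rewrite big_ord0.
  by exists (fun=> 0); rewrite big_ord0.
have Qsm S : Q S -> submod S.
  move=> [n [g Sg]]; have [H0 HD] := span_submod g.
  by split=> [|a x y /Sg ? /Sg ?]; apply/Sg => //; apply: HD.
have [S [[n [g Sg]] Smax]] := fin_len_max flX Q0 Qsm.
exists n, g => x; apply/Sg.
pose g' (i : 'I_n.+1) := if unlift ord0 i is Some j then g j else x.
have gg' i : span g' (g i).
  by have := span_gen g' (lift ord0 i); rewrite /g' liftK.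
apply: (Smax (span g')); first by exists n.+1, g'.
- move=> y /Sg [c ->]; have [H0 HD] := span_submod g'.
  by elim/big_rec: _ => [|i z _ Hz] //; apply: HD.
by have := span_gen g' ord0; rewrite /g' unlift_none.
Qed.

Lemma fin_gen_free X : fin_gen X <-> exists n (p : {linear free_mod R n -> X}), surj p.
Proof.
split=> [[n [g Hg]]|[n [p sp]]].
  have l (x : X) : linear (fun a : R^o => a *: x) by move=> a b c; rewrite scalerDl scalerA.
  exists n, (powsuml (fun i => lin_of (l (g i)))) => x.
  by have [c ->] := Hg x; exists [ffun i => c i] => /=; apply: eq_bigr => i _; rewrite ffunE.
exists n, (fun i => p (powi i (1 : R^o))) => x; have [c <-] := sp x.
exists (fun i => c i); rewrite powsumE; apply: eq_bigr => i _.
rewrite -linearZ; congr (p _); apply/ffunP => j; rewrite !ffunE.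
by case: eqP => _; rewrite ?scaler0 //; apply/esym/mulr1.
Qed.

Lemma fin_gen_surj X Y (f : {linear X -> Y}) : surj f -> fin_gen X -> fin_gen Y.
Proof.
move=> sf /fin_gen_free [n [p sp]]; apply/fin_gen_free; exists n, (compl f p) => y.
by have [x <-] := sf y; have [z <-] := sp x; exists z.
Qed.

Lemma fin_gen_presented X : fin_gen X -> presented X.
Proof.
move=> /fin_gen_free [n [p sp]]; have [K [k kp]] := ker_ses sp.
by exists K, (free_mod R n), k, p; split=> //; apply: proj_free.
Qed.

Lemma fin_len_of_gen X : fin_len R^o -> fin_gen X -> fin_len X.
Proof. by move=> H /fin_gen_free [n [p sp]]; apply: fin_len_surj sp (fin_len_pow n H). Qed.

End Length.

(** * Restriction of scalars *)

Section Restriction.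
Variables (S R : nzRingType).

(** A copy of [X] whose type records [phi], so that the restricted action can be a canonical
    structure on it. *)
Definition res_mod (phi : {rmorphism S -> R}) (X : lmodType R) : Type := X.
Variable phi : {rmorphism S -> R}.
Section Instances.
Variable X : lmodType R.
HB.instance Definition _ := GRing.Zmodule.copy (res_mod phi X) X.
Definition res_scale (a : S) (x : res_mod phi X) : res_mod phi X := phi a *: (x : X).
Fact res_scaleA a b x : res_scale a (res_scale b x) = res_scale (a * b) x.
Proof. by rewrite /res_scale rmorphM scalerA. Qed.
Fact res_scale1 : left_id 1 res_scale.
Proof. by move=> x; rewrite /res_scale rmorph1 scale1r. Qed.
Fact res_scaleDr : right_distributive res_scale +%R.
Proof. by move=> a x y; apply: scalerDr. Qed.
Fact res_scaleDl x : {morph res_scale^~ x : a b / a + b}.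
Proof. by move=> a b; rewrite /res_scale rmorphD scalerDl. Qed.
HB.instance Definition _ := GRing.Zmodule_isLmodule.Build S (res_mod phi X)
  res_scaleA res_scale1 res_scaleDr res_scaleDl.
End Instances.

Implicit Types X Y Z : lmodType R.
Lemma res_linear X Y (f : {linear X -> Y}) : linear (f : res_mod phi X -> res_mod phi Y).
Proof. by move=> a x y; apply: linearP. Qed.
Definition resl X Y f : {linear res_mod phi X -> res_mod phi Y} := lin_of (@res_linear X Y f).

Lemma ses_res X Y Z (f : {linear X -> Y}) (g : {linear Y -> Z}) :
  ses f g -> ses (resl f) (resl g).
Proof. by []. Qed.

End Restriction.

(** * Strong tilting modules over finite algebras *)

Section FiniteAlgebra.
Variables (K : comNzRingType) (R : nzRingType) (th : {rmorphism K -> R}).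
Implicit Types X Y Z W L M I C T U V P Q : lmodType R.

(** Length is taken over [K] rather than [R], so that modules over different rings can be
    compared. *)
Definition fl X := fin_len (res_mod th X).

Lemma fl_inj X Y (f : {linear X -> Y}) : injective f -> fl Y -> fl X.
Proof. exact: (@fin_len_inj _ _ _ (resl th f)). Qed.
Lemma fl_surj X Y (f : {linear X -> Y}) : surj f -> fl X -> fl Y.
Proof. exact: (@fin_len_surj _ _ _ (resl th f)). Qed.
Lemma fl_ses X Y Z (f : {linear X -> Y}) (g : {linear Y -> Z}) :
  ses f g -> fl X -> fl Z -> fl Y.
Proof. by move/(ses_res th)/fin_len_ses. Qed.
Lemma fl_prod X Y : fl X -> fl Y -> fl (X * Y)%type.
Proof. exact/fl_ses/ses_inl_snd. Qed.
Lemma fl_zero X : zero_mod X -> fl X.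
Proof. by move=> X0; apply: fin_len_zero. Qed.
Lemma fl_summand X Y : direct_summand X Y -> fl Y -> fl X.
Proof. by move=> [i [p ip]]; apply: fl_inj (can_inj ip). Qed.
Lemma fl_pow n X : fl X -> fl {ffun 'I_n -> X}.
Proof.
move=> H; elim: n => [|n IH]; first exact/fl_zero/zero_pow0.
apply: fl_summand (iso_summand (iso_sym (pow_add_iso 1 n X))) _; apply: fl_prod IH.
exact: fl_summand (iso_summand (iso_sym (pow1_iso X))) H.
Qed.

Lemma fl_fin_len X : fl X -> fin_len X.
Proof.
suff H n (S : X -> Prop) : @lenle K n (res_mod th X) S -> @lenle R n X S.
  by move=> [n Hn]; exists n; apply: H.
elim: n S => [|n IH] S H; first exact: H.
move=> S' smS' S'S ex; apply: IH; apply: H => //; case: smS' => S0 SD.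
by split=> [|a x y]; [apply: S0 | apply: SD].
Qed.

Hypothesis Rfin : fl R^o.

Lemma fl_free n : fl (free_mod R n). Proof. exact: fl_pow. Qed.

Lemma fl_gen X : fl X <-> fin_gen X.
Proof.
split=> [/fl_fin_len/fin_gen_of_len//|/fin_gen_free [n [p sp]]].
exact: fl_surj sp (fl_free n).
Qed.

Lemma fl_pres X : fl X -> exists n L (k : {linear L -> free_mod R n}) (p : {linear free_mod R n -> X}),
  ses k p /\ fl L.
Proof.
move=> /fl_gen /fin_gen_free [n [p sp]]; have [L [k kp]] := ker_ses sp.
exists n, L, k, p; split=> //; have [ik _ _] := kp; exact: fl_inj ik (fl_free n).
Qed.

Lemma fl_presented X : fl X -> presented X.
Proof. by move/fl_gen/fin_gen_presented. Qed.

Definition Pf X := fl X /\ exists n, pd n X.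

Lemma PfE X : Pf X <-> Pfin X.
Proof.
by split=> -[fX pX]; split; [exact/fl_gen|exact/fin_pdimE|exact/fl_gen|exact/fin_pdimE].
Qed.

Lemma Pf_mid X Y Z (f : {linear X -> Y}) (g : {linear Y -> Z}) :
  ses f g -> Pf X -> Pf Z -> Pf Y.
Proof.
move=> fg [fX [n pX]] [fZ [m pZ]]; split; first exact: fl_ses fg fX fZ.
exists (maxn n m); apply: pd_mid fg _ _; first exact: pd_le (leq_maxl n m) pX.
exact: pd_le (leq_maxr n m) pZ.
Qed.

Lemma Pf_left X Y Z (f : {linear X -> Y}) (g : {linear Y -> Z}) :
  ses f g -> Pf Y -> Pf Z -> Pf X.
Proof.
move=> fg [fX [n pX]] [fZ [m pZ]]; split; first by have [i _ _] := fg; apply: fl_inj i fX.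
exists (maxn n m); apply: pd_left fg _ _; first exact: pd_le (leq_maxl n m) pX.
exact: pd_le (leq_maxr n m) pZ.
Qed.

Lemma Pf_right X Y Z (f : {linear X -> Y}) (g : {linear Y -> Z}) :
  ses f g -> Pf X -> Pf Y -> Pf Z.
Proof.
move=> fg [fX [n pX]] [fZ [m pZ]]; split; first by have [_ _ s] := fg; apply: fl_surj s fZ.
exists (maxn n m).+1; apply: pd_right fg _ _; first exact: pd_le (leq_maxl n m) pX.
exact: pd_le (leq_maxr n m) pZ.
Qed.

Lemma Pf_prod X Y : Pf X -> Pf Y -> Pf (X * Y)%type.
Proof. exact/Pf_mid/ses_inl_snd. Qed.
Lemma Pf_summand X Y : direct_summand X Y -> Pf Y -> Pf X.
Proof.
move=> XY [fY [n pY]]; split; first exact: fl_summand XY fY.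
by exists n; apply: pd_summand XY pY.
Qed.

Lemma Pf_pow n X : Pf X -> Pf {ffun 'I_n -> X}.
Proof. by move=> [fX [m pX]]; split; [apply: fl_pow | exists m; apply: pd_pow]. Qed.
Lemma Pf_free n : Pf (free_mod R n).
Proof. by split; [apply: fl_free | exists 0; apply: (@proj_free R)]. Qed.

Lemma Pf_pres X : Pf X -> exists n L (k : {linear L -> free_mod R n}) (p : {linear free_mod R n -> X}),
  ses k p /\ Pf L.
Proof.
move=> PX; have [fX _] := PX; have [n [L [k [p [kp _]]]]] := fl_pres fX.
by exists n, L, k, p; split=> //; apply: Pf_left kp (Pf_free n) PX.
Qed.

Lemma Pf_syz n X : Pf X -> exists L, Pf L /\ syz n X L.
Proof.
elim: n X => [|n IH] X PX; first by exists X; split=> //; apply: iso_refl.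
have [m [L [k [p [kp /IH [L' [PL' s]]]]]]] := Pf_pres PX; exists L'; split=> //.
by exists L, (free_mod R m), k, p; split=> //; apply: proj_free.
Qed.

Definition perp Y := forall X, Pf X -> E1 X Y.

Lemma perp_syz n X L Y : perp Y -> Pf X -> syz n X L -> E1 L Y.
Proof. by move=> pY /(Pf_syz n) [L' [PL' s']] s; apply: E1_syz s' s _; apply: pY. Qed.
Lemma perp_mid X Y Z (f : {linear X -> Y}) (g : {linear Y -> Z}) :
  ses f g -> perp X -> perp Z -> perp Y.
Proof.
move=> fg pX pZ A PA; have [fA _] := PA.
exact: E1_extr fg (fl_presented fA) (pX _ PA) (pZ _ PA).
Qed.

Lemma perp_summand X Y : direct_summand X Y -> perp Y -> perp X.
Proof. by move=> XY pY A /pY; apply: E1_summandr. Qed.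
Lemma perp_pow n X : perp X -> perp {ffun 'I_n -> X}.
Proof. by move=> pX A /pX; apply: E1_pow. Qed.
Lemma perp_prod X Y : perp X -> perp Y -> perp (X * Y)%type.
Proof. exact/perp_mid/ses_inl_snd. Qed.
(* Ext^{d+1}(X, M) = 0 for all X in P. *)
Definition E1n d M := forall X L, Pf X -> syz d X L -> E1 L M.

Lemma E1n0 M : E1n 0 M <-> perp M.
Proof.
split=> [H X PX|H X L]; first by apply: H PX _; apply: iso_refl.
exact: perp_syz.
Qed.

Lemma E1n_S d M : E1n d M -> E1n d.+1 M.
Proof.
move=> H X L PX XL; have [n [X' [k [p [kp PX']]]]] := Pf_pres PX.
have [L' [PL' s']] := Pf_syz d PX'; apply: E1_syz _ XL (H _ _ PX' s').
by exists X', (free_mod R n), k, p; split=> //; apply: proj_free.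
Qed.

Lemma E1n_bound d M : (forall X, Pf X -> pd d X) -> E1n d M.
Proof.
by move=> b X L PX s; apply/E1_proj/(syz_pd (m := 0) s); rewrite addn0; apply: b.
Qed.

Lemma syz_presented n X L : Pf X -> syz n X L -> presented L.
Proof.
move=> [_ [m pX]] s; apply: (@pd_presented R m); apply: syz_pd s _.
by apply: pd_le pX; rewrite leq_addl.
Qed.

Lemma E1n_step d M I M' (f : {linear M -> I}) (g : {linear I -> M'}) :
  ses f g -> perp I -> E1n d.+1 M -> E1n d M'.
Proof.
move=> fg pI H X L PX XL; have [L' [P [i [p [ip pP]]]]] := syz_presented PX XL.
apply: (E1_shift fg ip pP _ (perp_syz pI PX XL)).
exact: H PX (syzSr XL ip pP).
Qed.

(** The recursion of [syz] peels off the first presentation; dimension shifting needs the last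
    one. *)
Lemma syz_last n X L : syz n.+1 X L ->
  exists L' P (i : {linear L -> P}) (p : {linear P -> L'}), [/\ ses i p, projective P & syz n X L'].
Proof.
elim: n X => [|n IH] X [X' [P [i [p [ip pP s]]]]].
  have [h [g [hK gK]]] := s; exists X, P, (compl i g), p; split=> //; last exact: iso_refl.
  have [ii ex sp] := ip; split=> //= [x y /ii|y]; first exact: (can_inj gK).
  apply: iff_trans (ex y) _; split=> [[x <-]|[x <-]]; last by exists (g x).
  by exists (h x) => /=; rewrite hK.
have [L' [P' [i' [p' [ip' pP' s']]]]] := IH _ s.
by exists L', P', i', p'; split=> //; exists X', P, i, p.
Qed.

Lemma E1n_unstep d M I M' (f : {linear M -> I}) (g : {linear I -> M'}) :
  ses f g -> perp I -> E1n d M' -> E1n d.+1 M.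
Proof.
move=> fg pI H X L PX XL; have [L' [P [i [p [ip pP s]]]]] := syz_last XL.
exact: E1_unshift fg ip pP (syz_presented PX XL) (H _ _ PX s) (perp_syz pI PX XL).
Qed.

Lemma syz_pd_conv n m X L : syz n X L -> pd m L -> pd (n + m) X.
Proof.
elim: n X => [|n IH] X; first by move=> XL; apply/pd_iso/iso_sym.
by move=> [X' [P [i [p [ip pP s]]]]] pL; exists X', P, i, p; split=> //; apply: IH.
Qed.

(** An s-th syzygy [L] has a projective syzygy [L'], by induction on the dimension of [L] with [s]
    raised by one. As [L'] is a summand of a free module, Ext^1(L, L') = 0, and the presentation of
    [L] splits. *)
Lemma bound_of_E1n s : E1n s R^o -> forall X, Pf X -> pd s X.
Proof.
move=> H X PX; have [L [PL XL]] := Pf_syz s PX.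
rewrite -[s]addn0; apply: (syz_pd_conv XL _).
have [fL [m pL]] := PL; rewrite /=.
elim: m s L fL pL H XL {PL} => [|m IH] s L fL pL H XL //.
have [n [L' [k [p [kp fL']]]]] := fl_pres fL.
have pL' : projective L'.
  apply: IH (E1n_S H) _ => //; first exact: pd_syz kp (@proj_free R n) pL.
  by apply: syzSr XL kp _; apply: proj_free.
have [n' [L'' [k' [p' [kp' _]]]]] := fl_pres fL'.
have [s' Hs'] := proj_split kp' pL'.
have E : E1 L L'.
  apply: (@E1_summandr _ _ _ (free_mod R n')); first by exists s', p'.
  exact/E1_pow/(H _ _ PX XL).
have [r Hr] := E1_section kp E; apply: proj_summand (@proj_free R n).
by exists r, p.
Qed.

(** [E] is kept apart from [J] because the last cosyzygy is at first only known to be Ext-injective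
    in P^{<oo}; that it belongs to add U is seen afterwards. *)
Fixpoint cores (J E : lmodType R -> Prop) d M : Prop :=
  match d with
  | 0 => E M
  | d'.+1 => exists I M' (f : {linear M -> I}) (g : {linear I -> M'}),
      [/\ ses f g, J I & cores J E d' M']
  end.

Lemma cores_of_E1n (J C : lmodType R -> Prop) d M :
  (forall M, C M -> exists I M' (f : {linear M -> I}) (g : {linear I -> M'}),
    [/\ ses f g, J I & C M']) ->
  (forall I, J I -> perp I) -> C M -> E1n d M -> cores J (fun M => C M /\ perp M) d M.
Proof.
move=> HC HJ; elim: d M => [|d IH] M CM HM; first by split=> //; apply/E1n0.
have [I [M' [f [g [fg JI CM']]]]] := HC M CM.
exists I, M', f, g; split=> //; apply: IH => //.
exact: E1n_step fg (HJ _ JI) HM.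
Qed.

Lemma add_pow T n : add_closure T {ffun 'I_n -> T}.
Proof. by exists n; apply/iso_summand/iso_refl. Qed.
Lemma add_self T : add_closure T T.
Proof. by exists 1%N; apply/iso_summand/pow1_iso. Qed.
Lemma add_summand T X Y : direct_summand X Y -> add_closure T Y -> add_closure T X.
Proof. by move=> XY [n YT]; exists n; apply: summand_trans XY YT. Qed.
Lemma add_prod T X Y : add_closure T X -> add_closure T Y -> add_closure T (X * Y)%type.
Proof.
move=> [n [i [p ip]]] [m [i' [p' ip']]]; exists (n + m)%N.
apply: summand_trans (iso_summand (pow_add_iso n m T)).
by exists (prodl i i'), (prodl p p') => -[x y] /=; rewrite ip ip'.
Qed.

Lemma add_zero T X : zero_mod X -> add_closure T X.
Proof.
move=> X0; exists 0%N, (zerol _ _), (zerol _ _) => x; rewrite [x]X0 //.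
Qed.

Lemma add_Pf T X : Pf T -> add_closure T X -> Pf X.
Proof. by move=> PT [n XT]; apply: Pf_summand XT (Pf_pow n PT). Qed.
Lemma add_perp T X : perp T -> add_closure T X -> perp X.
Proof. by move=> PT [n XT]; apply: perp_summand XT (perp_pow (n := n) PT). Qed.

(* Strong tilting in terms of P^{<oo} alone: a relative injective cogenerator of it, together
   with a bound on projective dimensions. *)
Definition STilt U := [/\ Pf U, perp U,
  forall X, Pf X -> exists n (f : {linear X -> {ffun 'I_n -> U}}), injective f
  & exists s, forall X, Pf X -> pd s X].

Lemma STilt_add U X : STilt U -> Pf X -> perp X -> add_closure U X.
Proof.
move=> [PU pU emb _] PX pX; have [n [f inj_f]] := emb X PX.
have [Q [g fg]] := coker_ses inj_f; have PQ := Pf_right fg PX (Pf_pow n PU).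
have [r Hr] := E1_retr fg (pX _ PQ).
by exists n, f, r.
Qed.

Lemma has_cores T s X : cores (add_closure T) (add_closure T) s X ->
  exists (C : nat -> lmodType R) (iota : {linear X -> C 0%N}) (d : forall j, {linear C j -> C j.+1}),
    [/\ forall j, (j <= s)%N -> add_closure T (C j),
        forall j, (s < j)%N -> zero_mod (C j),
        injective iota,
        exact_at iota (d 0%N)
      & forall j, exact_at (d j) (d j.+1)].
Proof.
elim: s X => [|s IH] X.
  move=> aX; pose C j : lmodType R := if j is 0 then X else free_mod R 0.
  exists C, (idl X), (fun j => zerol (C j) (C j.+1)); split=> //.
  - by case.
  - by case=> // j _; apply: zero_pow0.
  - by move=> y; split=> // _; exists y.
  - by move=> j y; split=> // _; exists 0; apply/esym/(@zero_pow0 R).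
move=> [I [M' [f [g [fg aI /IH [C [io [d [H1 H2 io_inj e0 e]]]]]]]]].
pose C' j : lmodType R := if j is j'.+1 then C j' else I.
pose d' j : {linear C' j -> C' j.+1} :=
  match j return {linear C' j -> C' j.+1} with
  | 0 => compl io g
  | j'.+1 => d j'
  end.
have [injf ex sg] := fg.
exists C', f, d'; split=> //.
- by case=> // j; apply: H1.
- by case=> // j; apply: H2.
- move=> y; apply: iff_trans (ex y) => /=; split=> [|->]; last by rewrite linear0.
  by rewrite -(linear0 io) => /io_inj.
case=> [|j] y; last exact: e.
apply: iff_trans (e0 y) _; split=> [[x <-]|[x <-]]; last by exists (g x).
by have [z <-] := sg x; exists z.
Qed.

Lemma has_cores_inv T s X (C : nat -> lmodType R) (iota : {linear X -> C 0%N})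
    (d : forall j, {linear C j -> C j.+1}) :
    [/\ forall j, (j <= s)%N -> add_closure T (C j),
        forall j, (s < j)%N -> zero_mod (C j),
        injective iota,
        exact_at iota (d 0%N)
      & forall j, exact_at (d j) (d j.+1)] ->
  cores (add_closure T) (add_closure T) s X.
Proof.
elim: s X C iota d => [|s IH] X C iota d [H1 H2 inj e0 e].
  apply: add_summand (H1 0%N _) => //; apply/iso_summand/(iso_of_bij inj) => y.
  by apply/e0; apply: H2.
have [Q [g gf]] := coker_ses inj; exists (C 0%N), Q, iota, g; split=> //; first exact: H1.
have [|io Hio] := ses_desc (h := d 0%N) gf; first by move=> x; apply/e0; exists x.
have [_ exg sg] := gf.
apply: (IH Q (fun j => C j.+1) io (fun j => d j.+1)); split.
- by move=> j js; apply: H1.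
- by move=> j js; apply: H2.
- apply: inj0 => q; have [x <-] := sg q; rewrite Hio => /e0 [z <-].
  exact: ses_comp gf z.
- move=> y; apply: iff_trans (e 0%N y) _; split=> [[x <-]|[x <-]].
    by exists (g x).
  by have [z <-] := sg x; exists z; rewrite Hio.
by move=> j; apply: e.
Qed.

(** Coresolving the ring by powers of [U] stays inside P^{<oo}. As projective dimensions there are
    at most [s], the s-th cosyzygy is Ext-injective, hence in add U. *)
Lemma strong_of_STilt U : STilt U -> strong_tilting U.
Proof.
move=> SU; have [PU pU emb [s bd]] := SU.
have Ext X : Pf X -> forall i, ExtS_vanishes i X U.
  by move=> PX i; apply: ExtSE => L; apply: perp_syz.
split; last by move=> X /PfE; apply: Ext.
split; [exact/PfE | exact: Ext |].
have E : E1n s R^o by apply: E1n_bound.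
have PR : Pf R^o.
  by apply: Pf_summand (Pf_free 1); apply/iso_summand/pow1_iso.
have [|C HC] := @has_cores U s R^o; last by exists s, C.
have step M : Pf M -> exists I M' (f : {linear M -> I}) (g : {linear I -> M'}),
    [/\ ses f g, add_closure U I & Pf M'].
  move=> PM; have [n [f inj_f]] := emb M PM; have [Q [g fg]] := coker_ses inj_f.
  exists {ffun 'I_n -> U}, Q, f, g; split=> //; first exact: add_pow.
  exact: Pf_right fg PM (Pf_pow n PU).
have := cores_of_E1n step (fun I => @add_perp U I pU) PR E.
move: {E PR bd} s (R^o : lmodType R); elim=> [|s IH] X /=.
  by move=> [PX pX]; apply: STilt_add.
by move=> [I [M' [f [g [fg aI c]]]]]; exists I, M', f, g; split=> //; apply: IH.
Qed.

(** * Strong tilting modules cogenerate P^{<oo} *)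

Section StrongTilting.
Variable T : lmodType R.
Hypothesis sT : strong_tilting T.

Lemma strong_Pf : Pf T. Proof. by case: sT => -[/PfE]. Qed.
Lemma strong_perp : perp T.
Proof.
move=> X PX; have [_ /(_ X) H] := sT; have PX' : Pfin X by apply/PfE.
have [_ fX] := PX'; have [L [XL E]] := ExtS_E1 (H PX' 0%N) fX.
exact: E1_syz XL (iso_refl X) E.
Qed.

Lemma strong_cores : exists s, cores (add_closure T) (add_closure T) s R^o.
Proof. by case: sT => -[_ _ [s [C [io [d H]]]]] _; exists s; apply: has_cores_inv H. Qed.

(** The terms of the coresolution of the ring are Ext-injective, so its length bounds the degrees in
    which Ext from P^{<oo} to the ring is nonzero. *)
Lemma strong_bound : exists s, forall X, Pf X -> pd s X.
Proof.
have [s c] := strong_cores; exists s; apply: bound_of_E1n.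
move: s (R^o : lmodType R) c; elim=> [|s IH] X /=; first by move/(add_perp strong_perp) => ?; apply/E1n0.
move=> [I [M' [f [g [fg aI /IH c]]]]]; apply: E1n_unstep fg _ c.
exact: add_perp strong_perp aI.
Qed.

Lemma noether X V W2 T' V' (f : {linear X -> V}) (g : {linear V -> W2})
    (f' : {linear V -> T'}) (g' : {linear T' -> V'}) :
  ses f g -> ses f' g' ->
  exists (W : lmodType R) (p : {linear T' -> W}) (a : {linear W2 -> W}) (b : {linear W -> V'}),
    [/\ ses (compl f' f) p, ses a b, forall x, a (g x) = p (f' x) & forall x, b (p x) = g' x].
Proof.
move=> fg fg'; have [i e s] := fg; have [i' e' s'] := fg'.
have [|W [p pf]] := @coker_ses _ _ _ (compl f' f); first by move=> x y /= /i' /i.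
have [|a Ha] := ses_desc (h := compl p f') fg; first by move=> x; have := ses_comp pf x.
have [|b Hb] := ses_desc (h := g') pf; first by move=> x /=; rewrite (ses_comp fg').
exists W, p, a, b; split=> //; have [ip ep sp] := pf; split.
- apply: inj0 => w; have [v <-] := s w; rewrite Ha => /ep [x /= /i' <-].
  exact: ses_comp fg x.
- move=> w; have [t <-] := sp w; rewrite Hb; split=> [/e' [v <-]|[w' E]].
    by exists (g v).
  have [v Ev] := s w'; have /ep [x E'] : p (f' v - t) = 0 by have := Ha v; rewrite Ev E linearB /= => ->; rewrite subrr.
  by rewrite -[t](subKr (f' v)) linearB -E' /= !(ses_comp fg') subrr.
by move=> v; have [t <-] := s' v; exists (p t).
Qed.

(* The coresolutions of R by add T generalize to all of P^{<oo} by induction on their length t;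
   this is how T is seen to cogenerate. *)
Fixpoint Gc t X : Prop :=
  match t with
  | 0 => Pf X /\ exists T' (f : {linear X -> T'}), add_closure T T' /\ injective f
  | t'.+1 => exists T' X' (f : {linear X -> T'}) (g : {linear T' -> X'}),
      [/\ ses f g, add_closure T T', Pf X & Gc t' X']
  end.

Lemma Gc_Pf t X : Gc t X -> Pf X.
Proof. by case: t => [[]|t [T' [X' [f [g []]]]]]. Qed.
Lemma Gc_emb t X : Gc t X -> exists T' (f : {linear X -> T'}), add_closure T T' /\ injective f.
Proof. by case: t => [[]|t [T' [X' [f [g [[i _ _] aT _ _]]]]]] //; exists T', f. Qed.
Lemma GcS t X : Gc t.+1 X -> Gc t X.
Proof.
elim: t X => [|t IH] X [T' [X' [f [g [fg aT PX G']]]]].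
  by split=> //; exists T', f; split=> //; have [] := fg.
by exists T', X', f, g; split=> //; apply: IH.
Qed.

Lemma Gc_add t X : add_closure T X -> Gc t X.
Proof.
elim: t X => [|t IH] X aX; have PX := add_Pf strong_Pf aX.
  by split=> //; exists X, (idl X); split=> // x y.
exists X, {ffun 'I_0 -> R^o}, (idl X), (zerol _ _); split=> //.
  split=> // [y|y]; first by split=> // _; exists y.
  by exists 0; apply/esym/(@zero_pow0 R).
by apply: IH; apply: add_zero; apply: zero_pow0.
Qed.

(** Dual horseshoe: the map of [X'] into add T extends to [X] because Ext^1(X'', T) = 0, and the
    cokernels form a short exact sequence again. *)
Lemma Gc_ext t X' X X'' (f : {linear X' -> X}) (g : {linear X -> X''}) :
  ses f g -> Gc t X' -> Gc t X'' -> Gc t X.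
Proof.
have emb X1 X2 X3 T1 T3 (u : {linear X1 -> X2}) (v : {linear X2 -> X3}) (a : {linear X1 -> T1})
    (b : {linear X3 -> T3}) : ses u v -> injective a -> injective b -> Pf X3 -> add_closure T T1 ->
    exists h : {linear X2 -> (T1 * T3)%type}, [/\ injective h, forall x, h (u x) = (a x, 0)
      & forall x, (h x).2 = b (v x)].
  move=> uv ia ib P3 aT1; have [a' Ha'] := add_perp strong_perp aT1 P3 uv a.
  exists (pairl a' (compl b v)); split=> //; last by move=> x /=; rewrite Ha' (ses_comp uv) linear0.
  apply: inj0 => x /= [a0]; rewrite -(linear0 b) => /ib; case: uv => _ e _ /e [y E].
  by move: a0; rewrite -E Ha' -(linear0 a) => /ia ->; rewrite linear0.
elim: t X' X X'' f g => [|t IH] X' X X'' f g fg.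
  move=> [P' [T1 [a [aT1 ia]]]] [P3 [T3 [b [aT3 ib]]]].
  have [h [ih _ _]] := emb _ _ _ _ _ f g a b fg ia ib P3 aT1.
  split; first exact: Pf_mid fg P' P3.
  by exists (T1 * T3)%type, h; split=> //; apply: add_prod.
move=> [T1 [Y1 [a [c [ac aT1 P1 G1]]]]] [T3 [Y3 [b [d [bd aT3 P3 G3]]]]].
have [ia ea sc] := ac; have [ib eb sd] := bd; have [jf ef sg] := fg.
have [h [ih hu hv]] := emb _ _ _ _ _ f g a b fg ia ib P3 aT1.
have [Y2 [q hq]] := coker_ses ih; have [_ eq sq] := hq.
exists (T1 * T3)%type, Y2, h, q; split=> //; first exact: add_prod.
  exact: Pf_mid fg P1 P3.
have [|x Hx] := ses_desc (h := compl q (inll T1 T3)) ac.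
  by move=> y /=; rewrite -hu (ses_comp hq).
have [|y Hy] := ses_desc (h := compl d (sndl T1 T3)) hq.
  by move=> z /=; rewrite hv (ses_comp bd).
apply: (IH _ _ _ x y) G1 G3; split.
- apply: inj0 => z; have [w <-] := sc z; rewrite Hx /= => /eq [v Hv].
  have /ef [u fu] : g v = 0 by apply: ib; rewrite -hv Hv linear0.
  by have := Hv; rewrite -fu hu => -[<-]; apply: ses_comp ac _.
- move=> z; have [w <-] := sq z; rewrite Hy; split=> [/= /eb [v bv]|[v]].
    have [u gu] := sg v.
    exists (c (w.1 - (h u).1)); rewrite Hx /=; apply/subr0_eq; rewrite -linearB.
    apply/eq; exists (- u); rewrite linearN [h u]surjective_pairing hv gu bv.
    by case: (w) => w1 w2 /=; congr (_, _); rewrite ?sub0r // addrAC subrr sub0r.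
  have [t' <-] := sc v; rewrite Hx /= => E.
  have /eq [u hu'] : q ((t', 0) - w) = 0 by rewrite linearB -E subrr.
  have {}E := congr1 snd hu'; rewrite hv /= sub0r in E.
  by rewrite -[w.2]opprK -E linearN (ses_comp bd) oppr0.
by move=> z; have [w <-] := sd z; exists (q (0, w)); rewrite Hy.
Qed.

(** With [X] embedded in [T'] through [V], the cokernel is an extension of the cokernel of [V] by
    [X2], and for these one level less suffices. *)
Lemma Gc_ker t X V X2 (f : {linear X -> V}) (g : {linear V -> X2}) :
  ses f g -> Gc t V -> Gc t X2 -> Gc t X.
Proof.
move=> fg; case: t => [|t] GV G2; have PX := Pf_left fg (Gc_Pf GV) (Gc_Pf G2).
  split=> //; have [T' [h [aT ih]]] := Gc_emb GV; have [jf _ _] := fg.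
  by exists T', (compl h f); split=> // x y /= /ih/jf.
case: GV => [T' [V' [f' [g' [fg' aT PV GV']]]]].
have [W [p [a [b [pf ab _ _]]]]] := noether fg fg'.
exists T', W, (compl f' f), p; split=> //; exact: Gc_ext ab (GcS G2) GV'.
Qed.

(** A coresolution of the ring can be continued by zeros, so every length is available. All lengths
    are wanted because each step up in projective dimension uses up one level. *)
Lemma Gc_free1 t : Gc t R^o.
Proof.
have [s c] := strong_cores.
have PR : Pf R^o by apply: Pf_summand (Pf_free 1); apply/iso_summand/pow1_iso.
move: s t (R^o : lmodType R) c PR; elim=> [|s IH] t X c PX; first exact: Gc_add.
case: c => [I [M' [f [g [fg aI c]]]]].
have PM : Pf M' by apply: Pf_right fg PX (add_Pf strong_Pf aI).
case: t => [|t]; first by split=> //; exists I, f; split=> //; have [] := fg.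
by exists I, M', f, g; split=> //; apply: IH.
Qed.

Lemma Gc_zero t X : zero_mod X -> Gc t X.
Proof. by move=> X0; apply/Gc_add/add_zero. Qed.

Lemma Gc_iso t X Y : lmod_iso X Y -> Gc t Y -> Gc t X.
Proof.
move=> /iso_bij [f [i s]] G; have f0 : ses f (zerol Y {ffun 'I_0 -> R^o}).
  split=> [//|y|y]; first by split=> [_|_]; [apply: s | apply: zero_pow0].
  by exists 0; apply/esym/(@zero_pow0 R).
by apply: Gc_ker f0 G _; apply/Gc_zero/zero_pow0.
Qed.

Lemma Gc_prod t X Y : Gc t X -> Gc t Y -> Gc t (X * Y)%type.
Proof. exact/Gc_ext/ses_inl_snd. Qed.

Lemma Gc_free t n : Gc t (free_mod R n).
Proof.
elim: n => [|n IH]; first exact/Gc_zero/zero_pow0.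
apply: Gc_iso (iso_sym (pow_add_iso 1 n R^o)) _; apply: Gc_prod IH.
exact: Gc_iso (iso_sym (pow1_iso R^o)) (Gc_free1 t).
Qed.

(** [X] splits off a free module with projective complement [L]. The cokernel of [X] in add T is an
    extension of the cokernel of the free module by [L], whence the induction on [t]. *)
Lemma Gc_proj t X : fl X -> projective X -> Gc t X.
Proof.
elim: t X => [|t IH] X fX pX; have PX : Pf X by split=> //; exists 0.
all: have [n [L [k [p [kp fL]]]]] := fl_pres fX; have [s ps] := proj_split kp pX.
  have [T' [h [aT ih]]] := Gc_emb (Gc_free 0 n).
  by split=> //; exists T', (compl h s); split=> // x y /= /ih; apply: (can_inj ps).
have [|r Hr] := ses_lift (h := addl (idl _) (oppl (compl s p))) kp.
  by move=> x /=; rewrite linearB ps subrr.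
have [jk ek _] := kp.
have sr : ses s r.
  split; first exact: can_inj ps.
    move=> y; have /= Hy := Hr y; split=> [ry|[x <-]].
      by exists (p y); apply/esym/subr0_eq; rewrite -Hy ry linear0.
    by apply: jk; rewrite Hr /= ps subrr linear0.
  by move=> l; exists (k l); apply: jk; rewrite Hr /= (ses_comp kp) linear0 subr0.
have [T' [V' [f' [g' [fg' aT PV GV']]]]] := Gc_free t.+1 n.
have [W [q [a [b [qf ab _ _]]]]] := noether sr fg'.
exists T', W, (compl f' s), q; split=> //; apply: Gc_ext ab (IH _ fL _) GV'.
apply: (proj_summand _ (@proj_free R n)).
by exists k, r => l; apply: jk; rewrite Hr /= (ses_comp kp) linear0 subr0.
Qed.

Lemma Gc_all t X : Pf X -> Gc t X.
Proof.
move=> [fX [n]]; elim: n t X fX => [|n IH] t X fX pX; first exact: Gc_proj.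
have PX : Pf X by split=> //; exists n.+1.
have [m [L [k [p [kp fL]]]]] := fl_pres fX; have [jk ek sp] := kp.
have pL : pd n L := pd_syz kp (@proj_free R m) pX.
have [T1 [X1 [a [c [ac aT1 P1 G1]]]]] := Gc_free t.+1 m.
have [T2 [X2 [b [d [bd aT2 P2 G2]]]]] := IH t.+1 L fL pL.
have [ja ea sc] := ac; have [jb eb sd] := bd.
have [b' Hb'] := add_perp strong_perp aT2 PX kp b.
(* X embeds in V = (T1 x T2)/L, an extension of X2 by T1, with cokernel an extension of X1 by T2 *)
pose h := pairl a b'; have jh : injective h by move=> x y [/ja].
have jhk : injective (compl h k) by move=> x y /= /jh/jk.
have [V [q hq]] := coker_ses jhk; have [Y [r hr]] := coker_ses jh.
have [_ eq sq] := hq; have [_ er sr] := hr.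
have [|u Hu] := ses_desc (h := compl q h) kp; first by move=> x; have := ses_comp hq x.
have [|v Hv] := ses_desc (h := r) hq; first by move=> x /=; rewrite (ses_comp hr).
have uv : ses u v.
  split.
  - apply: inj0 => x; have [y <-] := sp x; rewrite Hu => /eq [z /jh <-].
    exact: ses_comp kp z.
  - move=> y; have [w <-] := sq y; rewrite Hv; split=> [/er [z <-]|[x]].
      by exists (p z); rewrite Hu.
    have [z <-] := sp x; rewrite Hu => E.
    have /eq [l El] : q (w - h z) = 0 by rewrite linearB -E subrr.
    by rewrite -[w](subrK (h z)) -El linearD [r (h z)](ses_comp hr) [r _](ses_comp hr (k l)) addr0.
  by move=> y; have [w <-] := sr y; exists (q w); rewrite Hv.
apply: Gc_ker uv _ _.
  have [|x Hx] := ses_desc (h := compl d (sndl T1 T2)) hq.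
    by move=> y /=; rewrite Hb' (ses_comp bd).
  apply: (@Gc_ext t T1 V X2 (compl q (inll T1 T2)) x _ (Gc_add t aT1) G2); split.
  - apply: inj0 => y /= /eq [z [<-]]; rewrite Hb' -(linear0 b) => /jb ->.
    by rewrite !linear0.
  - move=> y; have [w <-] := sq y; rewrite Hx; split=> [/= /eb [z Ez]|[z Ez]].
      exists (w.1 - a (k z)); apply/subr0_eq; rewrite -linearB; apply/eq; exists (- z).
      rewrite !linearN /= Hb' Ez; case: (w) => w1 w2; congr (_, _) => /=.
        by rewrite addrAC subrr sub0r.
      by rewrite sub0r.
    have /eq [l El] : q (inll T1 T2 z - w) = 0 by rewrite linearB -Ez subrr.
    have {}El := congr1 snd El; rewrite /= Hb' sub0r in El.
    by rewrite /= -[w.2]opprK -El linearN (ses_comp bd) oppr0.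
  by move=> y; have [w <-] := sd y; exists (q (0, w)); rewrite Hx.
have [|x Hx] := ses_desc (h := compl c (fstl T1 T2)) hr.
  by move=> y /=; rewrite (ses_comp ac).
apply: (@Gc_ext t T2 Y X1 (compl r (inrl T1 T2)) x _ (Gc_add t aT2) G1); split.
- by apply: inj0 => y /= /er [z [E <-]]; rewrite (ja z 0) ?linear0 // E.
- move=> y; have [w <-] := sr y; rewrite Hx; split=> [/= /ea [z Ez]|[z Ez]].
    exists (w.2 - b' z); apply/subr0_eq; rewrite -linearB; apply/er; exists (- z).
    rewrite !linearN /= Ez; case: (w) => w1 w2; congr (_, _) => /=.
      by rewrite sub0r.
    by rewrite addrAC subrr sub0r.
  have /er [l El] : r (inrl T1 T2 z - w) = 0 by rewrite linearB -Ez subrr.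
  have {}El := congr1 fst El; rewrite /= sub0r in El.
  by rewrite /= -[w.1]opprK -El linearN (ses_comp ac) oppr0.
by move=> y; have [w <-] := sc y; exists (r (w, 0)); rewrite Hx.
Qed.

Lemma STilt_of_strong : STilt T.
Proof.
split; [exact: strong_Pf | exact: strong_perp | | exact: strong_bound].
move=> X /(Gc_all 0)/Gc_emb [T' [f [[n [i [p ip]]] jf]]].
by exists n, (compl i f) => x y /= /(can_inj ip); apply: jf.
Qed.

End StrongTilting.
End FiniteAlgebra.

(** * Commutative artinian rings *)

Section Artinian.
Variable K : comNzRingType.
Hypothesis artK : artinian K.
Implicit Types I J V S : K^o -> Prop.

Lemma submod_ideal I : submod I -> @left_ideal K I.
Proof.
move=> [I0 ID]; split=> // [x y Ix Iy|a x Ix].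
  by rewrite -[x]mul1r; apply: (ID 1).
by rewrite -[_ * _]addr0; apply: (ID a).
Qed.

Lemma dcc_min (Q : (K^o -> Prop) -> Prop) I0 : Q I0 -> (forall I, Q I -> submod I) ->
  exists I, Q I /\ forall J, Q J -> (forall x, J x -> I x) -> forall x, I x -> J x.
Proof.
move=> Q0 Qsm; apply: contrapT => H.
have step (I : {I | Q I}) : exists J : {I | Q I},
    (forall x, sval J x -> sval I x) /\ ~ forall x, sval I x -> sval J x.
  case: I => I QI /=; apply: contrapT => nJ; apply: H; exists I; split=> // J QJ JI.
  by apply: contrapT => nIJ; apply: nJ; exists (exist _ J QJ).
have [f Hf] := choice step.
pose s n := iter n f (exist _ I0 Q0).
have [n Hn] := artK (I := fun n => sval (s n)) (fun n => submod_ideal (Qsm _ (svalP (s n))))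
  (fun n => (Hf (s n)).1).
by case: (Hf (s n)) => _; apply; apply: (Hn n.+1).
Qed.

(** On an ideal [I] minimal among those of infinite length, each scalar acts as 0 or invertibly, so
    [I] behaves like a vector space. A subspace maximal among those missing a nonzero vector has
    finite length and a simple quotient, so [I] has finite length after all. *)
Lemma artinian_fin_len : fin_len K^o.
Proof.
apply: contrapT => nfl.
pose FL S := exists n, lenle n S.
have FLfull : ~ FL (fun _ => True) by [].
have [I [[smI nI] minI]] := @dcc_min (fun I => submod I /\ ~ FL I) _ (conj (@submod_full K K^o) FLfull)
  (fun I H => H.1).
have prop J : submod J -> (forall x, J x -> I x) -> (exists x, I x /\ ~ J x) -> FL J.
  move=> smJ JI [x [Ix nJ]]; apply: contrapT => nF; apply: nJ.
  exact: minI.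
have lmul (a : K) : linear (fun x : K^o => a * x : K^o).
  by move=> b x y; rewrite mulrDr; congr (_ + _); apply: mulrCA.
(* Otherwise the kernel and the image of multiplication by [a] are properly contained in [I], hence
   of finite length, and so is [I]. *)
have dich (a : K) : (forall x, I x -> a * x = 0) \/ (forall y, I y -> exists x, I x /\ a * x = y).
  have [H|H] := pselect (forall y, I y -> exists x, I x /\ a * x = y); first by right.
  left=> x Ix; apply: contrapT => nx; apply: nI.
  pose f := lin_of (lmul a).
  have [m Hm] : FL (fun x => I x /\ f x = 0).
    apply: prop; first exact: submodI smI (ker_submod f).
      by move=> y [].
    by exists x; split=> // -[].
  have [n Hn] : FL (fun y => exists x, I x /\ f x = y).
    apply: prop; first exact: submod_im.
      by move=> y [z [Iz <-]]; case: smI => I0 ID; rewrite /f /= -[_ * _]addr0; apply: (ID a).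
    apply: contrapT => H'; apply: H => y Iy; apply: contrapT => H; apply: H'; by exists y.
  by exists (m + n)%N; apply: lenle_add Hm Hn.
have [x [Ix nx]] : exists x, I x /\ x <> 0.
  apply: contrapT => H; apply: nI; exists 0%N => x Ix; apply: contrapT => nx.
  by apply: H; exists x.
have smK (S : K^o -> Prop) (a : K) y : submod S -> S y -> S (a * y).
  by move=> [S0 SD] Sy; rewrite -[_ * _]addr0; apply: (SD a).
have inv (a : K) : (forall y, I y -> exists x, I x /\ a * x = y) ->
    exists b : K, forall y, I y -> b * (a * y) = y.
  move=> asurj.
  have anz n : exists y, I y /\ a ^+ n * y = x.
    elim: n => [|n [y [Iy Ey]]]; first by exists x; rewrite expr0 mul1r.
    by have [z [Iz Ez]] := asurj y Iy; exists z; rewrite exprSr -mulrA Ez.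
  (* [C n] consists of the scalars acting on [I] as multiples of a^n. Stability of this chain gives
     [b] such that a^n = a^(n+1) b on [I]. *)
  pose C n : K^o -> Prop := fun z => exists b : K, forall y, I y -> z * y = a ^+ n * (b * y).
  have smC n : submod (C n).
    split=> [|c u v [b Hb] [d Hd]]; first by exists 0 => y _; rewrite !mul0r mulr0.
    exists (c * b + d) => y Iy; rewrite mulrDl /= -[c *: u]/(c * u) -mulrA Hb // Hd //.
    by rewrite mulrDl mulrDr; congr (_ + _); rewrite mulrCA -mulrA.
  have [|n Hn] := artK (fun n => submod_ideal (smC n)).
    move=> n z [b Hb]; exists (a * b) => y Iy; rewrite Hb // exprSr -!mulrA.
    by [].
  have [||b Hb] := Hn n.+1 _ (a ^+ n) => //; first by exists 1 => y _; rewrite mul1r.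
  (* 1 - b a acts as 0, as wanted, or surjectively. The latter would make a^n vanish on [I], against
     [anz]. *)
  exists b => y Iy; have [H|H] := dich (1 - b * a).
    by have /eqP := H y Iy; rewrite mulrBl mul1r subr_eq0 -mulrA => /eqP.
  have [z [Iz Ez]] := anz n; have [w [Iw Ew]] := H z Iz; case: nx.
  rewrite -Ez -Ew mulrBl mul1r mulrBr Hb // exprSr.
  by rewrite -!mulrA [a * (b * w)]mulrCA subrr.
pose QV V := submod V /\ (forall y, V y -> I y) /\ ~ V x.
have QFL V : QV V -> FL V by move=> [smV [VI nV]]; apply: prop => //; exists x.
(* The union of a strictly ascending sequence of ideals missing [x] still misses [x], so it has
   finite length, which such a sequence contradicts. *)
have [V [QVV maxV]] : exists V, QV V /\ forall V', QV V' -> (forall y, V y -> V' y) -> forall y, V' y -> V y.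
  apply: contrapT => H.
  have Q0 : QV (fun y => y = 0).
    split; last by split=> // y ->; case: smI.
    by split=> // a y z -> ->; rewrite scaler0 addr0.
  have step (S : {S | QV S}) : exists S' : {S | QV S},
      (forall y, sval S y -> sval S' y) /\ exists y, sval S' y /\ ~ sval S y.
    case: S => S QS /=; apply: contrapT => nS; apply: H; exists S; split=> // S' QS' SS' y S'y.
    by apply: contrapT => nSy; apply: nS; exists (exist _ S' QS'); split=> //; exists y.
  have [f Hf] := choice step.
  pose s n := iter n f (exist _ _ Q0).
  have smono n m y : (n <= m)%N -> sval (s n) y -> sval (s m) y.
    move=> /subnK <-; elim: (m - n)%N => [//|k IH] /IH; rewrite addSn; apply: (Hf _).1.
  pose U y := exists n, sval (s n) y.
  have [n Hn] : FL U.
    apply: QFL; split; last first.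
      split=> [y [n]|[n]]; first by case: (svalP (s n)) => _ [H' _]; apply: H'.
      by case: (svalP (s n)) => _ [].
    split=> [|a y z [n Hn] [m Hm]]; first by exists 0%N.
    exists (maxn n m); case: (svalP (s (maxn n m))) => -[_ SD] _; apply: SD.
      exact: smono (leq_maxl _ _) Hn.
    exact: smono (leq_maxr _ _) Hm.
  have bad k m : lenle k (sval (s (m + k.+1)%N)) -> False.
    elim: k => [|k IH] Hk.
      have [_ [y [sy nsy]]] := Hf (s m); apply: nsy.
      rewrite (Hk y); last by rewrite addn1.
      by case: (svalP (s m)) => -[].
    apply: IH; have [H1 H2] := Hf (s (m + k.+1)%N); rewrite addnS in Hk; apply: Hk => //.
    by case: (svalP (s (m + k.+1)%N)).
  by apply: (bad n 0%N); apply: lenle_sub Hn => y Hy; exists (0 + n.+1)%N.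
have [smV [VI nVx]] := QVV.
(* If [x] lies in V + K y, inverting the scalar puts [y] in V + K x. Otherwise V + K y misses [x],
   and [y] is in [V] by maximality. *)
have cover y : I y -> exists c : K, V (y - c * x).
  move=> Iy; have [[c [v [Vv E]]]|H] := pselect (exists (c : K) v, V v /\ x = v + c * y).
    have [cI|/inv [b Hb]] := dich c.
      by case: nVx; rewrite E cI // addr0.
    exists b; have -> : y - b * x = (- b) * v; last exact: smK.
    by rewrite E mulrDr Hb // opprD addrCA subrr addr0 mulNr.
  exists 0; rewrite mul0r subr0.
  apply: (maxV (fun z => exists (c : K) v, V v /\ z = v + c * y)).
  - split; [split | split].
    + by exists 0, 0; rewrite mul0r addr0; case: smV.
    + move=> a _ _ [c [v [Vv ->]]] [d [w [Vw ->]]]; exists (a * c + d), (a * v + w).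
      split; first by case: smV => _; apply.
      by rewrite mulrDl -mulrA addrACA -mulrDr.
    + move=> _ [c [v [Vv ->]]]; case: smI => _ ID; rewrite addrC; apply: ID => //.
      exact: VI.
    by move=> [c [v [Vv E]]]; apply: H; exists c, v.
  - by move=> z Vz; exists 0, z; rewrite mul0r addr0.
  by exists 1, 0; rewrite mul1r add0r; case: smV.
have [m Hm] := QFL V QVV; have [W [Q [i [q [[_ eq sq] iV]]]]] := sub_quot smV.
have qV y : q y = 0 <-> V y by apply: iff_trans (eq y) (iff_sym (iV y)).
have qZ (a : K) y : a *: q y = q (a * y) by rewrite -linearZ.
apply: nI; exists (m + 1)%N; apply: (lenle_add (f := q) smI).
  by apply: lenle_sub Hm => y [_ /qV].
move=> S smS SI [z [[y [Iy <-]] nSy]] w Sw; apply: contrapT => nw; apply: nSy.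
have xS : S (q x).
  have [u [Iu Eu]] := SI _ Sw; have [c Vc] := cover u Iu.
  have Ew : w = c *: q x.
    by rewrite -Eu qZ; apply/subr0_eq; rewrite -linearB; apply/qV.
  have [cI|/inv [b Hb]] := dich c.
    by case: nw; rewrite Ew qZ cI // linear0.
  have -> : q x = b *: w by rewrite Ew qZ qZ Hb.
  by case: smS => S0 SD; rewrite -[_ *: _]addr0; apply: SD.
have [c Vc] := cover y Iy.
have -> : q y = c *: q x.
  by rewrite qZ; apply/subr0_eq; rewrite -linearB; apply/qV.
by case: smS => S0 SD; rewrite -[_ *: _]addr0; apply: SD.
Qed.

End Artinian.

(** * An injective cogenerator *)

Section InjectiveCogenerator.
Variable K : comNzRingType.
Hypothesis finK : fin_len K^o.
Implicit Types X Y L N : lmodType K.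

Definition maxid (m : K^o -> Prop) :=
  [/\ submod m, ~ m 1 & forall c, ~ m c -> exists b : K, m (1 - b * c)].

(** A composition series of [S] as data: the pair [(a, m)] stands for a factor generated by [a] and
    killed by the maximal ideal [m]. *)
Fixpoint comp_series (s : seq (K * (K^o -> Prop))) (S : K^o -> Prop) : Prop :=
  match s with
  | [::] => forall x, S x -> x = 0
  | (a, m) :: s' => exists S', [/\ comp_series s' S', maxid m,
      forall x, S x -> exists c y : K, S' y /\ x = c * a + y & forall c, m c -> S' (c * a)]
  end.

Lemma comp_series_exists n (S : K^o -> Prop) : submod S -> lenle n S ->
  exists s, comp_series s S.
Proof.
elim: n S => [|n IH] S smS H; first by exists [::].
have [[a0 [Sa0 na0]]|S0] := pselect (exists x, S x /\ x <> 0); last first.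
  by exists [::] => x Sx; apply: contrapT => nx; apply: S0; exists x.
pose Q S' := submod S' /\ ((forall x, S' x -> S x) /\ exists x, S x /\ ~ S' x).
have Q0 : Q (fun x => x = 0).
  split; first by split=> // a x y -> ->; rewrite scaler0 addr0.
  by split=> [x ->|]; [case: smS | exists a0].
have [S' [[smS' [S'S [a [Sa nSa]]]] maxS']] := fin_len_max finK Q0 (fun S QS => QS.1).
have [|s Hs] := IH S' smS'; first by apply: H => //; exists a.
have [S'0 S'D] := smS'; have [S_0 SD] := smS.
have cover c : S c -> ~ S' c -> forall x, S x -> exists b y : K, S' y /\ x = b * c + y.
  move=> Sc nS'c x Sx; apply: contrapT => nx; apply: nS'c.
  pose V z := exists b y : K, S' y /\ z = b * c + y.
  apply: (maxS' V); last by exists 1, 0; rewrite mul1r addr0.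
    split; [split | split].
    - by exists 0, 0; rewrite mul0r addr0.
    - move=> d _ _ [b [y [Sy ->]]] [b' [y' [Sy' ->]]]; exists (d * b + b'), (d * y + y').
      by split; [apply: S'D | rewrite mulrDl -mulrA addrACA -mulrDr].
    - by move=> _ [b [y [/S'S Sy ->]]]; apply: SD.
    by exists x.
  by move=> y Sy; exists 0, y; rewrite mul0r add0r.
exists ((a, fun c : K => S' (c * a)) :: s); exists S'; split=> //; last exact: cover.
split=> [||c nc].
- split=> [|d x y Hx Hy]; first by rewrite mul0r.
  by rewrite mulrDl -mulrA; apply: S'D.
- by rewrite mul1r.
have Sca : S (c * a) by rewrite -[_ * _]addr0; apply: SD.
have [b [y [Sy Ey]]] := cover _ Sca nc a Sa.
by exists b; rewrite mulrBl mul1r -mulrA {1}Ey addrAC subrr add0r.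
Qed.

(** At the step of the series where the submodule [S] does not kill [x] but the next one does, a x
    is nonzero and killed by [m]. *)
Lemma comp_series_kill s S X (x : X) : comp_series s S -> (exists c, S c /\ c *: x <> 0) ->
  exists a m z, [/\ List.In (a, m) s, maxid m, z = a *: x, z <> 0 & forall c, m c -> c *: z = 0].
Proof.
elim: s S => [|[a m] s IH] S /=; first by move=> S0 [c [/S0 ->]]; rewrite scale0r.
move=> [S' [cs mm cov Hm]] [c [Sc nc]].
have [H|H] := pselect (exists c, S' c /\ c *: x <> 0).
  have [a' [m' [z [i mm' Ez nz kz]]]] := IH _ cs H.
  by exists a', m', z; split=> //; right.
have S'x d : S' d -> d *: x = 0.
  by move=> Sd; apply: contrapT => nd; apply: H; exists d.
exists a, m, (a *: x); split=> //; first by left.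
  by move=> ax; have [b [y [Sy Ec]]] := cov c Sc; apply: nc; rewrite Ec scalerDl -scalerA ax scaler0 S'x ?addr0.
by move=> d md; rewrite scalerA; apply: S'x; apply: Hm.
Qed.

Definition essential X Y (s : {linear X -> Y}) :=
  injective s /\ forall y, y <> 0 -> exists (k : K) x, k *: y <> 0 /\ s x = k *: y.

(** Multiplication by [a] maps the elements killed by [S'] to elements killed by [m], with the
    elements killed by [S] as kernel. By essentiality its image lies in [X0], since scalars outside
    [m] are invertible modulo [m]. Each factor thus adds at most [l]. *)
Lemma comp_series_bound s S n l X0 X (j : {linear X0 -> X}) :
  comp_series s S -> essential j -> len l X0 ->
  lenle n (fun x : X => forall c, S c -> c *: x = 0) -> exists b, (b <= n + size s * l)%N /\ len b X.
Proof.
move=> cs [_ ess] lX0; elim: s S n cs => [|[a m] s IH] S n /=.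
  move=> S0 H; exists n; split; first by rewrite mul0n addn0.
  by apply: lenle_sub H => x _ c /S0 ->; rewrite scale0r.
move=> [S' [cs [smm m1 mm] cov Hm]] H.
have la : linear (fun x : X => a *: x).
  by move=> b x y; rewrite scalerDr !scalerA mulrC.
have [|b [Hb Lb]] := IH S' (n + l)%N cs; last by exists b; split=> //; rewrite mulSn addnA.
apply: (lenle_add (f := lin_of la)).
- split=> [c _|d x y Hx Hy c Sc]; first by rewrite scaler0.
  by rewrite scalerDr scalerA mulrC -scalerA Hx // Hy // scaler0 addr0.
- apply: lenle_sub H => x [Hx /= ax] c /cov [d [y [Sy ->]]].
  by rewrite scalerDl -scalerA ax scaler0 Hx // addr0.
apply: lenle_sub (lenle_im j (@submod_full K X0) lX0) => _ [x [Hx <-]] /=.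
have [->|/eqP ny] := eqVneq (a *: x) 0; first by exists 0; rewrite linear0.
have [k [z [nk Ez]]] := ess _ ny.
have nmk : ~ m k by move=> mk; apply: nk; rewrite scalerA Hx //; apply: Hm.
have [b Hb] := mm k nmk; exists (b *: z); split=> //.
have : (1 - b * k) *: (a *: x) = 0 by rewrite scalerA Hx //; apply: Hm.
have -> : j (b *: z) = b *: j z by rewrite linearZ.
by rewrite scalerBl scale1r Ez -scalerA => /eqP; rewrite subr_eq0 => /eqP.
Qed.

Lemma simple_sum (s : seq (K * (K^o -> Prop))) :
  exists X, fin_len X /\ forall a m, List.In (a, m) s -> maxid m ->
    exists z : X, z <> 0 /\ forall c, m c -> c *: z = 0.
Proof.
elim: s => [|[a m] s [X [fX HX]]].
  by exists {ffun 'I_0 -> K^o}; split=> //; apply/fin_len_zero/zero_pow0.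
have [mm|nm] := pselect (maxid m); last first.
  by exists X; split=> // a' m' [[_ <-]//|]; apply: HX.
have [smm m1 _] := mm; have [M [Q [i [q [[_ eq sq] iM]]]]] := sub_quot smm.
exists (Q * X)%type; split.
  by apply: fin_len_prod fX; apply: fin_len_surj sq finK.
move=> a' m' [[_ <-] _|si mm'].
  exists (q (1 : K^o), 0); split=> [/(congr1 fst)/= E|c mc].
    by apply: m1; apply/iM; apply/eq.
  congr (_, _); last exact: scaler0.
  have -> : c *: q (1 : K^o) = q (c : K^o) by rewrite -linearZ; congr (q _); apply: mulr1.
  by apply/eq; apply/iM.
have [z [nz kz]] := HX _ _ si mm'; exists (0, z); split=> [/(congr1 snd)//|c mc].
by congr (_, _); [apply: scaler0 | apply: kz].
Qed.

(** An injective hull of a sum of simple modules is found as an essential extension of largest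
    length; such lengths are bounded by [comp_series_bound]. *)
Lemma injective_cogenerator : exists E : lmodType K,
  [/\ fin_len E, forall X, fin_gen X -> E1 X E &
      forall X (x : X), fin_gen X -> x <> 0 -> exists f : {linear X -> E}, f x <> 0].
Proof.
have [n0 Hn0] := finK; have [s cs] := comp_series_exists (@submod_full K K^o) Hn0.
have [X0 [[l lX0] HX0]] := simple_sum s.
pose P m := `[< exists X (j : {linear X0 -> X}), essential j /\ forall i, (i < m)%N -> ~ len i X >].
have bound X (j : {linear X0 -> X}) : essential j -> len (size s * l) X.
  move=> ej; have [|b [Hb Lb]] := @comp_series_bound s _ 0 l X0 X j cs ej lX0.
    by move=> x /(_ 1 I); rewrite scale1r.
  exact: lenle_le Hb Lb.
have P0 : exists m, P m.
  exists 0%N; apply/asboolP; exists X0, (idl X0); split=> //; split=> // y ny.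
  by exists 1, y; rewrite scale1r.
have PB m : P m -> (m <= size s * l)%N.
  move=> /asboolP [X [j [ej H]]]; rewrite leqNgt; apply/negP => sm.
  exact: (H _ sm (bound X j ej)).
case: (ex_maxnP P0 PB) => m /asboolP [E [j [ej HE]]] Hm.
have small X (i : {linear X0 -> X}) : essential i -> len m X.
  move=> ei; apply: contrapT => nl; suff /Hm : P m.+1 by rewrite ltnn.
  apply/asboolP; exists X, i; split=> // k km Hk; apply: nl; apply: lenle_le Hk.
  by rewrite -ltnS.
have onto X (i : {linear E -> X}) : injective i -> essential (compl i j) -> surj i.
  move=> ii ei y; apply: contrapT => ny; have := small X _ ei; rewrite /len.
  case: m Hm small HE => [|m] Hm small HE.
    by move=> H; apply: ny; exists 0; rewrite linear0 (H y).
  move=> H; apply: (HE m) => //.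
  have : lenle m (fun y => exists x, i x = y).
    by apply: H => //; [exact: im_submod | exists y].
  move=> H'; apply: (@lenle_add K E X i 0 m) => //.
    by move=> x [_]; rewrite -(linear0 i) => /ii.
  by apply: lenle_sub H' => z [x [_ <-]]; exists x.
have fE : fin_len E by exists (size s * l)%N; apply: (bound E j).
have ext N L (f : {linear N -> L}) (h : {linear N -> E}) : fin_len L -> injective f ->
    exists h' : {linear L -> E}, forall x, h' (f x) = h x.
  move=> fL jf.
  (* [W] contains the relations identifying [h x] with [f x] and meets [E] trivially. For maximal
     [W] the map from [E] to the quotient of [E * L] by [W] is essential, hence onto, and its
     inverse restricted to [L] extends [h]. *)
  pose Q (W : E * L -> Prop) := submod W /\ ((forall x, W (h x, - f x)) /\ forall e, W (e, 0) -> e = 0).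
  have Q0 : Q (fun w => exists x, w = (h x, - f x)).
    split; last first.
      split=> [x|e [x [-> /eqP]]]; first by exists x.
      by rewrite eq_sym oppr_eq0 -(linear0 f) => /eqP/jf ->; rewrite linear0.
    split=> [|a _ _ [x ->] [y ->]]; first by exists 0; rewrite !linear0.
    by exists (a *: x + y); congr (_, _); rewrite /= !linearP.
  have [W [[smW [Wf WE]] maxW]] := fin_len_max (fin_len_prod fE fL) Q0 (fun W H => H.1).
  have [W' [V [i [q [[_ eq sq] iW]]]]] := sub_quot smW.
  have qW w : q w = 0 <-> W w by apply: iff_trans (eq w) (iff_sym (iW w)).
  pose u := compl q (inll E L).
  have ju : injective u by apply: inj0 => e /= /qW /WE.
  have ess : essential (compl u j).
    have [jj ej'] := ej; split=> [x y /ju/jj //|v nv].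
    have [w Ew] := sq v.
    have [[k [e [ne Ee]]]|H] := pselect (exists (k : K) e, e <> 0 /\ u e = k *: v).
      have [k' [x [nx Ex]]] := ej' _ ne; exists (k' * k), x.
      have uE : u (k' *: e) = k' *: u e by rewrite linearZ.
      rewrite -scalerA -Ee -uE -[compl u j x]/(u (j x)) Ex; split=> // E0.
      by apply: nx; apply: ju; rewrite E0 linear0.
    case: nv; rewrite -Ew; apply/qW.
    apply: (maxW (fun z => exists (k : K) y, W y /\ z = k *: w + y)).
    - split; [|split].
      + split=> [|a _ _ [k [y [Wy ->]]] [k' [y' [Wy' ->]]]].
          by exists 0, 0; rewrite scale0r addr0; case: smW.
        exists (a * k + k'), (a *: y + y'); split; first by case: smW => _; apply.
        by rewrite scalerDl scalerDr scalerA addrACA.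
      + by move=> x; exists 0, (h x, - f x); rewrite scale0r add0r.
      + move=> e [k [y [Wy E']]]; apply: contrapT => ne; apply: H; exists k, e; split=> //.
        by rewrite /u /= E' linearD (proj2 (qW y) Wy) addr0 linearZ Ew.
    - by move=> y Wy; exists 0, y; rewrite scale0r add0r.
    by exists 1, 0; rewrite scale1r addr0; split=> //; case: smW.
  have su := onto _ u ju ess.
  have [r [ur ru]] := bij_inv ju su.
  exists (compl r (compl q (inrl E L))) => x; apply: ju; apply: etrans (ru _) _.
  apply/subr0_eq; rewrite -[_ - _]/(q (0, f x) - q (h x, 0)) -linearB; apply/qW.
  have -> : (0, f x) - (h x, 0) = - (h x, - f x) :> E * L by congr (_, _) => /=; rewrite ?sub0r ?subr0 ?opprK.
  by apply: (@submodN _ _ (SubmodT smW)); apply: Wf.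
exists E; split=> // [X gX|X x gX nx].
  have [n [p sp]] := proj1 (fin_gen_free X) gX; have [L [k kp]] := ker_ses sp.
  apply: (E1_one kp (@proj_free K n)) => h; apply: ext; first exact: fin_len_pow.
  by case: kp.
(* A multiple [z] of [x] spans a simple module, which embeds in [E] through [X0]; the embedding
   extends to [X]. *)
have [|a [m' [z [si mm Ez nz kz]]]] := @comp_series_kill s _ X x cs.
  by exists 1; rewrite scale1r.
have [y [ny ky]] := HX0 _ _ si mm; have [smm m1 mi] := mm.
have lz : linear (fun c : K^o => c *: z) by move=> b c d; rewrite scalerDl scalerA.
have [M [Q [i [q [[ji ei sq] iM]]]]] := sub_quot smm.
have qm c : q c = 0 <-> m' c by apply: iff_trans (ei c) (iff_sym (iM c)).
have [|f Hf] := surj_desc (h := lin_of lz) sq; first by move=> c /qm; apply: kz.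
have ly : linear (fun c : K^o => c *: y) by move=> b c d; rewrite scalerDl scalerA.
have [|g Hg] := surj_desc (h := lin_of ly) sq; first by move=> c /qm; apply: ky.
have jf : injective f.
  apply: inj0 => c; have [d <-] := sq c; rewrite Hf /= => dz; apply/qm.
  apply: contrapT => nd; have [b Hb] := mi d nd; apply: nz.
  by have := kz _ Hb; rewrite scalerBl scale1r -scalerA dz scaler0 subr0.
have [h Hh] := ext Q X f (compl j g) (fin_len_of_gen finK gX) jf.
exists h => hx; apply: ny; have [jj _] := ej; apply: jj; rewrite linear0.
have -> : y = g (q 1) by rewrite Hg /= scale1r.
have := Hh (q 1); rewrite Hf /= scale1r => <-.
by rewrite Ez linearZ hx /= scaler0.
Qed.

End InjectiveCogenerator.

(** * Corner rings and coinduction *)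

Section HomModule.
Variable A : nzRingType.
Implicit Types X Y Z : lmodType A.

Lemma lin_ext X Y (f g : {linear X -> Y}) : f =1 g -> f = g.
Proof.
case: f => f [[fa] [fb]]; case: g => g [[ga] [gb]] /= /funext fg.
by subst g; congr (GRing.Linear.Pack (GRing.Linear.Class _ _)); congr (_ _); apply: Prop_irrelevance.
Qed.

Definition homT X Y : Type := {linear X -> Y}.
Section Instances.
Variables X Y : lmodType A.
HB.instance Definition _ := gen_eqMixin (homT X Y).
HB.instance Definition _ := gen_choiceMixin (homT X Y).
Fact hom_addA : associative (@addl A X Y).
Proof. by move=> f g h; apply: lin_ext => x; apply: addrA. Qed.
Fact hom_addC : commutative (@addl A X Y).
Proof. by move=> f g; apply: lin_ext => x; apply: addrC. Qed.
Fact hom_add0 : left_id (zerol X Y) (@addl A X Y).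
Proof. by move=> f; apply: lin_ext => x; apply: add0r. Qed.
Fact hom_addN : left_inverse (zerol X Y) (@oppl A X Y) (@addl A X Y).
Proof. by move=> f; apply: lin_ext => x; apply: addNr. Qed.
HB.instance Definition _ := GRing.isZmodule.Build (homT X Y) hom_addA hom_addC hom_add0 hom_addN.
End Instances.
End HomModule.

(** Not unital: the image of 1 is the idempotent that defines the corner. *)
Record nuhom (A R : nzRingType) := Nuhom {
  nu :> A -> R;
  nuD : forall a b, nu (a + b) = nu a + nu b;
  nuM : forall a b, nu (a * b) = nu a * nu b }.

Section Corner.
Variables (A R : nzRingType) (io : nuhom A R).
Implicit Types X Y Z W L M : lmodType R.

Definition corner_mod (io : nuhom A R) X : Type := {x : X | io 1 *: x == x}.
Section Instances.
Variable X : lmodType R.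
Local Notation cor := (corner_mod io X).
HB.instance Definition _ := SubChoice.on cor.
Lemma corP (x : cor) : io 1 *: val x = val x. Proof. exact/eqP/(valP x). Qed.
Definition to_cor (x : X) (Hx : io 1 *: x = x) : cor := exist _ x (introT eqP Hx).
Lemma cor_addP (x y : cor) : io 1 *: (val x + val y) = val x + val y.
Proof. by rewrite scalerDr !corP. Qed.
Lemma cor_oppP (x : cor) : io 1 *: (- val x) = - val x.
Proof. by rewrite scalerN !corP. Qed.
Lemma cor_scaleP (a : A) (x : X) : io 1 *: (io a *: x) = io a *: x.
Proof. by rewrite scalerA -nuM mul1r. Qed.
Definition cor_add x y := to_cor (cor_addP x y).
Definition cor_opp x := to_cor (cor_oppP x).
Definition cor_zero := to_cor (scaler0 X (io 1)).
Definition cor_scale a (x : cor) := to_cor (cor_scaleP a (val x)).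
Fact cor_addA : associative cor_add.
Proof. by move=> x y z; apply/val_inj/addrA. Qed.
Fact cor_addC : commutative cor_add.
Proof. by move=> x y; apply/val_inj/addrC. Qed.
Fact cor_add0 : left_id cor_zero cor_add.
Proof. by move=> x; apply/val_inj/add0r. Qed.
Fact cor_addN : left_inverse cor_zero cor_opp cor_add.
Proof. by move=> x; apply/val_inj/addNr. Qed.
HB.instance Definition _ := GRing.isZmodule.Build cor cor_addA cor_addC cor_add0 cor_addN.
Fact cor_scaleA a b (x : cor) : cor_scale a (cor_scale b x) = cor_scale (a * b) x.
Proof. by apply/val_inj; rewrite /= nuM scalerA. Qed.
Fact cor_scale1 : left_id 1 cor_scale.
Proof. by move=> x; apply/val_inj/corP. Qed.
Fact cor_scaleDr : right_distributive cor_scale +%R.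
Proof. by move=> a x y; apply/val_inj/scalerDr. Qed.
Fact cor_scaleDl x : {morph cor_scale^~ x : a b / a + b}.
Proof. by move=> a b; apply/val_inj; rewrite /= nuD scalerDl. Qed.
HB.instance Definition _ := GRing.Zmodule_isLmodule.Build A cor
  cor_scaleA cor_scale1 cor_scaleDr cor_scaleDl.
End Instances.

Local Notation cor X := (corner_mod io X : lmodType A).

Lemma cor_mapP X Y (f : {linear X -> Y}) (x : cor X) : io 1 *: f (val x) = f (val x).
Proof. by rewrite -linearZ /= corP. Qed.
Fact corl_linear X Y (f : {linear X -> Y}) : linear (fun x : cor X => to_cor (cor_mapP f x)).
Proof. by move=> a x y; apply/val_inj; rewrite /= linearP. Qed.
Definition corl X Y f : {linear cor X -> cor Y} := lin_of (@corl_linear X Y f).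

Lemma ses_cor X Y Z (f : {linear X -> Y}) (g : {linear Y -> Z}) :
  ses f g -> ses (corl f) (corl g).
Proof.
move=> [injf ex sg]; split.
- by move=> x y E; apply: val_inj; apply: injf; apply: (congr1 val E).
- move=> y; split=> [/(congr1 val)/= /ex [x Ex]|[x <-]].
    have Hx : io 1 *: x = x by apply: injf; rewrite linearZ Ex; apply: corP.
    by exists (to_cor Hx); apply: val_inj.
  by apply/val_inj/ex; exists (val x).
move=> z; have [y Ey] := sg (val z).
have Hy : io 1 *: (io 1 *: y) = io 1 *: y by apply: cor_scaleP.
by exists (to_cor Hy); apply: val_inj; rewrite /= linearZ Ey; apply: corP.
Qed.

Lemma cor_summand X Y : direct_summand X Y -> direct_summand (cor X) (cor Y).
Proof. by move=> [i [p ip]]; exists (corl i), (corl p) => x; apply/val_inj/ip. Qed.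

Lemma cor_pow n X : lmod_iso (cor {ffun 'I_n -> X}) {ffun 'I_n -> cor X}.
Proof.
have H (x : {ffun 'I_n -> cor X}) : io 1 *: [ffun i => val (x i)] = [ffun i => val (x i)] :> {ffun 'I_n -> X}.
  by apply/ffunP => i; rewrite !ffunE corP.
have lf : linear (fun x : {ffun 'I_n -> cor X} => to_cor (H x)).
  by move=> a x y; apply/val_inj/ffunP => i; rewrite /= !ffunE.
exists (powtupl (fun i => corl (powpl X i))), (lin_of lf); split=> x.
  by apply/val_inj/ffunP => i; rewrite !ffunE.
by apply/ffunP => i; apply/val_inj; rewrite !ffunE /= ffunE.
Qed.

Definition eR : lmodType A := cor (R^o).
Definition eR1 : eR := @to_cor R^o (io 1) (esym (etrans (congr1 io (esym (mulr1 1))) (nuM io 1 1))).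

Lemma eR_mulP (x : eR) (r : R) : io 1 *: (val x * r : R^o) = val x * r.
Proof. by rewrite -[LHS]/(io 1 * (val x * r)) mulrA; congr (_ * _); apply: (corP x). Qed.
Definition eR_mul (x : eR) (r : R) : eR := to_cor (eR_mulP x r).
Lemma eR_mul_linear r : linear (fun x => eR_mul x r).
Proof. by move=> a x y; apply/val_inj; rewrite /= mulrDl -[io a *: _]/(io a * _) -mulrA. Qed.
Definition eR_mull r : {linear eR -> eR} := lin_of (eR_mul_linear r).

(* The right adjoint Hom_A(eR, -) of X |-> eX. *)
Definition coind_mod (Z : lmodType A) : Type := homT eR Z.
Section CoindInstances.
Variable Z : lmodType A.
Local Notation G := (coind_mod Z).
HB.instance Definition _ := GRing.Zmodule.copy G (homT eR Z).
Definition unG (h : G) : {linear eR -> Z} := h.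
Definition G_scale (r : R) (h : G) : G := compl (unG h) (eR_mull r).
Fact G_scaleA a b (x : G) : G_scale a (G_scale b x) = G_scale (a * b) x.
Proof. by apply: lin_ext => y /=; congr (unG x _); apply/val_inj/esym/mulrA. Qed.
Fact G_scale1 : left_id 1 G_scale.
Proof. by move=> x; apply: lin_ext => y /=; congr (unG x _); apply/val_inj/mulr1. Qed.
Fact G_scaleDr : right_distributive G_scale +%R.
Proof. by move=> a x y; apply: lin_ext. Qed.
Fact G_scaleDl x : {morph G_scale^~ x : a b / a + b}.
Proof.
move=> a b; apply: lin_ext => y; rewrite /= -[RHS]linearD; congr (unG x _).
exact/val_inj/mulrDr.
Qed.
HB.instance Definition _ := GRing.Zmodule_isLmodule.Build R G
  G_scaleA G_scale1 G_scaleDr G_scaleDl.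
End CoindInstances.

Local Notation G Z := (coind_mod Z : lmodType R).
Implicit Types V U T : lmodType A.

Lemma G_scaleE V r (h : G V) y : unG (r *: h) y = unG h (eR_mul y r).
Proof. by []. Qed.

Lemma actP X (y : eR) (x : X) : io 1 *: (val y *: x) = val y *: x.
Proof. by rewrite scalerA; congr (_ *: _); apply: (corP y). Qed.
Definition act X (y : eR) (x : X) : cor X := to_cor (actP y x).

Lemma act_lineary X (x : X) : linear (fun y => act y x).
Proof. by move=> a y z; apply/val_inj; rewrite /= scalerDl scalerA. Qed.
Definition actl X x : {linear eR -> cor X} := lin_of (@act_lineary X x).

Lemma adj_linear X V (f : {linear cor X -> V}) : linear (fun x => compl f (actl x) : G V).
Proof.
move=> r x x'; apply: lin_ext => y; rewrite /= -[RHS]linearD; congr (f _).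
by apply/val_inj; rewrite /= scalerDr scalerA.
Qed.

Definition adj X V f : {linear X -> G V} := lin_of (@adj_linear X V f).
Lemma adjE X V (f : {linear cor X -> V}) x y : unG (adj f x) y = f (act y x).
Proof. by []. Qed.

Lemma coadj_linear X V (g : {linear X -> G V}) : linear (fun x : cor X => unG (g (val x)) eR1).
Proof.
move=> a x y; rewrite -linearZ /= linearD linearZ.
rewrite -[LHS]/(unG (io a *: g (val x)) eR1 + unG (g (val y)) eR1) G_scaleE.
congr (unG _ _ + _); apply/val_inj => /=.
by rewrite -[RHS]/(io a * io 1) -[LHS]/((io 1 : R) * (io a : R)) -!nuM mulr1 mul1r.
Qed.

Definition coadj X V g : {linear cor X -> V} := lin_of (@coadj_linear X V g).

Lemma adjK X V (f : {linear cor X -> V}) x : coadj (adj f) x = f x.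
Proof. by rewrite /=; congr (f _); apply/val_inj/corP. Qed.

Lemma coadjK X V (g : {linear X -> G V}) x y : unG (adj (coadj g) x) y = unG (g x) y.
Proof.
rewrite adjE /= linearZ G_scaleE; congr (unG _ _).
by apply/val_inj; apply: corP.
Qed.

Lemma G_eq V (h h' : G V) : (forall y, unG h y = unG h' y) -> h = h'.
Proof. exact: lin_ext. Qed.

Lemma adj_nat X Y V (k : {linear X -> Y}) (f : {linear cor Y -> V}) x :
  adj f (k x) = adj (compl f (corl k)) x.
Proof.
by apply: G_eq => y; rewrite !adjE /=; congr (f _); apply: val_inj; rewrite /= linearZ.
Qed.

Lemma coadj_inj X V (g h : {linear X -> G V}) : (forall x, coadj g x = coadj h x) -> g =1 h.
Proof.
move=> E x; apply: G_eq => y; rewrite -(coadjK g) -(coadjK h); congr (unG _ y); congr (adj _ x).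
exact: lin_ext.
Qed.

(** By adjunction, a map into [G V] extends as soon as its transpose extends over the corner, and
    taking corners is exact. *)
Lemma E1_coind X V : E1 (cor X) V -> E1 X (G V).
Proof.
move=> E K L f g fg h; have [h' Hh] := E _ _ _ _ (ses_cor fg) (coadj h).
exists (adj h') => k; rewrite adj_nat; apply: G_eq => y; rewrite -[RHS]coadjK.
by congr (unG (adj _ _) _); apply: lin_ext => x; apply: Hh.
Qed.

Lemma Gl_linear U V (f : {linear U -> V}) : linear (fun h : G U => compl f (unG h) : G V).
Proof. by move=> r x x'; apply: lin_ext => y; rewrite /= linearD. Qed.
Definition Gl U V f : {linear G U -> G V} := lin_of (@Gl_linear U V f).
Lemma GlE U V (f : {linear U -> V}) h y : unG (Gl f h) y = f (unG h y). Proof. by []. Qed.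

Lemma Gl_inj U V (f : {linear U -> V}) : injective f -> injective (Gl f).
Proof.
by move=> jf x y E; apply: G_eq => z; apply: jf; rewrite -!GlE E.
Qed.

Lemma Gl_exact U V T (f : {linear U -> V}) (g : {linear V -> T}) : ses f g -> exact_at (Gl f) (Gl g).
Proof.
move=> fg h; split=> [E|[x <-]]; last first.
  by apply: G_eq => y; rewrite !GlE (ses_comp fg).
have [|u Hu] := ses_lift (h := unG h) fg.
  by move=> y; rewrite -GlE E.
by exists (u : G U); apply: G_eq => y; rewrite GlE -Hu.
Qed.

Lemma Gl_surj U V T (f : {linear U -> V}) (g : {linear V -> T}) :
  ses f g -> E1 eR U -> surj (Gl g).
Proof.
move=> fg E h; have [u Hu] := E1_lift (unG h) fg E.
by exists (u : G V); apply: G_eq => y; rewrite GlE -Hu.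
Qed.

Lemma G_summand U V : direct_summand U V -> direct_summand (G U) (G V).
Proof.
move=> [i [p ip]]; exists (Gl i), (Gl p) => h; apply: G_eq => y.
by rewrite !GlE ip.
Qed.

Definition full_corner := injective io /\ forall r, exists a, io 1 * r * io 1 = io a.

Lemma io1 : io 1 * io 1 = io 1. Proof. by rewrite -nuM mul1r. Qed.

Hypothesis fc : full_corner.

Definition counit V : {linear cor (G V) -> V} := coadj (idl (G V)).
Lemma counitE V (h : cor (G V)) : counit V h = unG (val h) eR1. Proof. by []. Qed.

Lemma io_inv (y : eR) : exists a, val y * io 1 = io a.
Proof.
have [_ H] := fc; have [a Ha] := H (val y); exists a; rewrite -Ha.
by congr (_ * _); apply/esym/(corP y).
Qed.

(** An element h of e(GV) satisfies h(y) = h(ye), and ye lies in eRe = A; so h is determined by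
    h(e). *)
Lemma counit_inj V : injective (counit V).
Proof.
apply: inj0 => h; rewrite counitE => h0; apply/val_inj/G_eq => y.
rewrite -(corP h) G_scaleE; have [a Ha] := io_inv y.
have -> : eR_mul y (io 1) = a *: eR1.
  by apply/val_inj; rewrite /= Ha -[_ *: _]/(io a * io 1) -nuM mulr1.
by rewrite linearZZ h0 scaler0.
Qed.

Lemma counit_surj V : surj (counit V).
Proof.
move=> v; have [inv Hinv] := choice io_inv; have [inj_io _] := fc.
have ioN a : io (- a) = - io a.
  apply/eqP; rewrite eq_sym -subr_eq0 -opprD oppr_eq0 -nuD subrr.
  by rewrite -(inj_eq (addIr (io 0))) -nuD !add0r.
(* The preimage of [v] is y |-> (ye) v, with ye read in [A] through [inv]. *)
have lu : linear (fun y : eR => inv y *: v).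
  move=> a x y; rewrite scalerA -scalerDl; congr (_ *: _); apply: inj_io.
  rewrite -Hinv nuD nuM -!Hinv /= mulrDl; congr (_ + _).
  by rewrite -[_ *: _]/(io a * _) mulrA.
pose h : G V := lin_of lu.
have Hh : io 1 *: h = h.
  apply: G_eq => y; rewrite G_scaleE /=; congr (_ *: _); apply: inj_io.
  by rewrite -!Hinv /= -mulrA io1.
exists (to_cor Hh); rewrite counitE /=.
suff -> : inv eR1 = 1 by rewrite scale1r.
by apply: inj_io; rewrite -Hinv /= io1.
Qed.

Lemma cor_coind V : lmod_iso (cor (G V)) V.
Proof. exact: iso_of_bij (@counit_inj V) (@counit_surj V). Qed.

Definition unit_map X : {linear X -> G (cor X)} := adj (idl (cor X)).

Lemma corl_unit X (x : cor X) : counit (cor X) (corl (unit_map X) x) = x.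
Proof. by rewrite counitE /=; apply/val_inj/corP. Qed.

Lemma corl_unit_inj X : injective (corl (unit_map X)).
Proof. exact: can_inj (@corl_unit X). Qed.
Lemma corl_unit_surj X : surj (corl (unit_map X)).
Proof. by move=> h; exists (counit _ h); apply/counit_inj/corl_unit. Qed.

(* eR = eRe + eR(1-e) *)
Lemma eR_summand : direct_summand A^o eR.
Proof.
have [inv Hinv] := choice io_inv; have [inj_io _] := fc.
have H a : io 1 *: (io a : R^o) = io a by rewrite -[_ *: _]/(io 1 * io a) -nuM mul1r.
have li : linear (fun a : A^o => @to_cor R^o (io a) (H a) : eR).
  by move=> a x y; apply/val_inj; rewrite /= nuD nuM.
have lp : linear (inv : eR -> A^o).
  move=> a x y; apply: inj_io; rewrite -Hinv nuD nuM -!Hinv /= mulrDl; congr (_ + _).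
  by rewrite -[_ *: _]/(io a * _) mulrA.
exists (lin_of li), (lin_of lp) => a; apply: inj_io; rewrite /= -Hinv.
by rewrite -[LHS]/(io a * io 1) -nuM mulr1.
Qed.

End Corner.

Definition central (K : comNzRingType) (R : nzRingType) (th : {rmorphism K -> R}) :=
  forall k x, th k * x = x * th k.

Section CornerLength.
Variables (K : comNzRingType) (A R : nzRingType) (thA : {rmorphism K -> A}) (thR : {rmorphism K -> R}).
Variable io : nuhom A R.
Hypothesis cR : central thR.
Hypothesis io_th : forall k, io (thA k) = io 1 * thR k.

Lemma fl_cor (X : lmodType R) : fl thR X -> fl thA (corner_mod io X).
Proof.
have lv : linear (fun x : res_mod thA (corner_mod io X) => val x : res_mod thR X).
  move=> k x y; rewrite -[LHS]/(io (thA k) *: val x + val y); congr (_ + _).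
  by rewrite io_th -cR -scalerA corP.
by apply: (@fin_len_inj _ _ _ (lin_of lv)); apply: val_inj.
Qed.

Hypotheses (Afin : fl thA A^o) (Rfin : fl thR R^o).

Lemma fl_eR : fl thA (eR io).
Proof. exact: fl_cor. Qed.

(** Evaluation at generators of eR over [A] embeds Hom_A(eR, Z) in a power of [Z], linearly over [K]
    because [K] is central. *)
Lemma fl_coind (Z : lmodType A) : fl thA Z -> fl thR (coind_mod io Z).
Proof.
move=> fZ; have [n [g Hg]] := proj1 (fl_gen Afin _) fl_eR.
have lv : linear (fun h : res_mod thR (coind_mod io Z) =>
    [ffun i => unG h (g i)] : res_mod thA {ffun 'I_n -> Z}).
  have E (u v : {ffun 'I_n -> Z}) (a : A) i : (a *: u + v) i = a *: u i + v i by rewrite !ffunE.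
  move=> k x y; apply/ffunP => i; rewrite ffunE; apply/esym; apply: etrans (E _ _ (thA k) i) _.
  rewrite !ffunE -[RHS]/(unG x (eR_mul (g i) (thR k)) + unG y (g i)); congr (_ + _).
  rewrite -linearZZ; congr (unG x _); apply/val_inj; rewrite /= -cR.
  by rewrite -[LHS]/(io (thA k) * _) io_th -cR -mulrA; congr (_ * _); apply: (corP (g i)).
apply: (@fin_len_inj _ _ _ (lin_of lv)); last exact: (@fl_pow _ _ thA n Z).
apply: inj0 => h /ffunP h0; apply: G_eq => y; have [c ->] := Hg y.
rewrite linear_sum big1 // => i _.
have := h0 i; rewrite ffunE [RHS]ffunE => h0i.
by rewrite linearZZ h0i scaler0.
Qed.
End CornerLength.

(** * Special approximations *)

Section InjectiveModules.
Variables (K : comNzRingType) (R : nzRingType) (th : {rmorphism K -> R}).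
Hypotheses (finK : fin_len K^o) (cR : central th) (Rfin : fl th R^o).
Implicit Types X Y Z M I C W : lmodType R.

(** Here the idempotent is 1: [corner_mod] becomes restriction to [K] and [coind_mod] becomes
    Hom_K(R, -), so the same adjunction coinduces injectives from [K]. *)
Definition th_nu : nuhom K R := Nuhom (rmorphD th) (rmorphM th).

Lemma fl_id (X : lmodType K) : fin_len X -> fl (idfun : {rmorphism K -> K}) X.
Proof.
have li : linear (fun x : res_mod (idfun : {rmorphism K -> K}) X => x : X) by [].
exact: (@fin_len_inj _ _ _ (lin_of li)).
Qed.

Lemma fl_of_id (X : lmodType K) : fl (idfun : {rmorphism K -> K}) X -> fin_len X.
Proof.
have li : linear (fun x : X => x : res_mod (idfun : {rmorphism K -> K}) X) by [].
exact: (@fin_len_inj _ _ _ (lin_of li)).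
Qed.

(** Among the kernels of maps from [X] to powers of [Y] there is a minimal one, and it must be 0. *)
Lemma finite_cogen X Y : fin_len X -> (forall x : X, x <> 0 -> exists f : {linear X -> Y}, f x <> 0) ->
  exists n (f : {linear X -> {ffun 'I_n -> Y}}), injective f.
Proof.
move=> fX cog; pose Q S := exists n (f : {linear X -> {ffun 'I_n -> Y}}), forall x, S x <-> f x = 0.
have Q0 : Q (fun _ => True).
  by exists 0%N, (zerol _ _) => x; split=> // _.
have [|S [[n [f Sf]] minS]] := fin_len_min fX Q0.
  move=> S [n [f Sf]]; have [H0 HD] := ker_submod f.
  by split=> [|a x y /Sf ? /Sf ?]; apply/Sf => //; apply: HD.
exists n, f; apply: inj0 => x fx; apply: contrapT => nx.
have [g gx] := cog x nx.
have [h [h' [hK _]]] := pow_add_iso n 1 Y.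
pose f' := compl h (pairl f (compl (powil Y ord0) g)).
apply: gx; suff /(_ x) : forall y, S y -> f' y = 0.
  move=> /(_ (proj2 (Sf x) fx)) /(congr1 h'); rewrite linear0 hK => /(congr1 snd) /= /ffunP /(_ ord0).
  by rewrite !ffunE.
apply: minS; first by exists (n + 1)%N, f'.
by move=> y /(congr1 h'); rewrite linear0 hK => /(congr1 fst) /= /Sf.
Qed.

Lemma inj_cogen : exists I, [/\ fl th I, forall X, fl th X -> E1 X I &
  forall X, fl th X -> exists n (f : {linear X -> {ffun 'I_n -> I}}), injective f].
Proof.
have [E [fE iE cE]] := injective_cogenerator finK.
have ioth k : th_nu ((idfun : {rmorphism K -> K}) k) = th_nu 1 * th k by rewrite /= rmorph1 mul1r.
have fcor X : fl th X -> fin_gen (corner_mod th_nu X).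
  by move=> fX; apply/fin_gen_of_len/fl_of_id/(fl_cor cR ioth).
exists (coind_mod th_nu E); split.
- apply: (fl_coind cR ioth) => //; exact: fl_id.
- by move=> X fX; apply/E1_coind/iE/fcor.
move=> X fX; apply: finite_cogen; first exact: fl_fin_len fX.
move=> x nx; have Hx : th_nu 1 *: x = x by rewrite /= rmorph1 scale1r.
have [|f fx] := cE _ (to_cor Hx) (fcor X fX).
  by move=> /(congr1 val).
exists (adj f) => /(congr1 (fun h => unG h (eR1 th_nu))); rewrite adjE.
by have -> : act (eR1 th_nu) x = to_cor Hx by apply/val_inj.
Qed.

(** Evaluation at generators of [X] identifies Hom_R(X, Y) with a [K]-submodule of a power of [Y],
    which has finite length. *)
Lemma hom_fg X Y : fl th X -> fl th Y -> exists k (f : 'I_k -> {linear X -> Y}),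
  forall g : {linear X -> Y}, exists c : 'I_k -> K, forall x, g x = \sum_j th (c j) *: f j x.
Proof.
move=> fX fY; have [n [t Ht]] := proj1 (fl_gen Rfin X) fX.
pose S (y : res_mod th {ffun 'I_n -> Y}) := exists f : {linear X -> Y}, forall i, f (t i) = (y : {ffun 'I_n -> Y}) i.
have smS : submod S.
  split=> [|a y y' [f Hf] [f' Hf']]; first by exists (zerol _ _) => i; rewrite /= ffunE.
  have lf : linear (fun x => th a *: f x).
    by move=> r x x'; rewrite linearP scalerDr !scalerA cR.
  exists (addl (lin_of lf) f') => i /=; rewrite Hf Hf'.
  by rewrite -[RHS]/((th a *: (y : {ffun 'I_n -> Y}) + y') i) !ffunE.
have [N [Q [i [q [[ji _ _] iN]]]]] := sub_quot smS.
have [k [g Hg]] : fin_gen N.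
  by apply: fin_gen_of_len; apply: fin_len_inj ji (fl_pow n fY).
have /choice [f Hf] j : exists f : {linear X -> Y}, forall l, f (t l) = (i (g j) : {ffun 'I_n -> Y}) l.
  by apply/iN; exists (g j).
exists k, f => h.
have /iN [z Ez] : S [ffun l => h (t l)] by exists h => l; rewrite ffunE.
have [c Ec] := Hg z; exists c => x; have [r ->] := Ht x.
rewrite linear_sum.
under [RHS]eq_bigr => j _ do rewrite linear_sum scaler_sumr.
rewrite exchange_big; apply: eq_bigr => l _; rewrite linearZZ.
have -> : h (t l) = (i z : {ffun 'I_n -> Y}) l by rewrite Ez ffunE.
rewrite Ec linear_sum sum_ffunE scaler_sumr; apply: eq_bigr => j _.
rewrite linearZZ -[(c j *: i (g j)) l]/((th (c j) *: (i (g j) : {ffun 'I_n -> Y})) l) ffunE -Hf linearZZ.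
by rewrite !scalerA cR.
Qed.

(** The obstruction to extending a map into [Y'] is a map [X -> Y]; it lifts to [C] and can be
    subtracted. *)
Lemma E1_kernel X Y' C Y (f : {linear Y' -> C}) (g : {linear C -> Y}) :
  ses f g -> E1 X C -> (forall v : {linear X -> Y}, exists w : {linear X -> C}, forall x, g (w x) = v x) ->
  E1 X Y'.
Proof.
move=> fg E lift N L a b ab h.
have [u Hu] := E _ _ _ _ ab (compl f h).
have [|v Hv] := ses_desc (h := compl g u) ab.
  by move=> k /=; rewrite Hu /= (ses_comp fg).
have [w Hw] := lift v.
have [|t Ht] := ses_lift (h := addl u (oppl (compl w b))) fg.
  by move=> x /=; rewrite linearB Hw Hv subrr.
exists t => k; have [jf _ _] := fg; apply: jf.
by rewrite Ht /= Hu (ses_comp ab) linear0 subr0.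
Qed.

Section Approximation.
Variable T : lmodType R.
Hypothesis ST : STilt th T.
Local Notation Pf := (Pf th).
Local Notation perp := (perp th).

(** Generators of Hom(T, Y) over [K] give a map from a power of [T] through which every map from
    P^{<oo} factors: such a map first extends to a power of [T], since [Y] is Ext-injective. Free
    modules being in P^{<oo}, the map is onto, and [E1_kernel] applies. *)
Lemma perp_cover Y : fl th Y -> perp Y ->
  exists k Y' (f : {linear Y' -> {ffun 'I_k -> T}}) (g : {linear {ffun 'I_k -> T} -> Y}),
    ses f g /\ perp Y'.
Proof.
move=> fY pY; have [PT pT emb _] := ST.
have [k [a Ha]] := hom_fg PT.1 fY.
pose g := powsuml a.
have fac (h : {linear T -> Y}) : exists h' : {linear T -> {ffun 'I_k -> T}}, forall t, g (h' t) = h t.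
  have [c Hc] := Ha h.
  have lh : linear (fun t : T => [ffun j => th (c j) *: t] : {ffun 'I_k -> T}).
    by move=> r x y; apply/ffunP => j; rewrite !ffunE scalerDr !scalerA cR.
  exists (lin_of lh) => t; rewrite Hc /=; apply: eq_bigr => j _.
  by rewrite ffunE linearZ.
have facn n (h : {linear {ffun 'I_n -> T} -> Y}) :
    exists h' : {linear {ffun 'I_n -> T} -> {ffun 'I_k -> T}}, forall t, g (h' t) = h t.
  have /choice [h' Hh'] i := fac (compl h (powil T i)).
  exists (powsuml h') => t; rewrite [RHS]powsumE linear_sum; apply: eq_bigr => i _.
  by rewrite Hh'.
have lift X (v : {linear X -> Y}) : Pf X -> exists w : {linear X -> {ffun 'I_k -> T}}, forall x, g (w x) = v x.
  move=> PX; have [n [e je]] := emb X PX; have [Q [q eq]] := coker_ses je.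
  have [v' Hv'] := pY _ (Pf_right eq PX (Pf_pow n PT)) _ _ _ _ eq v.
  by have [w Hw] := facn n v'; exists (compl w e) => x; rewrite Hw Hv'.
have sg : surj g.
  have [m [p sp]] := proj1 (fin_gen_free Y) (proj1 (fl_gen Rfin Y) fY).
  have [w Hw] := lift _ p (Pf_free Rfin m).
  by move=> y; have [x <-] := sp y; exists (w x).
have [Y' [f fg]] := ker_ses sg; exists k, Y', f, g; split=> // X PX.
by apply: E1_kernel fg _ (fun v => lift X v PX); apply/E1_pow/pT.
Qed.

(* Auslander-Buchweitz approximation. *)
Lemma special_approx M : fl th M ->
  exists Y Z (f : {linear Y -> Z}) (g : {linear Z -> M}), [/\ ses f g, Pf Z & perp Y].
Proof.
move=> fM; have [PT _ _ [s bd]] := ST.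
have : E1n th s M by apply: E1n_bound.
elim: s {bd} M fM => [|d IH] M fM.
  move=> /(E1n0 Rfin) pM; have [k [Y [f [g [fg pY]]]]] := perp_cover fM pM.
  by exists Y, {ffun 'I_k -> T}, f, g; split=> //; apply: Pf_pow.
(* [M] is embedded in an injective with cokernel [M1], one Ext degree lower. The pullback [W] of an
   approximation of [M1] is Ext-injective, as an extension of the injective by [Y1], and contains
   [M] with cokernel [Z1]. *)
move=> HM; have [I [fI iI cI]] := inj_cogen.
have [n [e je]] := cI M fM; have [M1 [q eq]] := coker_ses je.
have pI : perp {ffun 'I_n -> I} by move=> X [fX _]; apply/E1_pow/iI.
have fM1 : fl th M1 by have [_ _ sq] := eq; apply: fl_surj sq (fl_pow n fI).
have [Y1 [Z1 [f1 [g1 [fg1 PZ1 pY1]]]]] := IH M1 fM1 (E1n_step Rfin eq pI HM).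
have [W [a [b PB]]] := pullback q g1.
have [j1 [ja _]] := pullback_ses PB fg1.
have [j2 [jb _]] := pullback_ses (pullback_sym PB) eq.
have pW : perp W := perp_mid Rfin ja pY1 pI.
have fW : fl th W := fl_ses jb fM PZ1.1.
have [k [Y2 [f2 [g2 [fg2 pY2]]]]] := perp_cover fW pW.
(* The preimage [Z] of [M] in a power of [T] covering [W] is the kernel of the map from that power
   onto [Z1], hence in P^{<oo}; its kernel over [M] is [Y2]. *)
have [Z [c [d' PB2]]] := pullback j2 g2.
have [j3 [jc _]] := pullback_ses PB2 fg2.
exists Y2, Z, j3, c; split=> //.
have H : ses d' (compl b g2).
  have [E ex inj] := PB2; have [jj2 ej2 sb] := jb; have [_ _ sg2] := fg2; split.
  - apply: inj0 => z dz; apply: inj => //; apply: jj2.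
    by rewrite E dz !linear0.
  - move=> t; split=> [/= /ej2 [m Em]|[z <-]].
      by have [z [_ <-]] := ex _ _ Em; exists z.
    by rewrite /= -E (ses_comp jb).
  by move=> z; have [w <-] := sb z; have [t <-] := sg2 w; exists t.
exact: Pf_left H (Pf_pow k PT) PZ1.
Qed.

End Approximation.
End InjectiveModules.

(** * Transfer along a corner *)

Section GoodCorner.
Variables (K : comNzRingType) (A R : nzRingType) (thA : {rmorphism K -> A}) (thR : {rmorphism K -> R}).
Variable io : nuhom A R.
Local Notation cor X := (corner_mod io X : lmodType A).
Local Notation G Z := (coind_mod io Z : lmodType R).
Implicit Types X Y W : lmodType R.
Implicit Types V U Z : lmodType A.

(* The modules killed by e have bounded projective dimension, and so has eR over A = eRe. *)
Definition good_corner := [/\ full_corner io, forall k, io (thA k) = io 1 * thR k,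
  exists n, pd n (eR io) &
  exists n, forall X, fl thR X -> zero_mod (cor X) -> pd n X].

Hypothesis good : good_corner.
Hypotheses (cR : central thR) (Afin : fl thA A^o) (Rfin : fl thR R^o).

Let fc : full_corner io. Proof. by case: good. Qed.
Let io_th : forall k, io (thA k) = io 1 * thR k. Proof. by case: good. Qed.
Let flc X : fl thR X -> fl thA (cor X). Proof. exact: fl_cor. Qed.
Let flG V : fl thA V -> fl thR (G V). Proof. exact: (fl_coind cR io_th Afin Rfin). Qed.

Lemma Pf_eR : Pf thA (eR io).
Proof. by split; [apply: flc | case: good]. Qed.

Lemma cor_free n : lmod_iso (cor (free_mod R n)) {ffun 'I_n -> eR io}.
Proof. exact: cor_pow. Qed.

Lemma Pf_cor X : Pf thR X -> Pf thA (cor X).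
Proof.
move=> [fX [n]]; elim: n X fX => [|n IH] X fX pX; have [m [L [k [p [kp fL]]]]] := fl_pres Rfin fX.
  have [s ps] := proj_split kp pX.
  apply: (@Pf_summand _ _ _ _ (cor (free_mod R m))); first by apply: cor_summand; exists s, p.
  exact: Pf_summand (iso_summand (cor_free m)) (Pf_pow m Pf_eR).
apply: Pf_right (ses_cor io kp) _ _; first exact: IH fL (pd_syz kp (@proj_free R m) pX).
exact: Pf_summand (iso_summand (cor_free m)) (Pf_pow m Pf_eR).
Qed.

(** Kernel and cokernel of [f] are killed by e, so their dimensions are at most [n]. Going from [X]
    to [Y] passes to the image of [f], which costs the extra 1. *)
Lemma iso_e X Y (f : {linear X -> Y}) n a : 
  (forall X, fl thR X -> zero_mod (cor X) -> pd n X) -> fl thR X -> fl thR Y ->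
  injective (corl io f) -> surj (corl io f) ->
  (pd a X -> pd (maxn a n).+1 Y) /\ (pd a Y -> pd (maxn a n) X).
Proof.
move=> Hn fX fY jf sf.
have [L [I [Q [k [p [i [q [kp iq ip]]]]]]]] := im_factor f.
have [jk _ sp] := kp; have [ji _ sq] := iq.
have pL : pd (maxn a n) L.
  apply: pd_le (leq_maxr _ _) _; apply: Hn; first exact: fl_inj jk fX.
  move=> x; have [jck _ _] := ses_cor io kp; apply: jck; apply: jf; apply/val_inj.
  by rewrite /= -ip (ses_comp kp) !linear0.
have pQ : pd (maxn a n) Q.
  apply: pd_le (leq_maxr _ _) _; apply: Hn; first exact: fl_surj sq fY.
  move=> x; have [_ _ scq] := ses_cor io iq; have [y <-] := scq x.
  have [z <-] := sf y; apply/val_inj; rewrite /= -ip; exact: ses_comp iq _.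
split=> pd_a.
  apply: pd_mid iq _ (pdS pQ); apply: pd_right kp pL _.
  exact: pd_le (leq_maxl _ _) pd_a.
apply: pd_mid kp pL _; apply: pd_left iq _ pQ.
exact: pd_le (leq_maxl _ _) pd_a.
Qed.

Lemma G_pow n V : lmod_iso (G {ffun 'I_n -> V}) {ffun 'I_n -> G V}.
Proof.
pose u : {linear G {ffun 'I_n -> V} -> {ffun 'I_n -> G V}} := powtupl (fun i => Gl io (powpl V i)).
apply: (@iso_of_bij _ _ _ u).
  apply: inj0 => h /ffunP E; apply: G_eq => y; apply/ffunP => i.
  have := E i; rewrite !ffunE => /(congr1 (fun h => unG h y)).
  rewrite GlE => /= E'; exact: E'.
move=> h; exists (powtupl (fun i => unG (h i)) : G _).
by apply/ffunP => i; rewrite ffunE; apply: G_eq => y; rewrite GlE /= ffunE.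
Qed.

Lemma corl_Gl U V (f : {linear U -> V}) (h : cor (G U)) :
  counit io V (corl io (Gl io f) h) = f (counit io U h).
Proof. by []. Qed.

(** [A] is a summand of eR, and G(eR) agrees with [R] up to modules killed by e; this starts the
    induction. Since [G] is only left exact, [G V] is compared with the image of [Gl io p], the
    cokernel being again killed by e. *)
Lemma pd_coind m : exists N, forall V, fl thA V -> pd m V -> pd N (G V).
Proof.
have [_ _ _ [n Hn]] := good.
have GA : pd n.+1 (G A^o).
  apply: pd_summand (G_summand io (eR_summand fc)) _.
  have [H _] := iso_e 0 Hn Rfin (flG (flc Rfin)) (@corl_unit_inj _ _ io R^o) (corl_unit_surj fc (X := R^o)).
  by move: H; rewrite max0n; apply; apply: (@proj_free1 R).
elim: m => [|m [N HN]].
  exists n.+1 => V fV pV; have [k [L [i [p [ip fL]]]]] := fl_pres Afin fV.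
  have [s ps] := proj_split ip pV.
  have H : direct_summand (G V) (G (free_mod A k)) by apply: G_summand; exists s, p.
  apply: pd_summand H _; apply: pd_iso (iso_sym (G_pow k A^o)) _; exact: pd_pow.
exists (maxn (maxn N n.+1).+1 n) => V fV pV.
have [k [L [i [p [ip fL]]]]] := fl_pres Afin fV.
have pL := HN L fL (pd_syz ip (@proj_free A k) pV).
have [M [I [Q [a [b [c [d [ab cd cb]]]]]]]] := im_factor (Gl io p : {linear G _ -> G _}).
have [ja eab sb] := ab; have [jc ec sd] := cd; have [ji ei sp] := ip.
have LM : lmod_iso (G L) M.
  have [|u Hu] := ses_lift (h := Gl io i : {linear G _ -> G _}) ab.
    move=> w; apply: jc; rewrite cb linear0; apply/(Gl_exact ip); by exists w.
  apply: (@iso_of_bij _ _ _ u).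
    by apply: inj0 => w uw; apply: (Gl_inj ji); rewrite -Hu uw !linear0.
  move=> w; have /(Gl_exact ip) [v Hv] : Gl io p (a w) = 0 by rewrite -cb (ses_comp ab) linear0.
  by exists v; apply: ja; rewrite Hu.
have pM := pd_iso LM pL.
have pF : pd n.+1 (G (free_mod A k)).
  by apply: pd_iso (iso_sym (G_pow k A^o)) _; apply: pd_pow.
have pI : pd (maxn N n.+1).+1 I.
  by apply: pd_right ab _ _; [apply: pd_le (leq_maxl _ _) pM | apply: pd_le (leq_maxr _ _) pF].
have pQ : pd n Q.
  apply: Hn; first exact: fl_surj sd (flG fV).
  move=> x; have [_ _ scd] := ses_cor io cd; have [y <-] := scd x.
  have [w Hw] := sp (counit io V y); have [h Hh] := counit_surj fc w.
  have -> : y = corl io (Gl io p) h by apply: (counit_inj fc); rewrite corl_Gl Hh Hw.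
  by apply/val_inj; rewrite -[LHS]/(d (Gl io p (val h))) -cb; apply: ses_comp cd _.
by apply: pd_mid cd _ _; [apply: pd_le (leq_maxl _ _) pI | apply: pd_le (leq_maxr _ _) pQ].
Qed.

Lemma pd_of_cor m : exists N, forall X, fl thR X -> pd m (cor X) -> pd N X.
Proof.
have [_ _ _ [n Hn]] := good; have [N HN] := pd_coind m.
exists (maxn N n) => X fX pX.
have [_ H] := iso_e N Hn fX (flG (flc fX)) (@corl_unit_inj _ _ io X) (corl_unit_surj fc (X := X)).
by apply: H; apply: HN => //; apply: flc.
Qed.

Lemma Pf_of_cor X : fl thR X -> Pf thA (cor X) -> Pf thR X.
Proof. by move=> fX [_ [m pX]]; have [N HN] := pd_of_cor m; split=> //; exists N; apply: HN. Qed.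

Lemma bound_of_cor s : (forall V, Pf thA V -> pd s V) -> exists s', forall X, Pf thR X -> pd s' X.
Proof.
move=> Hs; have [N HN] := pd_of_cor s; exists N => X PX; apply: HN; first by case: PX.
by apply: Hs; apply: Pf_cor.
Qed.

Lemma Pf_coind V : Pf thA V -> Pf thR (G V).
Proof.
move=> PV; apply: Pf_of_cor; first by apply: flG; case: PV.
exact: Pf_summand (iso_summand (cor_coind fc V)) PV.
Qed.

Lemma perp_coind V : perp thA V -> perp thR (G V).
Proof. by move=> pV X /Pf_cor PX; apply/E1_coind/pV. Qed.

(** The unit becomes invertible on corners, so the corner of this pullback is [Z]: any map to eX is
    realised by a map to [X]. *)
Lemma coind_pullback X Z (phi : {linear Z -> cor X}) : fl thR X -> fl thA Z ->
  exists W (p : {linear W -> X}) (q : {linear W -> G Z}),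
  [/\ [/\ forall x, unit_map io X (p x) = Gl io phi (q x),
      forall x y, unit_map io X x = Gl io phi y -> exists z, p z = x /\ q z = y
    & forall z, p z = 0 -> q z = 0 -> z = 0], fl thR W & lmod_iso (cor W) Z].
Proof.
move=> fX fZ; have [W [p [q PB]]] := pullback (unit_map io X) (Gl io phi : {linear G _ -> G _}).
exists W, p, q; split=> //.
  case: PB => _ _ inj; apply: (@fl_inj _ _ _ _ _ (pairl p q)).
    by apply: inj0 => x [px qx]; apply: inj.
  by apply: fl_prod => //; apply: flG.
have [E ex inj] := PB.
apply: (@iso_of_bij _ _ _ (compl (counit io Z) (corl io q))).
  apply: inj0 => x /= H; have qx : q (val x) = 0.
    have : corl io q x = 0 by apply: (counit_inj fc); rewrite [LHS]H linear0.
    by move/(congr1 val).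
  apply/val_inj/inj => //.
  have : corl io p x = 0.
    apply: (@corl_unit_inj _ _ io X); rewrite [RHS]linear0; apply/val_inj.
    by apply: etrans (E (val x)) _; rewrite qx linear0.
  by move/(congr1 val).
move=> z; have [h Hh] := counit_surj fc z.
have Eh : corl io (unit_map io X) (phi z) = corl io (Gl io phi) h.
  by apply: (counit_inj fc); rewrite corl_unit corl_Gl Hh.
have [w [pw qw]] := ex _ _ (congr1 val Eh).
have ew : io 1 *: w = w.
  apply/subr0_eq/inj; first by rewrite linearB linearZZ pw corP subrr.
  by rewrite linearB linearZZ qw corP subrr.
exists (to_cor ew); rewrite -Hh; congr (counit io Z _); apply/val_inj.
by rewrite /= qw.
Qed.

Lemma coind_pullback_lift X Z (phi : {linear Z -> cor X}) W (p : {linear W -> X}) (q : {linear W -> G Z})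
   Y (f : {linear Y -> X}) (g : {linear cor Y -> Z}) :
  [/\ forall x, unit_map io X (p x) = Gl io phi (q x),
      forall x y, unit_map io X x = Gl io phi y -> exists z, p z = x /\ q z = y
    & forall z, p z = 0 -> q z = 0 -> z = 0] ->
  (forall y, phi (g y) = corl io f y) -> exists h : {linear Y -> W}, forall y, p (h y) = f y.
Proof.
move=> [E ex inj] fg; have [||h Hh] := @inj_lift _ Y _ _ (pairl p q) (pairl f (adj g)).
- by apply: inj0 => x [px qx]; apply: inj.
- move=> y; have [|w [pw qw]] := ex (f y) (adj g y).
    apply: G_eq => x; rewrite GlE !adjE fg; apply: val_inj; rewrite /=.
    by rewrite linearZZ.
  by exists w; rewrite /= pw qw.
by exists h => y; have := congr1 fst (Hh y).
Qed.

Lemma cf_of_corner : Pfin_contravariantly_finite A -> Pfin_contravariantly_finite R.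
Proof.
move=> cf X /(fl_gen Rfin) fX.
have [Z [phi [/(PfE Afin) PZ Hphi]]] := cf (cor X) (proj1 (fl_gen Afin _) (flc fX)).
have [W [p [q [PB fW iW]]]] := coind_pullback phi fX PZ.1.
exists W, p; split.
  by apply/(PfE Rfin)/Pf_of_cor => //; apply: Pf_summand (iso_summand iW) PZ.
move=> Y f /(PfE Rfin) PY.
have [g Hg] := Hphi (cor Y) (corl io f) (proj1 (PfE Afin _) (Pf_cor PY)).
have [h Hh] := coind_pullback_lift PB (fun y => esym (Hg y)).
by exists h => y; rewrite Hh.
Qed.

(* W is a special approximation of an injective cogenerator of R, obtained by pulling back
   one over A. *)
Lemma STilt_corner T : fin_len K^o -> central thA -> STilt thA T ->
  exists W, STilt thR (G T * W)%type /\ Pf thR W.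
Proof.
move=> finK cA sT; have [I [fI iI cI]] := inj_cogen finK cR Rfin.
have [Y [Z [f [g [fg PZ pY]]]]] := special_approx finK cA Afin sT (flc fI).
have [W [p [q [PB fW iW]]]] := coind_pullback g fI PZ.1.
have PW : Pf thR W by apply: Pf_of_cor => //; apply: Pf_summand (iso_summand iW) PZ.
have E1Y : E1 (eR io) Y by apply/pY/Pf_eR.
have sG : surj (Gl io g : {linear G _ -> G _}) by apply: Gl_surj fg E1Y.
have sesG : ses (Gl io f : {linear G _ -> G _}) (Gl io g : {linear G _ -> G _}).
  by split=> //; [apply: Gl_inj; case: fg | apply: Gl_exact].
have [j [jp _]] := pullback_ses PB sesG.
have pGY := perp_coind pY.
have pI : perp thR I by move=> X [fX _]; apply: iI.
have pW : perp thR W := perp_mid Rfin jp pGY pI.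
have [PT pT _ [s bd]] := sT.
exists W; split=> //; split.
- exact: Pf_prod (Pf_coind PT) PW.
- have pGT := perp_coind pT; exact: (@perp_prod _ _ _ Rfin (G T) W pGT pW).
(* Maps from [X] to [I] lift along [p], whose kernel is the Ext-injective [GY], and the lifts remain
   jointly injective. The embedding goes into the summand [W]; [GT] is there for the sake of the
   endomorphism ring. *)
- move=> X PX; have [n [e je]] := cI X PX.1; exists n.
  have /choice [h Hh] i : exists h : {linear X -> W}, forall x, p (h x) = e x i.
    exact: (E1_lift (compl (powpl I i) e) jp (pGY X PX)).
  exists (powtupl (fun i => compl (inrl (G T) W) (h i))) => x y E; apply: je; apply/ffunP => i.
  have /(congr1 (fun v : {ffun 'I_n -> G T * W} => p (v i).2)) := E.
  by rewrite !ffunE /= !Hh.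
exact: bound_of_cor bd.
Qed.

End GoodCorner.

(** * Modules Hom(X, U) over the endomorphism ring of U *)

Record endo_iso (D R : nzRingType) (U : lmodType R) := EndoIso {
  ph :> D -> {linear U -> U};
  phD : forall x y t, ph (x + y) t = ph x t + ph y t;
  phM : forall x y t, ph (x * y) t = ph x (ph y t);
  ph_inj : forall x y, ph x =1 ph y -> x = y;
  ph_surj : forall f : {linear U -> U}, exists x, ph x =1 f }.

Section HomFunctor.
Variables (D R : nzRingType) (U : lmodType R) (phi : endo_iso D U).
Implicit Types X Y Z : lmodType R.

Lemma ph1 t : phi 1 t = t.
Proof. by have [u Hu] := ph_surj phi (idl U); have := phM phi 1 u t; rewrite mul1r !Hu. Qed.
Lemma ph0 t : phi 0 t = 0.
Proof. by apply: (addrI (phi 0 t)); rewrite -phD !addr0. Qed.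

Definition dual_mod (phi : endo_iso D U) X : Type := homT X U.
Section Instances.
Variable X : lmodType R.
Local Notation F := (dual_mod phi X).
HB.instance Definition _ := GRing.Zmodule.copy F (homT X U).
Definition unF (f : F) : {linear X -> U} := f.
Definition F_scale (d : D) (f : F) : F := compl (phi d) (unF f).
Fact F_scaleA a b (x : F) : F_scale a (F_scale b x) = F_scale (a * b) x.
Proof. by apply: lin_ext => y; rewrite /= phM. Qed.
Fact F_scale1 : left_id 1 F_scale.
Proof. by move=> x; apply: lin_ext => y; rewrite /= ph1. Qed.
Fact F_scaleDr : right_distributive F_scale +%R.
Proof. by move=> a x y; apply: lin_ext => z; apply: (linearD (phi a)). Qed.
Fact F_scaleDl x : {morph F_scale^~ x : a b / a + b}.
Proof. by move=> a b; apply: lin_ext => y; apply: phD. Qed.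
HB.instance Definition _ := GRing.Zmodule_isLmodule.Build D F
  F_scaleA F_scale1 F_scaleDr F_scaleDl.
End Instances.

Local Notation F X := (dual_mod phi X : lmodType D).

Lemma F_eq X (f g : F X) : (forall x, unF f x = unF g x) -> f = g.
Proof. exact: lin_ext. Qed.
Lemma F_scaleE X d (f : F X) x : unF (d *: f) x = phi d (unF f x). Proof. by []. Qed.

Lemma Fl_linear X Y (f : {linear X -> Y}) : linear (fun h : F Y => compl (unF h) f : F X).
Proof. by move=> a x y; apply: lin_ext. Qed.
Definition Fl X Y f : {linear F Y -> F X} := lin_of (@Fl_linear X Y f).

Lemma F_summand X Y : direct_summand X Y -> direct_summand (F X) (F Y).
Proof. by move=> [i [p ip]]; exists (Fl p), (Fl i) => h; apply: F_eq => x /=; rewrite ip. Qed.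

Lemma F_ses X Y Z (f : {linear X -> Y}) (g : {linear Y -> Z}) :
  ses f g -> E1 Z U -> ses (Fl g) (Fl f).
Proof.
move=> fg E; have [jf ef sg] := fg; split.
- apply: inj0 => h h0; apply: F_eq => z; have [y <-] := sg z.
  by have := congr1 (fun k => unF k y) h0.
- move=> h; split=> [h0|[k <-]]; last first.
    by apply: F_eq => x; rewrite /= (ses_comp fg) linear0.
  have [|k Hk] := ses_desc (h := unF h) fg; first by move=> x; have := congr1 (fun k => unF k x) h0.
  by exists (k : F Z); apply: F_eq => y; rewrite /= Hk.
move=> h; have [k Hk] := E _ _ _ _ fg (unF h).
by exists (k : F Y); apply: F_eq => x; rewrite /= Hk.
Qed.

Lemma ev_linear n : linear (fun c : free_mod D n => powsuml (fun i => phi (c i)) : F {ffun 'I_n -> U}).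
Proof.
move=> a x y; apply: F_eq => u.
rewrite -[RHS]/(phi a (\sum_i phi (x i) (u i)) + \sum_i phi (y i) (u i)).
rewrite linear_sum -big_split; apply: eq_bigr => i _.
by rewrite !ffunE phD phM.
Qed.

(** Identifies D^n with Hom(U^n, U): a tuple is read as a row of endomorphisms. *)
Definition ev n : {linear free_mod D n -> F {ffun 'I_n -> U}} := lin_of (@ev_linear n).
Lemma evE n c u : unF (ev n c) u = \sum_i phi (c i) (u i). Proof. by []. Qed.

Lemma ev_surj n : surj (ev n).
Proof.
move=> h; have /choice [c Hc] i : exists d, phi d =1 compl (unF h) (powil U i) by apply: ph_surj.
exists [ffun i => c i]; apply: F_eq => u; rewrite evE [RHS]powsumE.
by apply: eq_bigr => i _; rewrite ffunE Hc.
Qed.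

Lemma ev_inj n : injective (ev n).
Proof.
apply: inj0 => c c0; apply/ffunP => i; rewrite ffunE; apply: (ph_inj (e := phi)) => u.
have := congr1 (fun h => unF h (powi i u)) c0; rewrite evE ph0 (bigD1 i) //= big1 ?addr0.
  by rewrite ffunE eqxx.
by move=> j /negbTE ji; rewrite ffunE ji linear0.
Qed.

Lemma F_pow_proj n : projective (F {ffun 'I_n -> U}).
Proof. by apply: (proj_iso (iso_sym (iso_of_bij (@ev_inj n) (@ev_surj n)))); apply: proj_free. Qed.

Variables (K : comNzRingType) (thD : {rmorphism K -> D}) (thR : {rmorphism K -> R}).
Hypothesis phi_th : forall k t, phi (thD k) t = thR k *: t.
Hypotheses (Rfin : fl thR R^o).
Lemma fl_F X : fl thR X -> fl thR U -> fl thD (F X).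
Proof.
move=> fX fU; have [n [g Hg]] := proj1 (fl_gen Rfin _) fX.
have lv : linear (fun h : res_mod thD (F X) => [ffun i => unF h (g i)] : res_mod thR {ffun 'I_n -> U}).
  have E (u v : {ffun 'I_n -> U}) (a : R) i : (a *: u + v) i = a *: u i + v i by rewrite !ffunE.
  move=> k x y; apply/ffunP => i; rewrite ffunE; apply/esym; apply: etrans (E _ _ (thR k) i) _.
  rewrite !ffunE -[RHS]/(phi (thD k) (unF x (g i)) + unF y (g i)); congr (_ + _).
  by rewrite phi_th.
apply: (@fin_len_inj _ _ _ (lin_of lv)); last exact: (@fl_pow _ _ thR n U).
apply: inj0 => h /ffunP h0; apply: F_eq => y; have [c ->] := Hg y.
rewrite linear_sum big1 // => i _; have := h0 i; rewrite ffunE [RHS]ffunE => h0i.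
by rewrite linearZZ h0i scaler0.
Qed.

Lemma fl_endo : fl thR U -> fl thD D^o.
Proof.
move=> fU; apply: fl_summand (iso_summand (pow1_iso D^o)) _.
apply: fl_inj (@ev_inj 1) _; exact: fl_F (fl_pow 1 fU) fU.
Qed.

Hypothesis sU : STilt thR U.

(** Hom(-, U) turns a coresolution of [X] by powers of [U] into a projective resolution. It stops at
    [s], because Ext-injective objects of P^{<oo} lie in add U. *)
Lemma pd_F : exists s, forall X, Pf thR X -> pd s (F X).
Proof.
have [PU pU emb [s bd]] := sU; exists s => X PX.
have : E1n thR s X by apply: E1n_bound.
elim: s {bd} X PX => [|s IH] X PX.
  move=> /(E1n0 Rfin) pX; have [n XU] := STilt_add sU PX pX.
  exact: proj_summand (F_summand XU) (@F_pow_proj n).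
move=> EX; have [n [e je]] := emb X PX; have [Q [q eq]] := coker_ses je.
have PQ := Pf_right eq PX (Pf_pow n PU).
exists (F Q), (F {ffun 'I_n -> U}), (Fl q), (Fl e); split; [|exact: F_pow_proj|].
  by apply: F_ses eq _; apply: pU.
have pUn : perp thR {ffun 'I_n -> U} by apply: perp_pow.
by apply: (IH _ PQ); exact: (E1n_step Rfin eq pUn EX).
Qed.

End HomFunctor.

(** * The corner of a tilted algebra *)

Section TiltedCorner.
Variables (K : comNzRingType) (A R : nzRingType) (thA : {rmorphism K -> A}) (thR : {rmorphism K -> R}).
Variable io : nuhom A R.
Hypothesis good : good_corner thA thR io.
Hypotheses (cR : central thR) (cA : central thA) (Afin : fl thA A^o) (Rfin : fl thR R^o).
Variables (T : lmodType A) (U : lmodType R).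
Hypotheses (sT : STilt thA T) (sU : STilt thR U).
Local Notation G Z := (coind_mod io Z : lmodType R).
Variables (i : {linear G T -> U}) (p : {linear U -> G T}).
Hypothesis ip : cancel i p.
Variables (DA D : nzRingType) (thDA : {rmorphism K -> DA}) (thD : {rmorphism K -> D}).
Variables (phA : endo_iso DA T) (phi : endo_iso D U).
Hypotheses (phA_th : forall k t, phA (thDA k) t = thA k *: t)
           (phi_th : forall k t, phi (thD k) t = thR k *: t).

Let fc : full_corner io. Proof. by case: good. Qed.
Let io_th : forall k, io (thA k) = io 1 * thR k. Proof. by case: good. Qed.

Lemma tilted_corner : exists io' : nuhom DA D, good_corner thDA thD io'.
Proof.
(* An endomorphism of [T] acts on the summand [GT] by functoriality and as 0 on the complement; the
   idempotent is [i] after [p]. *)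
pose psi a : {linear U -> U} := compl i (compl (Gl io (phA a)) p).
have /choice [f Hf] a : exists d, phi d =1 psi a by apply: ph_surj.
have fD a b : f (a + b) = f a + f b.
  apply: (ph_inj (e := phi)) => t; rewrite phD !Hf /psi /= -linearD; congr (i _).
  by apply: G_eq => y; rewrite GlE phD.
have fM a b : f (a * b) = f a * f b.
  apply: (ph_inj (e := phi)) => t; rewrite phM !Hf /psi /= ip; congr (i _).
  by apply: G_eq => y; rewrite GlE phM.
have f1 t : phi (f 1) t = i (p t).
  by rewrite Hf /psi /=; congr (i _); apply: G_eq => y; rewrite GlE ph1.
have GK k (h : G T) : Gl io (phA (thDA k)) h = thR k *: h.
  apply: G_eq => y; rewrite GlE phA_th G_scaleE -linearZZ; congr (unG h _).
  apply/val_inj; rewrite /= -cR -[LHS]/(io (thA k) * _) io_th -cR -mulrA.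
  by congr (_ * _); apply: (corP y).
pose io' := Nuhom fD fM.
have [PT pT embT _] := sT; have [PU pU embU _] := sU.
have fc' : full_corner io'.
  split=> [a b E|d].
    apply: (ph_inj (e := phA)) => t; have [h <-] := counit_surj fc t.
    rewrite -!corl_Gl; congr (counit io T _); apply/val_inj => /=.
    rewrite -[val h]ip; apply: (can_inj ip).
    by have := congr1 (fun d => phi d (i (val h))) E; rewrite /= !Hf /psi /= ip.
  (* An endomorphism of [GT] comes from one of [T], because the counit e(GT) -> T is bijective. *)
  pose g : {linear G T -> G T} := compl p (compl (phi d) i).
  have [|t Ht] := surj_desc (h := compl (counit io T) (corl io g)) (counit_surj fc (V := T)).
    by move=> h /= h0; rewrite (counit_inj fc (etrans h0 (esym (linear0 (counit io T))))) !linear0.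
  have [a Ha] := ph_surj phA t; exists a; apply: (ph_inj (e := phi)) => u.
  rewrite !phM !f1 Hf /psi /=; congr (i _).
  suff H : Gl io (phA a) =1 g by exact: (esym (H (p u))).
  apply: coadj_inj => x; rewrite -[RHS]/(counit io T (corl io g x)).
  by rewrite -[RHS]Ht -Ha.
have Th k : io' (thDA k) = io' 1 * thD k.
  apply: (ph_inj (e := phi)) => t; rewrite phM phi_th f1 Hf -[LHS]/(i (Gl io (phA (thDA k)) (p t))) GK.
  by rewrite !linearZZ.
exists io'; split=> //.
- (* e'D = Hom_R(U, GT) = Hom_A(eU, T) *)
  have [s Hs] := pd_F phA Afin sT; exists s.
  have PcU : Pf thA (corner_mod io U) := Pf_cor good cR Rfin PU.
  have lv : linear (fun d : eR io' => coadj (compl p (phi (val d))) : dual_mod phA (corner_mod io U)).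
    move=> a x y; apply: F_eq => u; rewrite /= phD linearD.
    rewrite -[RHS]/(phA a (unG (p (phi (val x) (val u))) (eR1 io)) + unG (p (phi (val y) (val u))) (eR1 io)).
    rewrite -[LHS]/(unG (p (phi (io' a * val x) (val u))) (eR1 io) + unG (p (phi (val y) (val u))) (eR1 io)).
    by congr (_ + _); rewrite phM Hf /psi /= ip.
  apply: pd_iso (iso_sym _) (Hs _ PcU); apply: (@iso_of_bij _ _ _ (lin_of lv)).
    apply: inj0 => d d0; apply/val_inj; apply: (ph_inj (e := phi)) => u; rewrite ph0.
    have H : compl p (phi (val d)) =1 zerol U (G T).
      by apply: coadj_inj => x; have := congr1 (fun h => unF h x) d0.
    have -> : val d = io' 1 * val d by apply/esym/(corP d).
    by rewrite phM f1; have /= -> := H u; rewrite linear0.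
  move=> h; have [d Hd] := ph_surj phi (compl i (adj (unF h))).
  have Ed : io' 1 *: (d : D^o) = d.
    by apply: (ph_inj (e := phi)) => u; rewrite phM f1 Hd /= ip.
  exists (to_cor Ed); apply: F_eq => x.
  rewrite -[LHS]/(unG (p (phi d (val x))) (eR1 io)) Hd /= ip.
  exact: adjK.
have [s Hs] := pd_F phi Rfin sU; exists s => Y fY Y0.
have Dfin : fl thD D^o := fl_endo phi_th Rfin PU.1.
have [n [L [k [p0 [kp fL]]]]] := fl_pres Dfin fY.
have [m [p1 sp1]] := proj1 (fin_gen_free L) (proj1 (fl_gen Dfin L) fL).
have [jk ek sp0] := kp.
(* A presentation D^m -> D^n -> Y is a matrix, and [dl] is the map U^n -> U^m with this matrix; [Y]
   is the cokernel of Hom(dl, U). *)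
pose dl := powtupl (fun j => unF (ev phi n (k (p1 (powi j (1 : D^o)))))).
have ev_dl b u : unF (ev phi n (k (p1 b))) u = unF (ev phi m b) (dl u).
  rewrite evE {1}[b]pow_sum !linear_sum.
  under eq_bigr => l _ do rewrite sum_ffunE.
  have -> : \sum_i phi (\sum_j (k (p1 (powi j (b j)))) i) (u i) =
            \sum_i \sum_j phi (k (p1 (powi j (b j))) i) (u i).
    apply: eq_bigr => l _; elim/big_rec2: _ => [|j x y _ <-]; first exact: ph0.
    exact: phD.
  rewrite exchange_big; apply: eq_bigr => j _.
  rewrite /dl ffunE evE linear_sum; apply: eq_bigr => l _; rewrite -phM; congr (phi _ _).
  have -> : powi j (b j) = b j *: powi j (1 : D^o).
    by apply/ffunP => j'; rewrite !ffunE; case: eqP => _; rewrite ?scaler0 //; apply/esym/mulr1.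
  by rewrite !linearZZ ffunE.
have ker c : p0 c = 0 <-> exists g : {linear {ffun 'I_m -> U} -> U}, forall u, unF (ev phi n c) u = g (dl u).
  split=> [/ek [l <-]|[g Hg]].
    by have [b <-] := sp1 l; exists (unF (ev phi m b)) => u; apply: ev_dl.
  have [b Hb] := @ev_surj _ _ _ phi m (g : dual_mod phi {ffun 'I_m -> U}).
  have -> : c = k (p1 b).
    by apply: (ev_inj (phi := phi) (n := n)); apply: F_eq => u; rewrite Hg ev_dl Hb.
  exact: ses_comp kp _.
have PUn : Pf thR {ffun 'I_n -> U} by apply: Pf_pow.
(* Here e'Y = 0 enters. A map [h] from e(U^n) to [T] gives a map U^n -> GT, that is, an element of
   e'D^n. Its class in [Y] vanishes, so it factors through [dl], and [h] vanishes on the kernel of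
   e(dl). As [T] cogenerates, this kernel is 0. *)
have jdl : injective (corl io dl).
  apply: inj0 => x x0.
  have [r [e je]] := embT _ (Pf_cor good cR Rfin PUn).
  apply: je; rewrite linear0; apply/ffunP => j; rewrite [RHS]ffunE.
  pose h := compl (powpl T j) e.
  have [c Hc] := @ev_surj _ _ _ phi n (compl i (adj h) : dual_mod phi {ffun 'I_n -> U}).
  have Ec : io' 1 *: c = c.
    apply: (ev_inj (phi := phi) (n := n)); rewrite linearZZ Hc; apply: F_eq => u.
    by rewrite F_scaleE f1 /= ip.
  have Epc : io' 1 *: p0 c = p0 c by rewrite -linearZZ Ec.
  have /ker [g Hg] : p0 c = 0 by have /(congr1 val) := Y0 (to_cor Epc).
  have H : i (adj h (val x)) = 0.
    have := Hg (val x); rewrite Hc => /= ->.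
    by have /(congr1 val) /= -> := x0; rewrite linear0.
  have {}H : adj h (val x) = 0 by apply: (can_inj ip); rewrite H linear0.
  by rewrite -[LHS]/(h x) -(adjK h x) /= -[LHS]/(unG (adj h (val x)) (eR1 io)) H.
have [X0 [B [Q [x0 [b0 [i0 [q0 [xb iq ib]]]]]]]] := im_factor dl.
have [jx ex sb] := xb.
(* The kernel of [dl] is killed by e, so it lies in P^{<oo}, and then so do image and cokernel.
   Hom(-, U) is exact on both resulting sequences, which gives Y = Hom(X0, U). *)
have PX0 : Pf thR X0.
  have fX0 : fl thR X0 by apply: fl_inj jx PUn.1.
  split=> //; have [_ _ _ [s' Hs']] := good; exists s'; apply: Hs' => // x.
  have H z : dl (x0 z) = 0 by rewrite -ib (ses_comp xb) linear0.
  have [jcx _ _] := ses_cor io xb; apply: jcx; apply: jdl; apply/val_inj.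
  exact: etrans (H _) (esym (H _)).
have PB := Pf_right xb PX0 PUn; have PQ := Pf_right iq PB (Pf_pow m PU).
have sF := F_ses phi xb (pU _ PB); have [_ _ sFx] := sF.
have HF c : p0 c = 0 -> (compl (Fl phi x0) (ev phi n)) c = 0.
  move=> /ker [g Hg]; apply: F_eq => x.
  rewrite -[LHS]/(unF (ev phi n c) (x0 x)) Hg -ib (ses_comp xb) !linear0 //.
have [w Hw] := surj_desc sp0 HF.
apply: pd_iso (iso_sym _) (Hs _ PX0); apply: (@iso_of_bij _ _ _ w).
  apply: inj0 => y; have [c <-] := sp0 y; rewrite Hw => H; apply/ker.
  have [|v Hv] := ses_desc (h := unF (ev phi n c)) xb.
    by move=> x; have := congr1 (fun h => unF h x) H.
  have [g Hg] := pU _ PQ _ _ _ _ iq v.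
  by exists g => u; rewrite -ib Hg Hv.
move=> h; have [h' Hh'] := sFx h; have [c Hc] := @ev_surj _ _ _ phi n h'.
by exists (p0 c); rewrite Hw -[LHS]/(Fl phi x0 (ev phi n c)) Hc.
Qed.

End TiltedCorner.

(** * Krull-Schmidt decompositions *)

Section KrullSchmidt.
Variable R : nzRingType.
Implicit Types X Y Z V W U T S : lmodType R.

Definition bij X Y (f : {linear X -> Y}) := injective f /\ surj f.

Lemma bij_ext X Y (f g : {linear X -> Y}) : f =1 g -> bij f -> bij g.
Proof.
by move=> fg [i s]; split=> [x y|y]; [rewrite -!fg; apply: i | have [x <-] := s y; exists x].
Qed.

Lemma bij_compl X Y Z (f : {linear X -> Y}) (g : {linear Y -> Z}) :
  bij f -> bij g -> bij (compl g f).
Proof.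
move=> [i s] [i' s']; split=> [x y /= /i'/i //|z].
by have [y <-] := s' z; have [x <-] := s y; exists x.
Qed.

Lemma bijK X Y (f : {linear X -> Y}) : bij f -> exists g : {linear Y -> X}, [/\ cancel f g, cancel g f & bij g].
Proof.
move=> [i s]; have [g [fK gK]] := bij_inv i s; exists g; split=> //.
by split=> [|x]; [apply: can_inj gK | exists (f x)].
Qed.

Lemma iter_linear X (f : {linear X -> X}) n : linear (iter n f).
Proof. by elim: n => [|n IH] a x y //=; rewrite IH linearP. Qed.
Definition iterl X n (f : {linear X -> X}) : {linear X -> X} := lin_of (iter_linear f n).

(** The images of the iterates stabilise; from f^(n+1) y = f^n x the injective f^n is cancelled. *)
Lemma inj_surj X (f : {linear X -> X}) : fin_len X -> injective f -> surj f.
Proof.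
move=> fX i; pose Q (S : X -> Prop) := exists n, forall x, S x <-> exists y, iter n f y = x.
have [||S [[n Sn] minS]] := @fin_len_min _ X Q (fun _ => True) fX.
- by exists 0%N => x; split=> // _; exists x.
- move=> S [n Sn]; have [H0 HD] := im_submod (iterl n f).
  by split=> [|a x y /Sn ? /Sn ?]; apply/Sn; [apply: H0 | apply: HD].
move=> x; have [y Hy] : exists y, iter n.+1 f y = iter n f x.
  apply: (minS (fun z => exists y, iter n.+1 f y = z)); first by exists n.+1.
    by move=> _ [y <-]; apply/Sn; exists (f y); rewrite -iterSr.
  by apply/Sn; exists x.
exists y; have inj_iter m : injective (iter m f) by elim: m => [|m IH] u v //= /i/IH.
by apply: (inj_iter n); rewrite -Hy iterSr.
Qed.

Lemma inj_endo_bij X (f : {linear X -> X}) : fin_len X -> injective f -> bij f.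
Proof. by move=> fX i; split=> //; apply: inj_surj. Qed.

Lemma fitting X (f : {linear X -> X}) : fin_len X -> exists n Z V (k : {linear Z -> X}) (v : {linear V -> X}),
  [/\ bij (copairl k v), forall z, iter n f (k z) = 0 &
      exists g h : {linear V -> V}, [/\ forall x, f (v x) = v (g x), cancel g h & cancel h g]].
Proof.
move=> fX; pose Q (S : X -> Prop) := exists n, forall x, S x <-> exists y, iter n f y = x.
have [||S [[n Sn] minS]] := @fin_len_min _ X Q (fun _ => True) fX.
- by exists 0%N => x; split=> // _; exists x.
- move=> S [n Sn]; have [H0 HD] := im_submod (iterl n f).
  by split=> [|a x y /Sn ? /Sn ?]; apply/Sn; [apply: H0 | apply: HD].
pose Q' (S : X -> Prop) := exists n, forall x, S x <-> iter n f x = 0.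
have [||S' [[m Sm] maxS]] := @fin_len_max _ X Q' (fun x => x = 0) fX.
- by exists 0%N.
- move=> S1 [n1 Sn1]; have [H0 HD] := ker_submod (iterl n1 f).
  by split=> [|a x y /Sn1 ? /Sn1 ?]; apply/Sn1; [apply: H0 | apply: HD].
have f0 j : iter j f 0 = 0 by apply: (linear0 (iterl j f)).
(* Kernels are stable from [m] on and images from [n] on. The extra 1 keeps [N] positive, so that f
   x = 0 implies f^N x = 0. *)
have [N EN] : exists N, N = (m.+1 + n)%N by exists (m.+1 + n)%N.
have im_stable j x : exists y, iter (n + j) f y = iter n f x.
  apply: (minS (fun z => exists y, iter (n + j) f y = z)); first by exists (n + j)%N.
    by move=> _ [y <-]; apply/Sn; exists (iter j f y); rewrite -iterD.
  by apply/Sn; exists x.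
have im_stableN j x : exists y, iter (N + j) f y = iter N f x.
  have [y Hy] := im_stable j x; exists y.
  by rewrite EN -addnA iterD Hy -iterD.
have ker_stable j x : iter (m + j) f x = 0 -> iter m f x = 0.
  move=> H; apply/Sm; apply: (maxS (fun z => iter (m + j) f z = 0)) => //.
    by exists (m + j)%N.
  by move=> z /Sm Hz; rewrite addnC iterD Hz f0.
have [V [Q1 [v [q1 [vq Hv]]]]] := sub_quot (im_submod (iterl N f)).
have [Z [Q2 [k [q2 [kq Hk]]]]] := sub_quot (ker_submod (iterl N f)).
have [jv _ _] := vq; have [jk _ _] := kq.
have kerN x : iter N f (iter N f x) = 0 -> iter N f x = 0.
  rewrite -iterD => H; rewrite EN addSn -addnS addnC iterD (ker_stable (n.+1 + N)%N) ?f0 //.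
  by rewrite addnA addnS -addSn -EN.
exists N, Z, V, k, v; split; first split.
- apply: inj0 => -[z w] /= E.
  have [x Hx] : exists x, iter N f x = v w by apply/Hv; exists w.
  have Hz : iter N f (k z) = 0 by apply/Hk; exists z.
  have Ew : v w = 0.
    rewrite -Hx; apply: kerN; rewrite Hx.
    have -> : v w = - k z by apply/eqP; rewrite -addr_eq0 addrC E.
    by apply: etrans (linearN (iterl N f) (k z)) _; rewrite /= Hz oppr0.
  have /jv Hw : v w = v 0 by rewrite Ew linear0.
  have /jk -> : k z = k 0 by move: E; rewrite Ew addr0 linear0.
  by rewrite Hw.
- move=> x; have [y Hy] := im_stableN N x.
  have Hy' : iter N f (iter N f y) = iter N f x by rewrite -iterD.
  have /Hk [z Hz] : iterl N f (x - iter N f y) = 0.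
    by rewrite linearB /= Hy' subrr.
  have /Hv [w Hw] : exists u, iterl N f u = iter N f y by exists y.
  by exists (z, w); rewrite /= Hz Hw subrK.
- by move=> z; apply/Hk; exists z.
have [|g Hg] := @inj_lift _ V _ _ v (compl f v) jv.
  move=> w; apply/Hv; have [x Hx] : exists x, iter N f x = v w by apply/Hv; exists w.
  by exists (f x); rewrite /= -Hx -iterSr.
have bg : bij g.
  split.
    apply: inj0 => w gw; apply: jv; rewrite linear0.
    have [x Hx] : exists x, iter N f x = v w by apply/Hv; exists w.
    rewrite -Hx; apply: kerN; rewrite Hx; have := Hg w; rewrite gw linear0 /= => E.
    by rewrite EN addSn iterSr -E f0.
  move=> w; have [x Hx] : exists x, iter N f x = v w by apply/Hv; exists w.
  have [y Hy] := im_stableN 1%N x.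
  have /Hv [w' Hw'] : exists u, iterl N f u = iter N f y by exists y.
  by exists w'; apply: jv; rewrite Hg /= Hw' -Hx -Hy addn1.
by have [h [gh hg _]] := bijK bg; exists g, h; split=> // x; rewrite Hg.
Qed.

Lemma endo_dich Y (f : {linear Y -> Y}) : fin_len Y -> indecomposable Y ->
  bij f \/ exists n, forall x, iter n f x = 0.
Proof.
move=> fY [nz ind]; have [n [Z [V [k [v [[i s] kn [g [h [fv gh hg]]]]]]]]] := fitting f fY.
have [Z0|V0] := ind Z V (iso_sym (iso_of_bij i s)); [left|right].
  have vb : bij v.
    split=> [x y E|x].
      by have /i [] : copairl k v (0, x) = copairl k v (0, y) by rewrite /= linear0 E.
    by have [[z w] <-] := s x; exists w; rewrite /= (Z0 z) linear0 add0r.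
  apply: inj_endo_bij => // x y E; have [_ sv] := vb; have [jv _] := vb.
  have [x' Ex] := sv x; have [y' Ey] := sv y; move: E; rewrite -Ex -Ey !fv.
  by move/jv/(can_inj gh) ->.
exists n => x; have [[z w] <-] := s x.
by rewrite /= (V0 w) linear0 addr0 kn.
Qed.

Lemma bij_1sub X (f g : {linear X -> X}) n : fin_len X -> (forall x, iter n f x = 0) ->
  (forall x, g x = x - f x) -> bij g.
Proof.
move=> fX fn Hg; apply: inj_endo_bij => //; apply: inj0 => x; rewrite Hg => /eqP; rewrite subr_eq0 => /eqP E.
by rewrite -(fn x); elim: n {fn} => [|n IH] //=; rewrite -IH -E.
Qed.

Section Local.
Variable Y : lmodType R.
Hypotheses (fY : fin_len Y) (indY : indecomposable Y).

(** Locality of End(Y): up to the automorphism [u], either [f] is bijective, or it is nilpotent and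
    1 - f is bijective. *)
Lemma bij_sum (f g u : {linear Y -> Y}) : bij u -> (forall x, u x = f x + g x) -> bij f \/ bij g.
Proof.
move=> bu E; have [u' [uK u'K bu']] := bijK bu.
have [H|[n Hn]] := endo_dich (compl u' f) fY indY; [left|right].
  by apply: bij_ext (bij_compl H bu) => x /=; rewrite u'K.
have H : bij (compl u' g).
  apply: (bij_1sub fY Hn) => x /=; apply/eqP; rewrite eq_sym subr_eq addrC; apply/eqP.
  by rewrite -linearD -E uK.
by apply: bij_ext (bij_compl H bu) => x /=; rewrite u'K.
Qed.

Lemma nz_indec : exists y : Y, y <> 0.
Proof.
have [nz _] := indY; apply: contrapT => H; apply: nz => y; apply: contrapT => ny.
by apply: H; exists y.
Qed.

Lemma not_bij0 (f : {linear Y -> Y}) : (forall x, f x = 0) -> ~ bij f.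
Proof.
move=> f0 [i _]; have [y ny] := nz_indec; apply: ny; apply: i.
by rewrite !f0.
Qed.

Lemma bij_bigsum (I : finType) (f : I -> {linear Y -> Y}) (u : {linear Y -> Y}) :
  bij u -> (forall x, u x = \sum_i f i x) -> exists i, bij (f i).
Proof.
move=> bu; rewrite /index_enum; elim: (Finite.enum I) u bu => [|i s IH] u bu E.
  by case: (@not_bij0 u) => // x; rewrite E big_nil.
have lg : linear (fun x => \sum_(j <- s) f j x).
  move=> a x y; rewrite scaler_sumr -big_split; apply: eq_bigr => j _ /=.
  exact: linearP.
have [|H|H] := @bij_sum (f i) (lin_of lg) u bu; first by move=> x; rewrite E big_cons.
  by exists i.
exact: IH H _.
Qed.

Lemma summand_bij V (i : {linear Y -> V}) (p : {linear V -> Y}) : bij (compl p i) -> direct_summand Y V.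
Proof.
by move=> /bijK [c [cK _ _]]; exists i, (compl c p) => y; apply: cK.
Qed.
End Local.

Lemma summand_compl X Y : direct_summand X Y -> exists Z, lmod_iso (Z * X)%type Y.
Proof.
move=> [i [p ip]]; have [Z [z zp]] : exists Z (z : {linear Z -> Y}), ses z p.
  by apply: ker_ses => x; exists (i x).
exists Z; exact: split_iso zp ip.
Qed.

Lemma summand_fin_len X Y : direct_summand X Y -> fin_len Y -> fin_len X.
Proof. by move=> [i [p ip]]; apply: fin_len_inj (can_inj ip). Qed.

(** The identity of each copy of [Y] is a sum of a map through one part of the decomposition and a
    map through the other; by locality one of them is bijective and splits [Y] off that part. *)
Lemma drop_copy S W Y : fin_len (S * W)%type -> indecomposable Y ->
  direct_summand (Y * Y)%type (S * W)%type -> ~ direct_summand (Y * Y)%type S ->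
  exists W', [/\ lmod_iso (W' * Y)%type W & direct_summand Y (S * W')%type].
Proof.
move=> fSW indY [i [p ip]] nYS.
have fY : fin_len Y.
  by apply: summand_fin_len fSW; apply: summand_trans (summand_prodl Y Y) _; exists i, p.
pose i1 := compl i (inll Y Y); pose i2 := compl i (inrl Y Y).
pose p1 := compl (fstl Y Y) p; pose p2 := compl (sndl Y Y) p.
have p1i1 x : p1 (i1 x) = x by rewrite /p1 /i1 /= ip.
have p2i2 x : p2 (i2 x) = x by rewrite /p2 /i2 /= ip.
have p1i2 x : p1 (i2 x) = 0 by rewrite /p1 /i2 /= ip.
have p2i1 x : p2 (i1 x) = 0 by rewrite /p2 /i1 /= ip.
have bid : bij (idl Y) by split=> [x y //|y]; exists y.
have [YW|nYW] := pselect (direct_summand Y W).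
  have [W' iW] := summand_compl YW; exists W'; split=> //.
  have [h [h' [hK h'K]]] := iW.
  pose toN := prodl (idl S) (compl h (inll W' Y)).
  pose ofN := prodl (idl S) (compl (fstl W' Y) h').
  pose q := compl (sndl W' Y) (compl h' (sndl S W)).
  pose io := compl (inrl S W) (compl h (inrl W' Y)).
  have dec x : x = toN (ofN x) + io (q x).
    case: x => s w; rewrite /toN /ofN /io /q /=; congr (_, _); first by rewrite addr0.
    have E : h' w = ((h' w).1, 0) + (0, (h' w).2).
      by case: (h' w) => a b; congr (_, _); rewrite /= ?addr0 ?add0r.
    by rewrite -[LHS]h'K {1}E linearD.
  have [|H|H] := @bij_sum Y fY indY (compl (compl p1 toN) (compl ofN i1)) (compl (compl p1 io) (compl q i1)) (idl Y) bid.
  - by move=> x /=; rewrite -[LHS]p1i1 {1}[i1 x]dec linearD.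
  - exact: (summand_bij H).
  have [|H'|H'] := @bij_sum Y fY indY (compl (compl p2 toN) (compl ofN i2)) (compl (compl p2 io) (compl q i2)) (idl Y) bid.
  - by move=> x /=; rewrite -[LHS]p2i2 {1}[i2 x]dec linearD.
  - exact: (summand_bij H').
  (* Both copies map isomorphically to the summand [Y] of [W]. As p2 i1 = 0, its part through S * W'
     is minus a bijection, so [Y] splits off S * W'. *)
  have bq : bij (compl q i1).
    by apply: inj_endo_bij => // x y E; case: H => inj _; apply: inj; exact: (congr1 (compl p1 io) E).
  have bq2 : bij (compl q i2).
    by apply: inj_endo_bij => // x y E; case: H' => inj _; apply: inj; exact: (congr1 (compl p2 io) E).
  have [c [cK Kc bc]] := bijK bq2.
  have bp : bij (compl p2 io).
    by apply: bij_ext (bij_compl bc H') => x; apply: (congr1 (compl p2 io) (Kc x)).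
  apply: (@summand_bij Y _ (compl ofN i1) (oppl (compl p2 toN))).
  apply: bij_ext (bij_compl bq bp) => x /=.
  by have := p2i1 x; rewrite {1}[i1 x]dec linearD => /eqP; rewrite addrC addr_eq0 => /eqP.
(* No bijection of [Y] factors through [W], so the 2 by 2 matrix of maps through [S] has bijective
   diagonal and [P1 S2] is not bijective. Elimination then exhibits [Y * Y] as a summand of [S]. *)
case: nYS.
pose S1 := compl (fstl S W) i1; pose S2 := compl (fstl S W) i2.
pose P1 := compl p1 (inll S W); pose P2 := compl p2 (inll S W).
pose W1 := compl (sndl S W) i1; pose W2 := compl (sndl S W) i2.
pose Q1 := compl p1 (inrl S W); pose Q2 := compl p2 (inrl S W).
have nr (a : {linear Y -> W}) (b : {linear W -> Y}) : ~ bij (compl b a).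
  by move=> H; apply: nYW; apply: (summand_bij H).
have dec x : x = (x.1, 0) + (0, x.2) :> (S * W)%type.
  by rewrite [LHS]surjective_pairing; congr (_, _); rewrite /= ?addr0 ?add0r.
have m11 x : P1 (S1 x) + Q1 (W1 x) = x by rewrite -[RHS]p1i1 [i1 x in RHS]dec linearD.
have m22 x : P2 (S2 x) + Q2 (W2 x) = x by rewrite -[RHS]p2i2 [i2 x in RHS]dec linearD.
have m12 x : P1 (S2 x) + Q1 (W2 x) = 0 by rewrite -[RHS](p1i2 x) [i2 x in RHS]dec linearD.
have b11 : bij (compl P1 S1).
  have [|//|/nr //] := @bij_sum Y fY indY (compl P1 S1) (compl Q1 W1) (idl Y) bid.
  by move=> x; apply/esym/m11.
have b22 : bij (compl P2 S2).
  have [|//|/nr //] := @bij_sum Y fY indY (compl P2 S2) (compl Q2 W2) (idl Y) bid.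
  by move=> x; apply/esym/m22.
have [c [cK Kc bc]] := bijK b11.
pose I2 := addl S2 (oppl (compl S1 (compl c (compl P1 S2)))).
have P1I2 x : P1 (I2 x) = 0.
  have P1S1c y : P1 (S1 (c y)) = y by exact: Kc.
  by rewrite -[LHS]/(P1 (S2 x - S1 (c (P1 (S2 x))))) linearB P1S1c subrr.
have b2 : bij (compl P2 I2).
  have [|//|H] := @bij_sum Y fY indY (compl P2 I2) (compl P2 (compl S1 (compl c (compl P1 S2)))) (compl P2 S2) b22.
    move=> x; rewrite -[LHS]/(P2 (S2 x)) -[RHS]/(P2 (I2 x) + P2 (S1 (c (P1 (S2 x))))) -linearD.
    by congr (P2 _); apply/esym/subrK.
  have b12 : bij (compl P1 S2).
    apply: inj_endo_bij => // x y E; case: H => inj _; apply: inj.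
    exact: (congr1 (compl P2 (compl S1 c)) E).
  case: (nr W2 (oppl Q1)); apply: bij_ext b12 => x.
  by apply/eqP; rewrite -[compl P1 S2 x]/(P1 (S2 x)) -[compl _ W2 x]/(- Q1 (W2 x)) -addr_eq0 m12.
have [d [dK Kd bd]] := bijK b2.
pose P2' := compl d (addl P2 (oppl (compl P2 (compl S1 (compl c P1))))).
have P1S1 x : c (P1 (S1 x)) = x by exact: cK.
have P2'I2 y : P2' (I2 y) = y.
  rewrite -[LHS]/(d (P2 (I2 y) - P2 (S1 (c (P1 (I2 y)))))) P1I2 !linear0 ?subr0 ?addr0.
  exact: dK.
have P2'S1 x : P2' (S1 x) = 0.
  by rewrite -[LHS]/(d (P2 (S1 x) - P2 (S1 (c (P1 (S1 x)))))) P1S1 subrr linear0.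
exists (copairl S1 I2), (pairl (compl c P1) P2') => -[x y].
have E1 : P1 (S1 x + I2 y) = P1 (S1 x) by rewrite linearD P1I2 addr0.
have E2 : P2' (S1 x + I2 y) = y by rewrite linearD P2'S1 P2'I2 add0r.
by rewrite -[LHS]/(c (P1 (S1 x + I2 y)), P2' (S1 x + I2 y)) E1 E2 P1S1.
Qed.

Lemma add_trans T T' X : add_closure T X -> add_closure T' T -> add_closure T' X.
Proof.
move=> [n XT] T'T; apply: add_summand XT _.
elim: n => [|n IH]; first exact/add_zero/zero_pow0.
apply: add_summand (iso_summand (iso_sym (pow_add_iso 1 n T))) _; apply: add_prod IH.
exact: add_summand (iso_summand (iso_sym (pow1_iso T))) T'T.
Qed.

Lemma summand_add T X : direct_summand X T -> add_closure T X.
Proof. by move=> XT; apply: add_summand XT (add_self T). Qed.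

Lemma len_summand n X Z Y : lmod_iso (Z * X)%type Y -> ~ zero_mod X -> len n.+1 Y -> len n Z.
Proof.
move=> [h [h' [hK h'K]]] nX H; pose j := compl h (inll Z X).
have jj : injective j by move=> x y /(can_inj hK) [].
apply: (@lenle_add R Z Y j 0 n) => //.
  by move=> x [_]; rewrite -(linear0 j) => /jj.
apply: lenle_sub (H (fun y => exists x, j x = y) (im_submod j) _ _) => //.
  by move=> y [x [_ <-]]; exists x.
have [x nx] : exists x : X, x <> 0.
  by apply: contrapT => Hx; apply: nX => x; apply: contrapT => nx; apply: Hx; exists x.
exists (h (0, x)); split=> // -[z] /(can_inj hK) [_ E].
exact: nx.
Qed.

Lemma prod_mono S W X Z : lmod_iso (X * Z)%type W ->
  add_closure (S * X)%type (S * Z)%type -> add_closure (S * X)%type (S * W)%type.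
Proof.
move=> iW H; have [h [h' [hK h'K]]] := iW.
apply: add_prod; first exact/summand_add/summand_prodl.
apply: add_summand (iso_summand (iso_sym iW)) _; apply: add_prod.
  exact/summand_add/summand_prodr.
exact: add_summand (summand_prodr S Z) H.
Qed.

(** Repeated summands are removed from [W] only, so that [S] survives whole. Each removal shortens
    [W], and the removed copy is still a summand of what remains. *)
Lemma basic_complement S W : fin_len S -> fin_len W -> basic_mod S ->
  exists W', [/\ basic_mod (S * W')%type, direct_summand W' W & add_closure (S * W')%type (S * W)%type].
Proof.
move=> fS [n Hn] bS; elim: n W Hn => [|n IH] W Hn.
  exists W; split; [|exact/iso_summand/iso_refl|exact: add_self].
  move=> Y indY [i [p ip]]; apply: (bS Y indY).
  exists (compl (fstl S W) i), (compl p (inll S W)) => x /=.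
  rewrite -[RHS]ip; congr (p _); rewrite [RHS]surjective_pairing; congr (_, _).
  by rewrite (Hn (i x).2).
have [bW|nb] := pselect (basic_mod (S * W)%type).
  by exists W; split; [|exact/iso_summand/iso_refl|exact: add_self].
have [Y [indY YY]] : exists Y, indecomposable Y /\ direct_summand (Y * Y)%type (S * W)%type.
  by apply: contrapT => H; apply: nb => Y indY YY; apply: H; exists Y.
have fSW : fin_len (S * W)%type by apply: fin_len_prod => //; exists n.+1.
have [W1 [iW YS]] := drop_copy fSW indY YY (bS Y indY).
have [nY _] := indY.
have [W' [bW' W'W1 aW']] := IH W1 (len_summand iW nY Hn).
exists W'; split=> //.
  by apply: summand_trans W'W1 _; apply: summand_trans (summand_prodl W1 Y) (iso_summand iW).
apply: add_trans aW'; apply: (prod_mono iW); apply: add_prod.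
  exact/summand_add/summand_prodl.
exact: summand_add.
Qed.

End KrullSchmidt.

Section Decomposition.
Variable R : nzRingType.
Implicit Types X Y Z W : lmodType R.

Lemma krull_decomp X : fin_len X -> exists (I : finType) (V : I -> lmodType R)
    (i : forall j, {linear V j -> X}) (p : forall j, {linear X -> V j}),
  [/\ forall j, indecomposable (V j), forall j, cancel (i j) (p j),
      forall j k x, j != k -> p k (i j x) = 0 & forall x, x = \sum_j i j (p j x)].
Proof.
move=> [n]; elim: n X => [|n IH] X Hn.
  exists void, (fun v : void => match v with end), (fun v : void => match v with end), (fun v : void => match v with end).
  by split=> // x; rewrite (Hn x) // big_pred0.
have [X0|nX] := pselect (zero_mod X).
  exists void, (fun v : void => match v with end), (fun v : void => match v with end), (fun v : void => match v with end).
  by split=> // x; rewrite (X0 x) // big_pred0.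
have [indX|nind] := pselect (indecomposable X).
  exists unit, (fun _ => X), (fun _ => idl X), (fun _ => idl X); split=> [//|//|[] [] //|x].
  by rewrite (big_pred1 tt) // => -[].
have [U [W [iX [nU nW]]]] : exists U W : lmodType R,
    lmod_iso X (U * W)%type /\ (~ zero_mod U /\ ~ zero_mod W).
  apply: contrapT => H; apply: nind; split=> // U W iX.
  have [U0|nU] := pselect (zero_mod U); first by left.
  by right; apply: contrapT => nW; apply: H; exists U, W.
have [h [h' [hK h'K]]] := iX.
have lU : len n U by apply: (len_summand (iso_sym iX) nW Hn).
have sw : lmod_iso (W * U)%type X.
  apply: iso_trans (iso_sym iX).
  by exists (pairl (sndl W U) (fstl W U)), (pairl (sndl U W) (fstl U W)); split=> -[].
have lW : len n W := len_summand sw nU Hn.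
have [I1 [V1 [i1 [p1 [ind1 ip1 o1 s1]]]]] := IH U lU.
have [I2 [V2 [i2 [p2 [ind2 ip2 o2 s2]]]]] := IH W lW.
pose V (j : I1 + I2) := match j with inl a => V1 a | inr b => V2 b end.
pose i (j : I1 + I2) : {linear V j -> X} := match j return {linear V j -> X} with
  | inl a => compl h' (compl (inll U W) (i1 a)) | inr b => compl h' (compl (inrl U W) (i2 b)) end.
pose p (j : I1 + I2) : {linear X -> V j} := match j return {linear X -> V j} with
  | inl a => compl (p1 a) (compl (fstl U W) h) | inr b => compl (p2 b) (compl (sndl U W) h) end.
exists (I1 + I2)%type, V, i, p; split.
- by case=> a; [apply: ind1 | apply: ind2].
- by case=> a x /=; rewrite h'K /=; [apply: ip1 | apply: ip2].
- case=> a [] b x ab /=; rewrite h'K /= ?linear0 //; [apply: o1 | apply: o2];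
    by apply: contra ab => /eqP ->.
move=> x; rewrite big_sumType /= -!linear_sum -linearD -[LHS]hK; congr (h' _).
have E : h x = ((h x).1, 0) + (0, (h x).2).
  by case: (h x) => a b; congr (_, _); rewrite /= ?addr0 ?add0r.
rewrite {1}E {1}[(h x).1]s1 {1}[(h x).2]s2 [X in (X, 0)]/=.
rewrite -[(_, 0)]/(inll U W _) -[(0, _)]/(inrl U W _) !linear_sum //.
Qed.

End Decomposition.

(** * Basic rings *)

Section QuotientRing.
Variable R : nzRingType.

Record ideal2 := Ideal2 {
  ideal2_sub :> submodT R^o;
  ideal2_mulr : forall x y : R, ideal2_sub x -> ideal2_sub (x * y);
  ideal2_proper : ~ ideal2_sub (1 : R) }.

Variable M : ideal2.
Definition quot_ring : Type := quot_mod M.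
HB.instance Definition _ := GRing.Zmodule.copy quot_ring (quot_mod M).
Definition qr (x : R) : quot_ring := qcl M (x : R^o).
Definition qr_mul (x y : quot_ring) : quot_ring := qr ((val x : R) * (val y : R)).

Lemma qrK (x : quot_ring) : qr (val x) = x. Proof. exact: qclK. Qed.
Lemma qr_eq x y : M (x - y) <-> qr x = qr y.
Proof. by split=> [|E]; [apply: qcl_eq | apply: (qcl_inj E)]. Qed.
Lemma qrD x y : qr (x + y) = qr x + qr y.
Proof. by have := linearD (qproj M) (x : R^o) (y : R^o). Qed.
Lemma qrM x y : qr (x * y) = qr_mul (qr x) (qr y).
Proof.
apply/qr_eq; have Hx := crepP M (x : R^o); have Hy := crepP M (y : R^o).
have -> : x * y - crep M (x : R^o) * crep M (y : R^o) =
  (x - crep M (x : R^o)) * y + (crep M (x : R^o) : R) * (y - crep M (y : R^o)).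
  by rewrite mulrBl mulrBr addrA subrK.
apply: submodD; first exact: ideal2_mulr.
exact: (submodZ (S := M) (crep M (x : R^o) : R) Hy).
Qed.

Fact qr_mulA : associative qr_mul.
Proof. by move=> x y z; rewrite -[x]qrK -[y]qrK -[z]qrK -!qrM mulrA. Qed.
Fact qr_mul1 : left_id (qr 1) qr_mul.
Proof. by move=> x; rewrite -[x]qrK -qrM mul1r. Qed.
Fact qr_mulr1 : right_id (qr 1) qr_mul.
Proof. by move=> x; rewrite -[x]qrK -qrM mulr1. Qed.
Fact qr_mulDl : left_distributive qr_mul +%R.
Proof. by move=> x y z; rewrite -[x]qrK -[y]qrK -[z]qrK -qrD -!qrM mulrDl qrD. Qed.
Fact qr_mulDr : right_distributive qr_mul +%R.
Proof. by move=> x y z; rewrite -[x]qrK -[y]qrK -[z]qrK -qrD -!qrM mulrDr qrD. Qed.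
Fact qr_1n0 : qr 1 != 0.
Proof.
apply/eqP => E; apply: (ideal2_proper (i := M)); rewrite -[1]subr0; apply/qr_eq.
by rewrite E; apply/esym/(linear0 (qproj M)).
Qed.
HB.instance Definition _ := GRing.Zmodule_isNzRing.Build quot_ring
  qr_mulA qr_mul1 qr_mulr1 qr_mulDl qr_mulDr qr_1n0.

Fact qr_zmod : zmod_morphism qr.
Proof. by move=> x y; have := linearB (qproj M) (x : R^o) (y : R^o). Qed.
Fact qr_monoid : monoid_morphism qr.
Proof. by split=> // x y; apply: qrM. Qed.
HB.instance Definition _ := GRing.isZmodMorphism.Build R quot_ring qr qr_zmod.
HB.instance Definition _ := GRing.isMonoidMorphism.Build R quot_ring qr qr_monoid.
Definition qrm : {rmorphism R -> quot_ring} := qr.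

Lemma qr0 x : qr x = 0 <-> M x.
Proof.
rewrite -[x in M x]subr0; apply: iff_trans (iff_sym (qr_eq _ _)).
by rewrite -[qr 0]/(qrm 0) rmorph0.
Qed.

End QuotientRing.

Section BasicRings.

Lemma left_idealP (R : nzRingType) (I : R -> Prop) : left_ideal I <-> submod (I : R^o -> Prop).
Proof.
split=> [[I0 ID IM]|[I0 ID]]; first by split=> // a x y Ix Iy; apply: ID Iy; apply: IM.
split=> // [x y Ix Iy|a x Ix]; first by rewrite -[x]mul1r; apply: (ID 1).
by rewrite -[_ * _]addr0; apply: (ID a).
Qed.

(** If [a] is in the kernel but not in the maximal left ideal [I], then 1 = y + r a with [y] in [I],
    although y = 1 - r a has a left inverse. Conversely, the kernel of each [pi i] is a maximal left
    ideal. *)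
Lemma basic_ringI (R : nzRingType) n (D : 'I_n -> nzRingType) (pi : forall i, {rmorphism R -> D i}) :
  (forall i, division_ring (D i)) ->
  (forall d : (forall i, D i), exists a : R, forall i, pi i a = d i) ->
  (forall a, (forall i, pi i a = 0) -> exists b, b * (1 - a) = 1) -> basic_ring R.
Proof.
move=> div sur inv; exists n, D, pi; split=> // a; split=> [a0 I [[I0 ID IM] I1 Imax]|Ja i].
  apply: contrapT => nIa; pose J x := exists y r, I y /\ x = y + r * a.
  have lJ : left_ideal J.
    split.
    - by exists 0, 0; rewrite mul0r addr0.
    - move=> _ _ [y [r [Iy ->]]] [y' [r' [Iy' ->]]]; exists (y + y'), (r + r').
      by rewrite mulrDl addrACA; split=> //; apply: ID.
    - move=> s _ [y [r [Iy ->]]]; exists (s * y), (s * r).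
      by rewrite mulrDr mulrA; split=> //; apply: IM.
  have [J1|nJ1] := pselect (J 1).
    have [y [r [Iy E]]] := J1.
    have [|b Hb] := inv (r * a); first by move=> i; rewrite rmorphM a0 mulr0.
    by apply: I1; rewrite -Hb {1}E addrK; apply: IM.
  apply: nIa; apply: (Imax J lJ nJ1); last by exists 0, 1; rewrite mul1r add0r.
  by move=> x Ix; exists x, 0; rewrite mul0r addr0.
apply: (Ja (fun x => pi i x = 0)); split.
- split=> [|x y Hx Hy|b x Hx]; rewrite ?rmorph0 // ?rmorphD ?rmorphM ?Hx ?Hy ?addr0 ?mulr0 //.
- by rewrite rmorph1; apply/eqP/oner_neq0.
move=> J [J0 JD JM] J1 HJ x Jx; apply: contrapT => nx.
have [y [_ yx]] := div i _ nx.
have [r Hr] := sur (dfwith (fun j => 0 : D j) y).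
apply: J1; rewrite -[1](subrK (r * x)); apply: JD; last exact: JM.
by apply: HJ; rewrite rmorphB rmorph1 rmorphM Hr dfwith_in yx subrr.
Qed.

(** Otherwise the left ideal generated by 1 - a' would lie in a maximal one, which finite length
    provides. The left inverse [b] is again 1 minus a radical element, hence left invertible, and so
    the inverse is two-sided. *)
Lemma jacobson_inv (R : nzRingType) (a : R) : fin_len R^o -> jacobson_radical a ->
  exists b, b * (1 - a) = 1 /\ (1 - a) * b = 1.
Proof.
move=> fR Ja; have linv a' : jacobson_radical a' -> exists b : R, b * (1 - a') = 1.
  move=> Ja'; apply: contrapT => nb.
  pose Q (S : R^o -> Prop) := submod S /\ ((forall b : R, S (b * (1 - a'))) /\ ~ S (1 : R)).
  have [||S [[smS [Sb nS1]] Smax]] := @fin_len_max _ R^o Q (fun x => exists b : R, x = b * (1 - a')) fR.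
  - split; last first.
      by split=> [b|[b E]]; [exists b | apply: nb; exists b].
    split=> [|c x y [b ->] [b' ->]]; first by exists 0; rewrite mul0r.
    by exists (c * b + b'); rewrite mulrDl -mulrA.
  - by move=> S [].
  have Sa : S a'.
    apply: Ja'; split=> //; first exact/left_idealP.
    move=> J /left_idealP lJ nJ1 SJ; apply: Smax => //; split=> //; split=> // b.
    exact: SJ.
  by apply: nS1; have := smS.2 1 _ _ (Sb 1) Sa; rewrite scale1r mul1r subrK.
have [b Hb] := linv a Ja; exists b; split=> //.
have Jba : jacobson_radical (- (b * a)).
  by move=> I mI; have [[I0 ID IM] _ _] := mI; rewrite -mulNr; apply: IM; apply: Ja.
have [c Hc] := linv _ Jba.
have Eb : 1 - - (b * a) = b by rewrite opprK -{1}Hb mulrBr mulr1 subrK.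
have cb : c * b = 1 by rewrite -Hc Eb.
have Ec : c = 1 - a by have := congr1 (fun x => x * (1 - a)) cb; rewrite -mulrA Hb mulr1 mul1r.
by rewrite -Ec.
Qed.

(** Two-sided inverses make the criterion of [basic_ringI] left-right symmetric. *)
Lemma basic_ring_converse (R : nzRingType) : fin_len (R^c : nzRingType)^o -> basic_ring R^c -> basic_ring R.
Proof.
move=> fR [n [D [pi [div sur ker]]]].
pose pi' i : {rmorphism R -> (D i)^c} :=
  HB.pack (pi i : R -> (D i)^c) (GRing.isZmodMorphism.Build R (D i)^c (pi i) (rmorphB (pi i)))
   (GRing.isMonoidMorphism.Build R (D i)^c (pi i) (conj (rmorph1 (pi i)) (fun x y => rmorphM (pi i) y x))).
apply: (@basic_ringI R n (fun i => (D i)^c) pi').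
- by move=> i x nx; have [y [xy yx]] := div i x nx; exists y.
- by move=> d; have [a Ha] := sur d; exists a.
move=> a a0; have Ja : @jacobson_radical R^c a by apply/ker.
by have [b [_ Hb]] := jacobson_inv fR Ja; exists b.
Qed.

End BasicRings.

(** * Endomorphism rings of basic modules *)

Section BasicEndo.
Variables (R D : nzRingType) (U : lmodType R) (phi : endo_iso D U).
Hypotheses (fU : fin_len U) (bU : basic_mod U).

(** The summands [V j] are pairwise non-isomorphic, so no bijection of one factors through another.
    Endomorphisms whose j-th diagonal entry is not bijective therefore form an ideal with division
    quotient, and those lying in all these ideals are nilpotent. *)
Lemma basic_endo : basic_ring D.
Proof.
have [I [V [i [p [ind ip orth dec]]]]] := krull_decomp fU.
have fV j : fin_len (V j) by apply: fin_len_inj (can_inj (ip j)) fU.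
have bid (Y : lmodType R) : bij (idl Y) by split=> [x y //|y]; exists y.
have cross j k (a : {linear V j -> V k}) (b : {linear V k -> V j}) : j != k -> ~ bij (compl b a).
  move=> jk /bijK [c [cK _ _]]; apply: (bU (ind j)).
  exists (copairl (i j) (compl (i k) a)), (pairl (p j) (compl (compl c b) (p k))).
  move=> [x y] /=; rewrite !linearD ip (orth k j) 1?eq_sym // addr0; congr (_, _).
  rewrite (orth j k) // ip !linear0 add0r; exact: cK.
pose m j k (d : D) : {linear V j -> V k} := compl (p k) (compl (phi d) (i j)).
have mM j l a b x : m j l (a * b) x = \sum_k m k l a (m j k b x).
  by rewrite /m /= phM {1}[phi b _]dec !linear_sum.
pose M j (d : D) := ~ bij (m j j d).
(* Terms of the matrix product passing through [V k] with k <> j are never bijective, so only the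
   product of the diagonal entries counts. *)
have bijM j a b : bij (m j j (a * b)) <-> bij (m j j a) /\ bij (m j j b).
  have comp_bij k (f g : {linear V k -> V k}) : bij (compl f g) -> bij f /\ bij g.
    move=> H; have bg : bij g.
      apply: (inj_endo_bij (fV k)) => x y E; case: H => inj _; apply: inj.
      exact: (congr1 f E).
    split=> //; have [c [cK Kc bc]] := bijK bg.
    by apply: bij_ext (bij_compl bc H) => x /=; rewrite Kc.
  split=> [H|[Ha Hb]].
    have [k Hk] := @bij_bigsum R _ (fV j) (ind j) I (fun k => compl (m k j a) (m j k b)) _ H (mM j j a b).
    have [Ejk|njk] := eqVneq j k; last by case: (cross j k (m j k b) (m k j a) njk Hk).
    by subst k; apply: comp_bij.
  pose rest := \sum_(k | k != j) (compl (m k j a) (m j k b) : homT (V j) (V j)).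
  have restE x : (rest : {linear V j -> V j}) x = \sum_(k | k != j) m k j a (m j k b x).
    rewrite /rest; elim/big_rec2: _ => //= k y f _ <- //.
  have [|//|H] := @bij_sum R _ (fV j) (ind j) (m j j (a * b)) (oppl rest) (compl (m j j a) (m j j b)) (bij_compl Hb Ha).
    by move=> x; rewrite mM (bigD1 j) //= restE addrK.
  have rl (k : I) : linear (fun x => if k != j then m k j a (m j k b x) else 0).
    by move=> c x y; case: (k != j); rewrite ?scaler0 ?addr0 // !linearP.
  have bR : bij (rest : {linear V j -> V j}).
    have [h [hK Kh bh]] := bijK H.
    by apply: (inj_endo_bij (fV j)) => x y E; case: H => inj _; apply: inj; rewrite /= E.
  have [F FE] : exists F : I -> {linear V j -> V j}, forall k x,
      F k x = if k != j then m k j a (m j k b x) else 0.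
    by exists (fun k => lin_of (rl k)).
  have [|k Hk] := @bij_bigsum R _ (fV j) (ind j) I F _ bR.
    by move=> x; rewrite restE big_mkcond; apply: eq_bigr => k _; rewrite FE.
  have [Ekj|nkj] := eqVneq k j.
    by case: (@not_bij0 R _ (ind j) (F k)) => // x; rewrite FE Ekj eqxx.
  case: (cross j k (m j k b) (m k j a)); first by rewrite eq_sym.
  by apply: bij_ext Hk => x; rewrite FE nkj.
have MD j x y : M j x -> M j y -> M j (x + y).
  move=> Mx My Hxy; have [||] := @bij_sum R _ (fV j) (ind j) (m j j x) (m j j y) _ Hxy => //.
  by move=> z; rewrite /m /= phD linearD.
have M0 j : M j 0.
  by apply: (not_bij0 (ind j)) => x; rewrite /m /= ph0 linear0.
have MsubP j : submod (M j : D^o -> Prop).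
  split; first exact: M0.
  by move=> a x y Mx My; apply: MD => // /bijM [_].
have HM j : exists T : ideal2 D, forall x, T x <-> M j x.
  unshelve eexists (@Ideal2 D (SubmodT (MsubP j)) _ _) => //.
    by move=> x y Mx /bijM [Hx _]; apply: Mx.
  by apply; apply: bij_ext (bid _) => x; rewrite /m /= ph1 ip.
have [Mj HMj] := choice HM.
have phB (x y : D) t : phi (x - y) t = phi x t - phi y t.
  by apply/eqP; rewrite eq_sym subr_eq -phD subrK.
pose e j : I := enum_val (A := predT) (j : 'I_#|I|).
apply: (@basic_ringI D #|I| (fun j => quot_ring (Mj (e j))) (fun j => qrm (Mj (e j)))).
- move=> j x nx; have [d Ed] : exists d, x = qr (Mj (e j)) d by exists (val x); rewrite qrK.
  rewrite Ed in nx *.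
  have bd : bij (m (e j) (e j) d) by apply: contrapT => H; apply: nx; apply/qr0/HMj.
  have [c [cK Kc bc]] := bijK bd.
  have [d' Hd'] := ph_surj phi (compl (i (e j)) (compl c (p (e j)))).
  exists (qr (Mj (e j)) d'); split.
    apply: etrans (esym (qrM _ _ _)) _; apply/qr_eq/HMj/(not_bij0 (ind (e j))) => y.
    rewrite /m /= phB phM ph1 linearB Hd' /= ip.
    by rewrite -[p _ (phi d _)]/(m (e j) (e j) d (c y)) Kc subrr.
  apply: etrans (esym (qrM _ _ _)) _; apply/qr_eq/HMj/(not_bij0 (ind (e j))) => y.
  rewrite /m /= phB phM ph1 linearB Hd' /= !ip.
  by rewrite -[p _ (phi d _)]/(m (e j) (e j) d y) cK subrr.
- move=> d; pose r k : D := val (d (enum_rank k)).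
  have lr : linear (fun u => \sum_k i k (m k k (r k) (p k u))).
    move=> c x y; rewrite scaler_sumr -big_split; apply: eq_bigr => k _.
    by rewrite /= !linearP.
  have [a Ha] := ph_surj phi (lin_of lr); exists a => j.
  rewrite -[d j]qrK; apply/qr_eq/HMj/(not_bij0 (ind (e j))) => y.
  have <- : r (e j) = val (d j).
    have H l : l = j -> (val (d l) : D) = val (d j) by move=> ->.
    by apply: H; apply: enum_valK.
  rewrite /m /= phB Ha /= linearB (bigD1 (e j)) //= big1 ?addr0.
    by rewrite !ip subrr.
  by move=> k nk; rewrite (orth (e j) k) 1?eq_sym // !linear0.
move=> a a0.
have Ma k : M k a.
  have := a0 (enum_rank k); move/qr0/HMj; rewrite /e enum_rankK //.
have [n [Z [W [k [v [bkv kn [g [h [fv gh hg]]]]]]]]] := fitting (phi a) fU.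
have W0 : zero_mod W.
  apply: contrapT => nW.
  have fW : fin_len W.
    apply: (@fin_len_inj _ _ _ v _ fU) => x y E; case: bkv => inj _.
    by have /inj [] : copairl k v (0, x) = copairl k v (0, y) by rewrite /= linear0 E.
  have [J [V' [i' [p' [ind' ip' _ dec']]]]] := krull_decomp fW.
  have [j0 _] : exists j : J, True.
    by apply: contrapT => H; apply: nW => x; rewrite [x]dec' big1 // => j _; case: H; exists j.
  have fY : fin_len (V' j0) by apply: fin_len_inj (can_inj (ip' j0)) fW.
  have [s [sK Ks _]] := bijK bkv.
  pose al := compl v (i' j0); pose be := compl (p' j0) (compl h (compl (sndl Z W) s)).
  have sv w : s (v w) = (0, w).
    by rewrite -[RHS]sK /= linear0 add0r.
  have bfa x : x = be (phi a (al x)) by rewrite /be /al /= fv sv /= gh ip'.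
  pose t (kl : I * I) := compl (compl be (i kl.1)) (compl (m kl.2 kl.1 a) (compl (p kl.2) al)).
  have [|[k1 l1] H] := @bij_bigsum R _ fY (ind' j0) (I * I)%type t _ (bid _).
    move=> x; have -> : \sum_kl t kl x = \sum_k \sum_l t (k, l) x.
      by rewrite pair_bigA; apply: eq_bigr => -[].
    rewrite -[LHS]/x [LHS]bfa [phi a _]dec linear_sum; apply: eq_bigr => k1 _.
    rewrite {1}[al x]dec !linear_sum; apply: eq_bigr => l1 _.
    by [].
  rewrite /t /= in H; have [c [cK Kc bc]] := bijK H.
  (* One path through a matrix entry of [a] is bijective on a summand of the part where [a] is
     invertible. So [e'] fixes the nonzero image of [a'] and is not nilpotent; being bijective, it
     contradicts [cross] off the diagonal and [Ma] on it. *)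
  pose a' := compl (p l1) al; pose b' := compl be (i k1).
  pose e' := compl (compl a' (compl c b')) (m l1 k1 a).
  have Ee z : e' (a' z) = a' z by rewrite -[RHS](congr1 a' (cK z)).
  have [be'|[n' Hn']] := endo_dich e' (fV l1) (ind l1).
    have [El|nl] := eqVneq l1 k1; last exact: (cross l1 k1 (m l1 k1 a) (compl a' (compl c b')) nl be').
    subst k1; apply: (Ma l1); apply: (inj_endo_bij (fV l1)) => x y E.
    by case: be' => inj _; apply: inj; apply: (congr1 (compl a' (compl c b')) E).
  have a'0 z : a' z = 0.
    by rewrite -(Hn' (a' z)); elim: (n') => // n1 IH; rewrite iterS -IH; apply/esym/Ee.
  apply: (not_bij0 (ind' j0) _ H) => z.
  by rewrite -[LHS]/(b' (m l1 k1 a (a' z))) a'0 !linear0.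
have an x : iter n (phi a) x = 0.
  have [_ sj] := bkv; have [[z w] <-] := sj x.
  by rewrite /= (W0 w) linear0 addr0 kn.
have b1 : bij (phi (1 - a)).
  by apply: bij_1sub fU an _ => x; rewrite phB ph1.
have [f' [f'K Kf' _]] := bijK b1; have [d Hd] := ph_surj phi f'.
by exists d; apply: (ph_inj (e := phi)) => u; rewrite phM Hd f'K ph1.
Qed.

End BasicEndo.

(** * Coinduction and basic modules *)

Section CoinducedBasic.
Variables (A R : nzRingType) (io : nuhom A R).
Hypothesis fc : full_corner io.
Local Notation cor X := (corner_mod io X : lmodType A).
Local Notation G Z := (coind_mod io Z : lmodType R).

Lemma G_zero (V : lmodType A) : zero_mod V -> zero_mod (G V).
Proof. by move=> V0 h; apply: G_eq => y; rewrite (V0 (unG h y)) (V0 (unG 0 y)). Qed.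

Lemma G_prod (V W : lmodType A) : lmod_iso (G (V * W)%type) (G V * G W)%type.
Proof.
apply: (@iso_of_bij _ _ _ (pairl (Gl io (fstl V W)) (Gl io (sndl V W)) : {linear G (V * W)%type -> (G V * G W)%type})).
  move=> h h' E; apply: G_eq => y.
  have /= F1 := congr1 (fun u : G V * G W => unG u.1 y) E.
  have /= F2 := congr1 (fun u : G V * G W => unG u.2 y) E.
  by rewrite [LHS]surjective_pairing [RHS]surjective_pairing F1 F2.
by move=> [h h']; exists (pairl (unG h) (unG h') : G _); congr (_, _); apply: G_eq.
Qed.

Lemma G_iso (V W : lmodType A) : lmod_iso V W -> lmod_iso (G V) (G W).
Proof.
move=> [f [g [fK gK]]]; exists (Gl io f), (Gl io g).
by split=> h; apply: G_eq => y; rewrite !GlE ?fK ?gK.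
Qed.

Lemma cor_prod (X Y : lmodType R) : lmod_iso (cor (X * Y)%type) (cor X * cor Y)%type.
Proof.
apply: (@iso_of_bij _ _ _ (pairl (corl io (fstl X Y)) (corl io (sndl X Y)))).
  move=> x y E; apply/val_inj.
  have /= E1 := congr1 (fun u : cor X * cor Y => val u.1) E.
  have /= E2 := congr1 (fun u : cor X * cor Y => val u.2) E.
  by rewrite [LHS]surjective_pairing [RHS]surjective_pairing E1 E2.
move=> [x y]; have H : io 1 *: (val x, val y) = (val x, val y) by congr (_, _); apply: corP.
by exists (to_cor H); congr (_, _); apply/val_inj.
Qed.

(** The unit is bijective on [GT], and this passes to retracts. *)
Lemma coind_summand (T : lmodType A) (Y : lmodType R) :
  direct_summand Y (G T) -> lmod_iso Y (G (cor Y)).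
Proof.
move=> [i [p ip]]; apply: (@iso_of_bij _ _ _ (unit_map io Y)).
  apply: inj0 => y y0; apply: (can_inj ip); rewrite linear0; apply: G_eq => x.
  rewrite -(coadjK i) adjE.
  have -> : act x y = 0 by have := congr1 (fun h => unG h x) y0.
  exact: linear0.
move=> h; pose g : G T := Gl io (coadj i) h; exists (p g); apply: G_eq => x.
rewrite [LHS]adjE; have E : act x g = corl io i (unG h x).
  apply: (counit_inj fc); rewrite -[RHS]/(unG g x) -[LHS]/(unG (val x *: g) (eR1 io)) G_scaleE.
  by congr (unG g _); apply/val_inj; apply: (corP x).
have -> : act x (p g) = corl io p (act x g) by apply/val_inj; rewrite /= linearZZ.
by rewrite E; apply/val_inj; rewrite /= ip.
Qed.

Lemma coind_basic (T : lmodType A) : basic_mod T -> basic_mod (G T).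
Proof.
move=> bT Y [nY ind] YY.
have YG : direct_summand Y (G T) := summand_trans (summand_prodl Y Y) YY.
have iY := coind_summand YG.
apply: (bT (cor Y)).
  split=> [c0|U V iUV].
    apply: nY => y; have [f [g [fK gK]]] := iY.
    by rewrite -[y]fK (G_zero c0 (f y)) linear0.
  have [|GU|GV] := ind (G U) (G V).
  - exact: iso_trans iY (iso_trans (G_iso iUV) (G_prod U V)).
  - left=> u; have [f [g [fK gK]]] := cor_coind fc U.
    rewrite -[u]gK; have -> : g u = 0 by apply/val_inj/GU.
    exact: linear0.
  - right=> u; have [f [g [fK gK]]] := cor_coind fc V.
    rewrite -[u]gK; have -> : g u = 0 by apply/val_inj/GV.
    exact: linear0.
apply: summand_trans (iso_summand (iso_sym (cor_prod Y Y))) _.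
exact: summand_trans (cor_summand io YY) (iso_summand (cor_coind fc T)).
Qed.

End CoinducedBasic.

(** * Iteration of strong tilting *)

Section EndoAlgebra.
Variables (K : comNzRingType) (R : nzRingType) (th : {rmorphism K -> R}) (U : lmodType R).
Hypotheses (cR : central th) (nzU : exists u : U, u <> 0).

(* [rev] selects the opposite multiplication. *)
Definition endo_alg (rev : bool) (_ : central th) (_ : exists u : U, u <> 0) : Type := homT U U.

Section Instances.
Variable rev : bool.
Local Notation E := (endo_alg rev cR nzU).
HB.instance Definition _ := GRing.Zmodule.copy E (homT U U).
Definition ef (x : E) : {linear U -> U} := x.
Definition ea_mul (x y : E) : E := if rev then compl (ef y) (ef x) else compl (ef x) (ef y).
Definition ea_one : E := idl U.
Lemma ea_eq (x y : E) : ef x =1 ef y -> x = y. Proof. exact: lin_ext. Qed.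
Fact ea_mulA : associative ea_mul.
Proof. by move=> x y z; apply: ea_eq => u; rewrite /ea_mul; case: rev. Qed.
Fact ea_mul1 : left_id ea_one ea_mul.
Proof. by move=> x; apply: ea_eq => u; rewrite /ea_mul; case: rev. Qed.
Fact ea_mulr1 : right_id ea_one ea_mul.
Proof. by move=> x; apply: ea_eq => u; rewrite /ea_mul; case: rev. Qed.
Fact ea_mulDl : left_distributive ea_mul +%R.
Proof.
move=> x y z; apply: ea_eq => u; rewrite /ea_mul; case: rev => //.
exact: (linearD (ef z)).
Qed.
Fact ea_mulDr : right_distributive ea_mul +%R.
Proof.
move=> x y z; apply: ea_eq => u; rewrite /ea_mul; case: rev => //.
exact: (linearD (ef x)).
Qed.
Fact ea_1n0 : ea_one != 0.
Proof.
apply/eqP => E1; have [u nu] := nzU; apply: nu.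
by have := congr1 (fun x => ef x u) E1.
Qed.
HB.instance Definition _ := GRing.Zmodule_isNzRing.Build E
  ea_mulA ea_mul1 ea_mulr1 ea_mulDl ea_mulDr ea_1n0.
Fact ea_scale_linear k (x : E) : linear (fun u => th k *: ef x u).
Proof. by move=> a u v; rewrite linearP scalerDr !scalerA cR. Qed.
Definition ea_scale k (x : E) : E := lin_of (ea_scale_linear k x).
Fact ea_scaleA k l x : ea_scale k (ea_scale l x) = ea_scale (k * l) x.
Proof. by apply: ea_eq => u; rewrite /= scalerA rmorphM. Qed.
Fact ea_scale1 : left_id 1 ea_scale.
Proof. by move=> x; apply: ea_eq => u; rewrite /= rmorph1 scale1r. Qed.
Fact ea_scaleDr : right_distributive ea_scale +%R.
Proof. by move=> k x y; apply: ea_eq => u; apply: scalerDr. Qed.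
Fact ea_scaleDl x : {morph ea_scale^~ x : k l / k + l}.
Proof. by move=> k l; apply: ea_eq => u; rewrite /= rmorphD scalerDl. Qed.
HB.instance Definition _ := GRing.Zmodule_isLmodule.Build K E
  ea_scaleA ea_scale1 ea_scaleDr ea_scaleDl.
Fact ea_scaleAl (k : K) (x y : E) : k *: (x * y) = (k *: x) * y.
Proof.
apply: ea_eq => u; rewrite /GRing.mul /= /ea_mul; case: rev => //=.
by rewrite /GRing.scale /= linearZZ.
Qed.
HB.instance Definition _ := GRing.Lmodule_isLalgebra.Build K E ea_scaleAl.
Fact ea_scaleAr (k : K) (x y : E) : k *: (x * y) = x * (k *: y).
Proof.
apply: ea_eq => u; rewrite /GRing.mul /= /ea_mul; case: rev => //=.
by rewrite /GRing.scale /= linearZZ.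
Qed.
HB.instance Definition _ := GRing.Lalgebra_isAlgebra.Build K E ea_scaleAr.
End Instances.

Lemma endo_alg_iso : @iso_to_End K (endo_alg false cR nzU) R (in_alg (endo_alg false cR nzU)) th U.
Proof.
exists (@ef false); split=> //; first exact: ea_eq.
by move=> f; exists f.
Qed.

Lemma endo_alg_iso_rev : @iso_to_End K (endo_alg true cR nzU)^c R (in_alg (endo_alg true cR nzU)) th U.
Proof.
exists (@ef true); split=> //; first exact: ea_eq.
by move=> f; exists f.
Qed.

End EndoAlgebra.

(** * Left and right modules treated uniformly *)

Section Sides.
Variable K : comNzRingType.
Implicit Types A C D : algType K.

Section InAlgConverse.
Variable C : algType K.
Definition in_algc_fun : K -> C^c := in_alg C.
Fact in_algc_zmod : zmod_morphism in_algc_fun.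
Proof. by move=> x y; apply: (rmorphB (in_alg C)). Qed.
Fact in_algc_monoid : monoid_morphism in_algc_fun.
Proof.
split; first exact: (rmorph1 (in_alg C)).
move=> x y; rewrite -[RHS]/((y%:A : C) * x%:A) -[LHS]/((x * y)%:A : C).
by rewrite -scalerAl mul1r scalerA mulrC.
Qed.

Definition in_algc : {rmorphism K -> C^c} := HB.pack in_algc_fun
  (GRing.isZmodMorphism.Build K C^c in_algc_fun in_algc_zmod)
  (GRing.isMonoidMorphism.Build K C^c in_algc_fun in_algc_monoid).
End InAlgConverse.

(* Left modules over [side b C] are left (b = false) or right (b = true) C-modules. *)
Definition side (b : bool) C : nzRingType := if b then (C^c : nzRingType) else C.
Definition side_alg b C : {rmorphism K -> side b C} :=
  match b return {rmorphism K -> side b C} with true => in_algc C | false => in_alg C end.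

Lemma side_central b C : central (side_alg b C).
Proof.
case: b => k x /=.
  by rewrite -[LHS]/((x : C) * k%:A) -[RHS]/(k%:A * (x : C)) mulr_algr mulr_algl.
by rewrite mulr_algr mulr_algl.
Qed.

Lemma side_fin b C : fin_len K^o -> (fin_gen C <-> fl (side_alg b C) (side b C)^o).
Proof.
move=> finK; suff [f bf] : exists f : {linear res_mod (side_alg b C) (side b C)^o -> C}, bij f.
  have [g [_ _ [jg _]]] := bijK bf; have [jf _] := bf; split=> [gC|flC].
    exact: fin_len_inj jf (fin_len_of_gen finK gC).
  by apply: fin_gen_of_len; apply: fin_len_inj jg flC.
case: b; last first.
  have lf : linear ((fun x => x) : res_mod (in_alg C) C^o -> C).
    by move=> k x y; congr (_ + _); apply: mulr_algl.
  by exists (lin_of lf); split=> [x y|y] //; exists y.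
have lf : linear ((fun x => x) : res_mod (in_algc C) (C^c : nzRingType)^o -> C).
  move=> k x y; congr (_ + _); rewrite -[LHS]/((x : C) * k%:A); exact: mulr_algr.
by exists (lin_of lf); split=> [x y|y] //; exists y.
Qed.

(** Endomorphisms act on the left, so End(T) is [D] on the opposite side [~~ b]; the two values of
    [b] give the two kinds of tilt. *)
Definition tilts b C D := exists T : lmodType (side b C),
  [/\ basic_mod T, strong_tilting T &
      iso_to_End (side_alg (~~ b) D) (side_alg b C) T].

(** The side matters: [good_corner] speaks of left modules over [side b], and a tilt moves it to the
    other side. *)
Definition good_pair b A C := exists io : nuhom (side b A) (side b C),
  good_corner (side_alg b A) (side_alg b C) io.

Definition good_alg C := artin_algebra C /\ basic_ring C.

Lemma endo_alg_tilts b C (U : lmodType (side b C)) : (exists u : U, u <> 0) ->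
  exists D, iso_to_End (side_alg (~~ b) D) (side_alg b C) U.
Proof.
case: b U => U nzU.
  by exists (endo_alg false (side_central (b := true) (C := C)) nzU); apply: endo_alg_iso.
by exists (endo_alg true (side_central (b := false) (C := C)) nzU); apply: endo_alg_iso_rev.
Qed.

Lemma endo_iso_of (E R : nzRingType) (eta : K -> E) (theta : K -> R) (T : lmodType R) :
  iso_to_End eta theta T -> exists phi : endo_iso E T, forall k t, phi (eta k) t = theta k *: t.
Proof. by move=> [phi [H1 H2 H3 H4 H5]]; exists (EndoIso H1 H2 H4 H5). Qed.

Lemma tilt_step b A C A' : artinian K -> good_alg A -> good_alg C -> good_pair b A C ->
  good_alg A' -> tilts b A A' ->
  exists C', [/\ good_alg C', tilts b C C' & good_pair (~~ b) A' C'].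
Proof.
move=> artK [[_ gA] bA] [[_ gC] bC] [io good] gA' [T [bT sT iT]].
have finK := artinian_fin_len artK.
have Afin := proj1 (side_fin b A finK) gA; have Cfin := proj1 (side_fin b C finK) gC.
have cA := side_central (b := b) (C := A); have cC := side_central (b := b) (C := C).
have fc : full_corner io by case: good.
have ST := STilt_of_strong Afin sT.
have [W [SW PW]] := STilt_corner good cC Afin Cfin finK cA ST.
pose GT : lmodType (side b C) := coind_mod io T.
have PGT : Pf (side_alg b C) GT by apply: (Pf_coind good cC Afin Cfin); case: ST.
(* Only [W] is thinned out, so that the projection onto [GT] still defines the corner End(T) of
   End(U). *)
have [W' [bU W'W aU]] := basic_complement (fl_fin_len PGT.1) (fl_fin_len PW.1) (coind_basic fc bT).
pose U : lmodType (side b C) := (GT * W')%type.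
have UW : direct_summand U (GT * W)%type.
  by have [i [p ip]] := W'W; exists (prodl (idl GT) i), (prodl (idl GT) p) => -[x y] /=; rewrite ip.
have [PS pS embS bdS] := SW.
have SU : STilt (side_alg b C) U.
  split.
  - exact: Pf_summand UW PS.
  - exact: perp_summand UW pS.
  - move=> X PX; have [n [f jf]] := embS X PX.
    have [m [i [p ip]]] : add_closure U {ffun 'I_n -> (GT * W)%type} := add_trans (add_pow (GT * W)%type n) aU.
    by exists m, (compl i f) => x y /= /(can_inj ip)/jf.
  exact: bdS.
have PU : Pf (side_alg b C) U by case: SU.
(* Needed for 1 <> 0 in the endomorphism ring; it holds because the ring embeds in a power of
   [U]. *)
have nzU : exists u : U, u <> 0.
  apply: contrapT => H; have U0 : zero_mod U.
    by move=> u; apply: contrapT => nu; apply: H; exists u.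
  have [_ _ emb _] := SU; have [n [f jf]] := emb _ (Pf_free Cfin 1).
  have /eqP : [ffun _ => 1] = 0 :> free_mod (side b C) 1.
    by apply: jf; apply/ffunP => i; rewrite (U0 (f _ i)) (U0 (f 0 i)).
  apply/negP/eqP => /ffunP /(_ ord0); rewrite !ffunE => /eqP.
  by rewrite oner_eq0.
have [C' iC'] := endo_alg_tilts nzU; exists C'.
have [phi Hphi] := endo_iso_of iC'; have [phA HphA] := endo_iso_of iT.
have Dfin : fl (side_alg (~~ b) C') (side (~~ b) C')^o := fl_endo Hphi Cfin PU.1.
have bD : basic_ring (side (~~ b) C') := basic_endo phi (fl_fin_len PU.1) bU.
split.
- split; first by split=> //; apply/(side_fin (~~ b) C' finK).
  (* For left modules the endomorphism ring is the converse of [C'], and basicness has to be carried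
     over to [C']. *)
  by case: (b) bD Dfin => //= bD /fl_fin_len fD; apply: basic_ring_converse.
- by exists U; split=> //; apply: (strong_of_STilt Cfin).
have [io' good'] := @tilted_corner _ _ _ _ _ io good cC Afin Cfin T U ST SU
  (inll GT W') (fstl GT W') (fun x => erefl) _ _ _ _ phA phi HphA Hphi.
by exists io'.
Qed.

(** Dependent choice along the sequence given for [A]: the state at stage i is an algebra having
    [S i] as a corner on the side set by the parity of i. *)
Lemma unlimited_of_corner A C : artinian K -> good_alg C -> good_pair false A C ->
  unlimited_strong_tilting A -> unlimited_strong_tilting C.
Proof.
move=> artK gC gAC [S [S0 gS evS odS]].
pose state i C := good_alg C /\ good_pair (odd i) (S i) C.
have tS i : tilts (odd i) (S i) (S i.+1).
  case E : (odd i); first exact: odS.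
  by apply: evS; rewrite E.
have step i (D : {D | state i D}) : exists D' : {D' | state i.+1 D'}, tilts (odd i) (sval D) (sval D').
  case: D => D [gD pD] /=.
  have [D' [gD' t pD']] := tilt_step artK (gS i) gD pD (gS i.+1) (tS i).
  by exists (exist _ D' (conj gD' pD')).
have f i : {f : {D | state i D} -> {D' | state i.+1 D'} & forall D : {D | state i D}, tilts (odd i) (sval D) (sval (f D))}.
  exact: choice (step i).
have s0 : state 0 C by split=> //; rewrite S0.
pose s := fix s n : {D | state n D} := if n is n'.+1 then projT1 (f n') (s n') else exist _ C s0.
have ts i : tilts (odd i) (sval (s i)) (sval (s i.+1)) := projT2 (f i) (s i).
exists (fun n => sval (s n)); split=> //.
- by move=> i; case: (svalP (s i)).
- by move=> i oi; have : tilts (odd i) (sval (s i)) (sval (s i.+1)) := ts i; rewrite (negbTE oi).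
by move=> i oi; have : tilts (odd i) (sval (s i)) (sval (s i.+1)) := ts i; rewrite oi.
Qed.

End Sides.

(** * Triangular matrix algebras *)

Section SplitCorner.
Variables (R B : nzRingType) (pi : {rmorphism R -> B}) (io : nuhom B R).
Hypothesis pi_io : forall b, pi (io b) = b.

Lemma res_corner_iso (X : lmodType R) : (forall r (x : X), r *: x = io (pi r) *: x) ->
  lmod_iso (res_mod pi (corner_mod io X)) X.
Proof.
move=> H.
have lf : linear (fun x : res_mod pi (corner_mod io X) => val x).
  by move=> r x y; rewrite -[LHS]/(io (pi r) *: val x + val y) -H.
apply: (@iso_of_bij _ _ _ (lin_of lf)) => [x y|x]; first exact: val_inj.
have Hx : io 1 *: x = x by rewrite -(rmorph1 pi) -H scale1r.
by exists (to_cor Hx).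
Qed.

Hypothesis io_absorb : forall r, r * io 1 = io (pi r).

(** With e = io 1, [io_absorb] gives Re = eRe, so Hom_R(P, Y) = Hom_B(P, eY), and taking corners is
    exact. *)
Lemma res_proj (P : lmodType B) : projective P -> projective (res_mod pi P).
Proof.
move=> pP X Y g f sg.
have Hf p : io 1 *: f p = f p.
  by rewrite -linearZZ -[_ *: p]/(pi (io 1) *: (p : P)) pi_io scale1r.
have lf : linear (fun p : P => to_cor (Hf p) : corner_mod io Y).
  move=> b x y; apply: val_inj; rewrite /= -linearZZ -linearD; congr (f (_ + _)).
  by rewrite -[RHS]/(pi (io b) *: (x : P)) pi_io.
have sc : surj (corl io g).
  move=> y; have [x gx] := sg (val y).
  exists (to_cor (cor_scaleP io 1 x)); apply: val_inj.
  by rewrite /= linearZZ gx corP.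
have [h Hh] := pP _ _ (corl io g) (lin_of lf) sc.
have lh : linear (fun p : res_mod pi P => val (h p)).
  move=> r x y; rewrite -[r *: x]/(pi r *: (x : P)) linearP /=; congr (_ + _).
  by rewrite -io_absorb -scalerA corP.
by exists (lin_of lh) => p; rewrite -[LHS]/(val (corl io g (h p))) Hh.
Qed.

Lemma res_pd n (X : lmodType B) : pd n X -> pd n (res_mod pi X).
Proof.
elim: n X => [|n IH] X; first exact: res_proj.
move=> [L [P [f [g [fg pP pL]]]]].
exists (res_mod pi L), (res_mod pi P), (resl pi f), (resl pi g); split.
- exact: ses_res.
- exact: res_proj.
exact: IH.
Qed.

End SplitCorner.

(** Projective [R]-modules have dimension at most [d] over [S], and each step of a resolution adds
    1. *)
Lemma pd_res_bound (S R : nzRingType) (K : comNzRingType) (th : {rmorphism K -> R})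
    (phi : {rmorphism S -> R}) d : fl th R^o -> pd d (res_mod phi R^o) ->
  forall n (X : lmodType R), fl th X -> pd n X -> pd (n + d) (res_mod phi X).
Proof.
move=> Rfin pR.
have pF k : pd d (res_mod phi (free_mod R k)).
  have lf : linear ((fun x => x) : {ffun 'I_k -> res_mod phi R^o} -> res_mod phi (free_mod R k)).
    by move=> a x y; apply/ffunP => i; rewrite !ffunE.
  apply: pd_iso (pd_pow k pR); apply: (@iso_of_bij _ _ _ (lin_of lf)) => [x y|x] //.
  by exists x.
elim=> [|n IH] X fX pX; have [k [L [i [p [ip fL]]]]] := fl_pres Rfin fX.
  have [s ps] := proj_split ip pX.
  by apply: pd_summand (pF k); exists (resl phi s), (resl phi p).
apply: (pd_right (ses_res phi ip)); first by apply: IH => //; apply: pd_syz ip _ pX; apply: proj_free.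
by apply: pd_le (pF k); apply: leq_addl.
Qed.

Section BasicExtension.
Variables (R A B : nzRingType) (pA : {rmorphism R -> A}) (pB : {rmorphism R -> B}).
Hypothesis pAB : forall a b, exists r, pA r = a /\ pB r = b.
Hypothesis sq0 : forall m, pA m = 0 -> pB m = 0 -> m * m = 0.

(** If [x] is radical in [A] and in [B], inverses of 1 - x there lift to [r] with r (1 - x) = 1 + k
    and k^2 = 0; then 1 - k corrects [r]. *)
Lemma basic_extension : fin_len A^o -> fin_len B^o -> basic_ring A -> basic_ring B -> basic_ring R.
Proof.
move=> fA fB [n [D [pi [dD sD kD]]]] [m [D' [pi' [dD' sD' kD']]]].
pose DD (s : 'I_n + 'I_m) : nzRingType := match s with inl j => D j | inr j => D' j end.
pose PP (s : 'I_n + 'I_m) : {rmorphism R -> DD s} :=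
  match s return {rmorphism R -> DD s} with inl j => pi j \o pA | inr j => pi' j \o pB end.
apply: (@basic_ringI R (n + m) (fun i => DD (split i)) (fun i => PP (split i))).
- by move=> i; case: (split i) => j; [apply: dD | apply: dD'].
(* The family [d] is transported along [unsplitK]; decidable equality of indices removes the
   transport in the end. *)
- move=> d; pose d' s : DD s := eq_rect _ DD (d (unsplit s)) _ (unsplitK s).
  have [a Ha] := sD (fun j => d' (inl j)); have [b Hb] := sD' (fun j => d' (inr j)).
  have [r [Er Er']] := pAB a b; exists r => i.
  have -> : PP (split i) r = d' (split i).
    case: (split i) => j; first by rewrite -[LHS]/(pi j (pA r)) Er; apply: Ha.
    by rewrite -[LHS]/(pi' j (pB r)) Er'; apply: Hb.
  rewrite /d'; move: (unsplitK (split i)); move: (unsplit (split i)) (splitK i) => i' -> E.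
  by rewrite (eq_axiomK E).
move=> x x0.
have Ja : jacobson_radical (pA x).
  by apply/kD => j; have := x0 (unsplit (inl j)); rewrite unsplitK.
have Jb : jacobson_radical (pB x).
  by apply/kD' => j; have := x0 (unsplit (inr j)); rewrite unsplitK.
have [a [Ea _]] := jacobson_inv fA Ja; have [b [Eb _]] := jacobson_inv fB Jb.
have [r [Er Er']] := pAB a b; pose k := r * (1 - x) - 1.
have kk : k * k = 0.
  by apply: sq0; rewrite /k rmorphB rmorphM rmorphB !rmorph1 ?Er ?Er' ?Ea ?Eb subrr.
exists ((1 - k) * r); rewrite -mulrA.
have -> : r * (1 - x) = 1 + k by rewrite /k [RHS]addrC subrK.
by rewrite mulrBl mul1r mulrDr mulr1 kk addr0 addrK.
Qed.

End BasicExtension.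

Section BimoduleLength.
Variables (K : comNzRingType) (A B : algType K) (M : bimodType A B).

(** The products of bimodule generators with [K]-generators of [B] generate over [A], since scalars
    of [K] pass from right to left. *)
Lemma bimod_fl : fl (in_alg A) A^o -> fin_gen B -> fin_gen_bimod M -> fl (in_alg A) M.
Proof.
move=> fA [q [b Hb]] [n [g Hg]]; apply/(fl_gen fA).
have lf i j : linear (fun a : A^o => a *: ract (g i) (b j)).
  by move=> c x y; rewrite scalerDl scalerA.
pose f := powsuml (fun i => powsuml (fun j => lin_of (lf i j))).
have fE u : f u = \sum_i \sum_j u i j *: ract (g i) (b j) by [].
have [I0 ID] := im_submod f.
have IA x y : (exists u, f u = x) -> (exists u, f u = y) -> exists u, f u = x + y.
  by move=> Ix Iy; have := ID 1 _ _ Ix Iy; rewrite scale1r.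
have IZ a x : (exists u, f u = x) -> exists u, f u = a *: x.
  by move=> Ix; have := ID a _ _ Ix I0; rewrite addr0.
have Isum (T : Type) (s : seq T) (F : T -> M) :
    (forall t, exists u, f u = F t) -> exists u, f u = \sum_(t <- s) F t.
  by move=> H; elim/big_ind: _ => [|x y|t _]; [apply: I0 | apply: IA | apply: H].
have Igen i j : exists u, f u = ract (g i) (b j).
  exists [ffun i' => [ffun j' => ((i' == i) && (j' == j))%:R : A^o]].
  rewrite fE (bigD1 i) //= [X in _ + X]big1 => [|i' /negbTE ni].
    rewrite addr0 (bigD1 j) //= !ffunE !eqxx scale1r big1 ?addr0 // => j' /negbTE nj.
    by rewrite !ffunE nj andbF scale0r.
  by apply: big1 => j' _; rewrite !ffunE ni scale0r.
apply: (@fin_gen_surj _ _ _ f).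
  move=> m; have [t ->] := Hg m; apply: (Isum _ _ _) => -[[a i] y] /=.
  have [c ->] := Hb y; rewrite ract_scale; apply: (IZ _ _).
  have -> : ract (g i) (\sum_j c j *: b j) = \sum_j (c j)%:A *: ract (g i) (b j).
    elim/big_rec2: _ => [|j u v _ IH]; last by rewrite ractDr ract_alg_scale IH.
    by apply: (addrI (ract (g i) 0)); rewrite -ractDr !addr0.
  by apply: (Isum _ _ _) => j; apply: (IZ _ _).
by apply/(fl_gen fA); do 2!apply: fl_pow.
Qed.

End BimoduleLength.

Section Triangular.
Variables (K : comNzRingType) (A B R : algType K).
Variables (pA : {rmorphism R -> A}) (pB : {rmorphism R -> B}) (ioA : nuhom A R) (ioB : nuhom B R).
Hypotheses (pAK : forall a, pA (ioA a) = a) (pBK : forall b, pB (ioB b) = b).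
Hypothesis io_sum : ioA 1 + ioB 1 = 1.
Hypothesis corA : forall r, ioA 1 * r * ioA 1 = ioA (pA r).
Hypothesis ioA_alg : forall k, ioA k%:A = ioA 1 * k%:A.
Hypothesis ioB_alg : forall k, ioB k%:A = ioB 1 * k%:A.
Hypothesis pB_ioA : forall a, pB (ioA a) = 0.
Hypothesis pA_ioB : forall b, pA (ioB b) = 0.
Hypothesis sq0 : forall m, pA m = 0 -> pB m = 0 -> m * m = 0.
Hypothesis Bfin : fl (in_alg B) B^o.
Hypothesis Afin : fl (in_alg A) A^o.

Lemma triangular_basic : basic_ring A -> basic_ring B -> basic_ring R.
Proof.
apply: (basic_extension (pA := pA) (pB := pB)) => //; [|exact: fl_fin_len Afin|exact: fl_fin_len Bfin].
move=> a b; exists (ioA a + ioB b).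
by rewrite !rmorphD /= pAK pBK pB_ioA pA_ioB addr0 add0r.
Qed.

Lemma triangular_killed (X : lmodType R) (x : X) : zero_mod (corner_mod ioA X) -> ioB 1 *: x = x.
Proof.
move=> X0; rewrite -[RHS]scale1r -io_sum scalerDl.
have := congr1 val (X0 (to_cor (cor_scaleP ioA 1 x))); rewrite /= => ->.
by rewrite add0r.
Qed.

(** [d] is the loss of dimension when a [B]-module is viewed over [R]: 0 in the lower case, one more
    than the dimension bound for [M] in the upper case. *)
Lemma triangular_good d :
  (forall r (X : lmodType R) (x : X), (forall y : X, ioB 1 *: y = y) -> r *: x = ioB (pB r) *: x) ->
  (exists m, pd m (eR ioA)) -> fin_gldim B ->
  (forall m (X : lmodType B), fl (in_alg B) X -> pd m X -> pd (m + d) (res_mod pB X)) ->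
  good_pair false A R.
Proof.
move=> H pe [m Hm] Hd; exists ioA; split=> //.
- split; first exact: can_inj pAK.
  by move=> r; exists (pA r).
exists (m + d)%N => X fX X0.
have cR : central (in_alg R) := side_central (b := false) (C := R).
apply: pd_iso (res_corner_iso (pi := pB) (io := ioB) _) _.
  by move=> r x; apply: H => y; apply: triangular_killed.
apply: Hd; last exact: pd_of_res.
exact: (@fl_cor K B R (in_alg B) (in_alg R) ioB cR ioB_alg X fX).
Qed.

End Triangular.

Lemma corner_transfer (K : comNzRingType) (A R : algType K) : artinian K ->
  artin_algebra A -> good_alg R -> good_pair false A R -> Pfin_contravariantly_finite A ->
  Pfin_contravariantly_finite R /\ (unlimited_strong_tilting A -> unlimited_strong_tilting R).
Proof.
move=> artK [_ gA] gR good cf; split; last exact: unlimited_of_corner.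
have finK := artinian_fin_len artK; have [io gio] := good; have [[_ fR] _] := gR.
have Afin := proj1 (side_fin false A finK) gA; have Rfin := proj1 (side_fin false R finK) fR.
exact: (cf_of_corner gio (side_central (b := false) (C := R)) Afin Rfin cf).
Qed.

Lemma ractr0 (K : comNzRingType) (A B : algType K) (M : bimodType A B) (m : M) :
  ract m (0 : B) = 0.
Proof. by apply: (addrI (ract m 0)); rewrite -ractDr !addr0. Qed.

Section Lower.
Variables (K : comNzRingType) (A B : algType K) (N : bimodType B A).
Local Notation L := (lower_tri N).

Definition lt_pA : {rmorphism L -> A} := HB.pack (fun x : L => x.1.1)
  (GRing.isZmodMorphism.Build L A (fun x : L => x.1.1) (fun x y => erefl))
  (GRing.isMonoidMorphism.Build L A (fun x : L => x.1.1) (conj erefl (fun x y => erefl))).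
Definition lt_pB : {rmorphism L -> B} := HB.pack (fun x : L => x.2)
  (GRing.isZmodMorphism.Build L B (fun x : L => x.2) (fun x y => erefl))
  (GRing.isMonoidMorphism.Build L B (fun x : L => x.2) (conj erefl (fun x y => erefl))).

Definition lt_inA (a : A) : L := (a, 0, 0).
Definition lt_inB (b : B) : L := (0, 0, b).
Fact lt_inA_D : {morph lt_inA : a b / a + b}.
Proof. by move=> a b; apply: lt_eq => /=; rewrite ?addr0. Qed.
Fact lt_inA_M : {morph lt_inA : a b / a * b}.
Proof. by move=> a b; apply: lt_eq => /=; rewrite ?ract0 ?scaler0 ?addr0 ?mulr0. Qed.
Fact lt_inB_D : {morph lt_inB : a b / a + b}.
Proof. by move=> a b; apply: lt_eq => /=; rewrite ?addr0. Qed.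
Fact lt_inB_M : {morph lt_inB : a b / a * b}.
Proof. by move=> a b; apply: lt_eq => /=; rewrite ?ract0 ?scaler0 ?addr0 ?mulr0. Qed.
Definition lt_ioA : nuhom A L := Nuhom lt_inA_D lt_inA_M.
Definition lt_ioB : nuhom B L := Nuhom lt_inB_D lt_inB_M.

Lemma lt_absorb (r : L) : r * lt_ioB 1 = lt_ioB (lt_pB r).
Proof. by apply: lt_eq => /=; rewrite ?mulr0 ?mulr1 ?scaler0 ?ractr0 ?addr0. Qed.

Lemma lt_finite : fin_len K^o -> fin_gen A -> fin_gen B -> fin_gen_bimod N -> fin_gen L.
Proof.
move=> finK gA gB gN; have Bfin := proj1 (side_fin false B finK) gB.
pose X : lmodType K := (A * res_mod (in_alg B) N * B)%type.
have lf : linear ((fun x => x) : X -> L) by [].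
apply: (@fin_gen_surj _ _ _ (lin_of lf)); first by move=> x; exists x.
apply: fin_gen_of_len; apply: fin_len_prod; last exact: fin_len_of_gen.
by apply: fin_len_prod; [apply: fin_len_of_gen | apply: bimod_fl].
Qed.

Lemma lower_tri_good : fin_len K^o -> artin_algebra A -> basic_ring A ->
  artin_algebra B -> basic_ring B -> fin_gen_bimod N -> fin_gldim B ->
  good_alg L /\ good_pair false A L.
Proof.
move=> finK [artK gA] bA [_ gB] bB gN gdB.
have gL := lt_finite finK gA gB gN.
have Afin := proj1 (side_fin false A finK) gA; have Bfin := proj1 (side_fin false B finK) gB.
have Rfin := proj1 (side_fin false L finK) gL.
have pAK a : lt_pA (lt_ioA a) = a by [].
have pBK b : lt_pB (lt_ioB b) = b by [].
have pAB b : lt_pA (lt_ioB b) = 0 by [].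
have pBA a : lt_pB (lt_ioA a) = 0 by [].
have sq0 (m : L) : lt_pA m = 0 -> lt_pB m = 0 -> m * m = 0.
  case: m => [[a n] b] /= -> ->.
  by apply: lt_eq => /=; rewrite ?mulr0 // ractr0 scale0r addr0.
have io_sum : lt_ioA 1 + lt_ioB 1 = 1 by apply: lt_eq => /=; rewrite ?addr0 ?add0r.
have eA r : lt_ioA 1 * r = lt_ioA (lt_pA r).
  by apply: lt_eq => /=; rewrite ?mul1r ?mul0r ?scale0r ?addr0 ?ract0.
have corA r : lt_ioA 1 * r * lt_ioA 1 = lt_ioA (lt_pA r).
  by rewrite eA -nuM mulr1.
have algA k : lt_ioA k%:A = lt_ioA 1 * k%:A.
  by rewrite eA; congr (lt_ioA _).
have algB k : lt_ioB k%:A = lt_ioB 1 * k%:A.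
  apply: lt_eq; rewrite /= ?mul1r ?mul0r //.
  by rewrite ract0 scale1r scaler0 addr0.
split.
  by split=> //; apply: (triangular_basic pAK pBK pBA pAB sq0).
apply: (@triangular_good K A B L lt_pA lt_pB lt_ioA lt_ioB pAK io_sum corA algA algB 0) => //.
- by move=> r X x H; rewrite -lt_absorb -scalerA H.
- exists 0%N.
  have lf : linear (fun y : eR lt_ioA => lt_pA (val y) : A^o).
    by [].
  apply: (proj_iso _ (@proj_free1 A)); apply: (@iso_of_bij _ _ _ (lin_of lf)) => [x y E|a].
    by apply: val_inj; rewrite -(corP x) -(corP y) /= -![_ *: _]/(_ * _ : L) !eA; congr (lt_ioA _).
  have Ha : lt_ioA 1 *: (lt_ioA a : L^o) = lt_ioA a by rewrite -[LHS]/(lt_ioA 1 * lt_ioA a) -nuM mul1r.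
  by exists (@to_cor _ _ lt_ioA L^o _ Ha).
by move=> m X _ pX; rewrite addn0; apply: (res_pd pBK lt_absorb).
Qed.

End Lower.

Section Upper.
Variables (K : comNzRingType) (A B : algType K) (M : bimodType A B).
Local Notation U := (upper_tri M).

Definition ut_pA : {rmorphism U -> A} := HB.pack (fun x : U => x.1.1)
  (GRing.isZmodMorphism.Build U A (fun x : U => x.1.1) (fun x y => erefl))
  (GRing.isMonoidMorphism.Build U A (fun x : U => x.1.1) (conj erefl (fun x y => erefl))).
Definition ut_pB : {rmorphism U -> B} := HB.pack (fun x : U => x.2)
  (GRing.isZmodMorphism.Build U B (fun x : U => x.2) (fun x y => erefl))
  (GRing.isMonoidMorphism.Build U B (fun x : U => x.2) (conj erefl (fun x y => erefl))).

Definition ut_inA (a : A) : U := (a, 0, 0).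
Definition ut_inB (b : B) : U := (0, 0, b).
Fact ut_inA_D : {morph ut_inA : a b / a + b}.
Proof. by move=> a b; apply: ut_eq => /=; rewrite ?addr0. Qed.
Fact ut_inA_M : {morph ut_inA : a b / a * b}.
Proof. by move=> a b; apply: ut_eq => /=; rewrite ?ract0 ?scaler0 ?addr0 ?mulr0. Qed.
Fact ut_inB_D : {morph ut_inB : a b / a + b}.
Proof. by move=> a b; apply: ut_eq => /=; rewrite ?addr0. Qed.
Fact ut_inB_M : {morph ut_inB : a b / a * b}.
Proof. by move=> a b; apply: ut_eq => /=; rewrite ?ract0 ?scaler0 ?addr0 ?mulr0. Qed.
Definition ut_ioA : nuhom A U := Nuhom ut_inA_D ut_inA_M.
Definition ut_ioB : nuhom B U := Nuhom ut_inB_D ut_inB_M.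

(** In the upper algebra it is the projective [A]-modules, not the [B]-modules, that stay projective
    by this absorption; hence the detour through A + M. *)
Lemma ut_absorbA (r : U) : r * ut_ioA 1 = ut_ioA (ut_pA r).
Proof. by apply: ut_eq => /=; rewrite ?mulr0 ?mulr1 ?scaler0 ?ractr0 ?addr0. Qed.

Lemma ut_absorbB (r : U) : ut_ioB 1 * r = ut_ioB (ut_pB r).
Proof. by apply: ut_eq => /=; rewrite ?mul0r ?mul1r ?scale0r ?ract0 ?addr0. Qed.

(** The corner condition on eR becomes one on [M]; in the lower case eR is just [A]. *)
Lemma ut_corner_iso : lmod_iso (eR ut_ioA) (A^o * M)%type.
Proof.
have lf : linear (fun y : eR ut_ioA => ((val y : U).1.1 : A^o, (val y : U).1.2)).
  by move=> a x y; congr (_, _); rewrite /= ract0 addr0.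
have eA (r : U) : (ut_ioA 1 : U) *: (r : U^o) = ((r.1.1, r.1.2, 0) : U).
  by apply: ut_eq; rewrite /= ?mul1r ?mul0r ?scale1r ?ract0 ?addr0.
apply: (@iso_of_bij _ _ _ (lin_of lf)) => [x y [E1 E2]|[a m]].
  by apply: val_inj; rewrite -(corP x) -(corP y) !eA E1 E2.
by exists (@to_cor _ _ ut_ioA U^o ((a, m, 0) : U) (eA _)).
Qed.

(** The kernel of [ut_pB] is A + M with [U] acting through [A]. Restriction along [ut_pA] preserves
    projectives, so its dimension over [U] is at most [d]. *)
Lemma ut_res_pd d : pd d M -> pd d.+1 (res_mod ut_pB B^o).
Proof.
move=> pM; have pAM : pd d (A^o * M)%type.
  by apply: pd_prod pM; apply: (pd_le (leq0n d)); apply: (@proj_free1 A).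
have lf : linear (fun x : res_mod ut_pA (A^o * M)%type => ((x.1, x.2, 0) : U^o)).
  by move=> r x y; apply: ut_eq; rewrite /= ?mulr0 ?ractr0 ?addr0.
have lg : linear (fun r : U^o => ut_pB r : res_mod ut_pB B^o) by [].
apply: (@pd_right _ d _ _ _ (lin_of lf) (lin_of lg)).
- split=> [[a m] [a' m'] [-> ->]//|[[a m] b]|b]; last by exists (ut_inB b).
  split=> [/= ->|[[a' m'] [_ _ <-]]//]; by exists (a, m).
- by apply: (res_pd (io := ut_ioA)) pAM => // r; apply: ut_absorbA.
by apply: (pd_le (leq0n d)); apply: (@proj_free1 U).
Qed.

Lemma ut_finite : fin_len K^o -> fin_gen A -> fin_gen B -> fin_gen_bimod M -> fin_gen U.
Proof.
move=> finK gA gB gM; have Afin := proj1 (side_fin false A finK) gA.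
pose X : lmodType K := (A * res_mod (in_alg A) M * B)%type.
have lf : linear ((fun x => x) : X -> U) by [].
apply: (@fin_gen_surj _ _ _ (lin_of lf)); first by move=> x; exists x.
apply: fin_gen_of_len; apply: fin_len_prod; last exact: fin_len_of_gen.
by apply: fin_len_prod; [apply: fin_len_of_gen | apply: bimod_fl].
Qed.

Lemma upper_tri_good : fin_len K^o -> artin_algebra A -> basic_ring A ->
  artin_algebra B -> basic_ring B -> fin_gen_bimod M -> fin_gldim B -> fin_pdim M ->
  good_alg U /\ good_pair false A U.
Proof.
move=> finK [artK gA] bA [_ gB] bB gM gdB /fin_pdimE [d pM].
have gU := ut_finite finK gA gB gM.
have Afin := proj1 (side_fin false A finK) gA; have Bfin := proj1 (side_fin false B finK) gB.
have Rfin := proj1 (side_fin false U finK) gU.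
have pAK a : ut_pA (ut_ioA a) = a by [].
have pBK b : ut_pB (ut_ioB b) = b by [].
have pAB b : ut_pA (ut_ioB b) = 0 by [].
have pBA a : ut_pB (ut_ioA a) = 0 by [].
have sq0 (m : U) : ut_pA m = 0 -> ut_pB m = 0 -> m * m = 0.
  case: m => [[a n] b] /= -> ->.
  by apply: ut_eq => /=; rewrite ?mulr0 // ractr0 scale0r addr0.
have io_sum : ut_ioA 1 + ut_ioB 1 = 1 by apply: ut_eq => /=; rewrite ?addr0 ?add0r.
have corA r : ut_ioA 1 * r * ut_ioA 1 = ut_ioA (ut_pA r).
  by rewrite -mulrA ut_absorbA -nuM mul1r.
have algA k : ut_ioA k%:A = ut_ioA 1 * k%:A.
  apply: ut_eq; rewrite /= ?mul1r ?mul0r //.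
  by rewrite ract0 scale1r scaler0 addr0.
have algB k : ut_ioB k%:A = ut_ioB 1 * k%:A by rewrite ut_absorbB; congr (ut_ioB _).
split.
  by split=> //; apply: (triangular_basic pAK pBK pBA pAB sq0).
apply: (@triangular_good K A B U ut_pA ut_pB ut_ioA ut_ioB pAK io_sum corA algA algB d.+1) => //.
- by move=> r X x H; rewrite -[LHS]H scalerA ut_absorbB.
- exists d; apply: pd_iso (iso_sym ut_corner_iso) _.
  by apply: pd_prod pM; apply: (pd_le (leq0n d)); apply: (@proj_free1 A).
by move=> m X; apply: (pd_res_bound Bfin); apply: ut_res_pd.
Qed.

End Upper.

Theorem corollary6p7 (K : comNzRingType) (A B : algType K)
    (M : bimodType A B) (N : bimodType B A)
    (K_artinian : artinian K)
    (A_artin : artin_algebra A) (A_basic : basic_ring A)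
    (B_artin : artin_algebra B) (B_basic : basic_ring B)
    (M_fg : fin_gen_bimod M) (N_fg : fin_gen_bimod N)
    (B_gldim : fin_gldim B)
    (A_cf : Pfin_contravariantly_finite A) :
  (Pfin_contravariantly_finite (lower_tri N) /\
   (unlimited_strong_tilting A -> unlimited_strong_tilting (lower_tri N))) /\
  (fin_pdim M ->
   Pfin_contravariantly_finite (upper_tri M) /\
   (unlimited_strong_tilting A -> unlimited_strong_tilting (upper_tri M))).
Proof.
have finK := artinian_fin_len K_artinian.
split=> [|pM].
  have [gL gAL] := lower_tri_good finK A_artin A_basic B_artin B_basic N_fg B_gldim.
  exact: corner_transfer.
have [gU gAU] := upper_tri_good finK A_artin A_basic B_artin B_basic M_fg B_gldim pM.
exact: corner_transfer.
Qed.
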